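(* Assume hypothesis $(\mathrm{H}_3)$: for every $n\ge3$, every $\rho\in[-1,0]$ and every measurable $f:\mathbb{R}^n\to B^3$, $\mathrm{Stab}_\rho[f]\ge\mathrm{Stab}_\rho[f^{(3)}_{\mathrm{opt}}]$ with $f^{(3)}_{\mathrm{opt}}(x)=(x_1,x_2,x_3)/\|(x_1,x_2,x_3)\|$. Then \[\inf_G\frac{\mathrm{QMaxCut}(G)}{\mathrm{SDP}_{\mathrm{QMC}}(G)}=\alpha_{\mathrm{GP}},\] the infimum being over all weighted graphs $G$ without self-loops.
   Context: $\mathrm{Stab}_\rho[f]=\mathbb{E}_{\mathbf{x}\sim_\rho\mathbf{y}}\langle f(\mathbf{x}),f(\mathbf{y})\rangle$ for $\rho$-correlated standard Gaussians. A weighted graph $G=(V,E,w)$ is a finite undirected graph with nonnegative edge weights summing to $1$. With Pauli matrices $X,Y,Z$, $h=\tfrac14(I\otimes I-X\otimes X-Y\otimes Y-Z\otimes Z)$, $H_G=\sum_{(u,v)\in E}w_{u,v}h_{u,v}$ on $(\mathbb{C}^2)^{\otimes V}$, and $\mathrm{QMaxCut}(G)=\lambda_{\max}(H_G)$. $\mathrm{SDP}_{\mathrm{QMC}}(G)=\max_{f:V\to S^{|V|-1}}\mathbb{E}_{(\mathbf{u},\mathbf{v})\sim E}[\tfrac14-\tfrac34\langle f(\mathbf{u}),f(\mathbf{v})\rangle]$. $F^*(3,\rho)=\mathbb{E}\langle\mathbf{Z}u/\|\mathbf{Z}u\|,\mathbf{Z}v/\|\mathbf{Z}v\|\rangle$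 for unit vectors $u,v$ with $\langle u,v\rangle=\rho$ and $\mathbf{Z}$ a $3\times m$ matrix of i.i.d. standard Gaussians, and $\alpha_{\mathrm{GP}}=\min_{-1\le\rho<1/3}\frac{\frac14-\frac14F^*(3,\rho)}{\frac14-\frac34\rho}$ ($\approx0.498$). *)

(* Defs.v *)
From HB Require Import structures.
From mathcomp Require Import all_boot all_order all_algebra.
From mathcomp Require Import all_classical all_reals all_analysis.
From mathcomp Require Import complex.

Set Implicit Arguments.
Unset Strict Implicit.
Unset Printing Implicit Defensive.

Import Order.TTheory GRing.Theory Num.Theory.
Import numFieldNormedType.Exports.
Local Open Scope classical_set_scope.
Local Open Scope ring_scope.

Section Defs.
Variable R : realType.

Definition dotm (p q : nat) (a b : 'M[R]_(p, q)) : R :=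
  \sum_(i < p) \sum_(j < q) a i j * b i j.

Definition enorm (p q : nat) (a : 'M[R]_(p, q)) : R := Num.sqrt (dotm a a).

(* a / ||a||  (equal to 0 when a = 0, a null event below) *)
Definition normalize (p q : nat) (a : 'M[R]_(p, q)) : 'M[R]_(p, q) :=
  (enorm a)^-1 *: a.

Definition borel_rV (n : nat) : set (set 'rV[R]_n) :=
  smallest (sigma_algebra setT) (@open 'rV[R]_n).

Definition borel_measurable_rV (n m : nat) (f : 'rV[R]_n -> 'rV[R]_m) : Prop :=
  forall B, borel_rV B -> borel_rV (f @^-1` B).

Fixpoint gaussE (n : nat) : ('rV[R]_n -> R) -> R :=
  match n return ('rV[R]_n -> R) -> R with
  | 0 => fun g => g 0
  | k.+1 => fun g =>
      Rintegral (@lebesgue_measure R) setT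
        (fun t : R => normal_pdf 0 1 t *
                      gaussE (fun x : 'rV[R]_k => g (row_mx (t%:M : 'rV[R]_1) x)))
  end.

(* Stab_rho[f] = E_{x ~_rho y} <f(x), f(y)> where (x, y) are rho-correlated
   standard Gaussians on R^n, realised as y = rho x + sqrt(1 - rho^2) z with
   x, z independent standard Gaussians on R^n. *)
Definition Stab (n m : nat) (rho : R) (f : 'rV[R]_n -> 'rV[R]_m) : R :=
  gaussE (fun w : 'rV[R]_(n + n) =>
    dotm (f (lsubmx w))
         (f (rho *: lsubmx w + Num.sqrt (1 - rho ^+ 2) *: rsubmx w))).

Definition in_ball (m : nat) (y : 'rV[R]_m) : Prop := enorm y <= 1.

(* first three coordinates of x (n >= 3 in use) *)
Definition proj3 (n : nat) (x : 'rV[R]_n) : 'rV[R]_3 :=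
  \row_(i < 3) (if @insub _ (fun k => k < n)%N _ (val i) is Some j
                then x ord0 j else 0).

Definition fopt3 (n : nat) (x : 'rV[R]_n) : 'rV[R]_3 := normalize (proj3 x).

Definition hyp_H3 : Prop :=
  forall (n : nat), (3 <= n)%N ->
  forall rho : R, -1 <= rho <= 0 ->
  forall f : 'rV[R]_n -> 'rV[R]_3,
    borel_measurable_rV f -> (forall x, in_ball (f x)) ->
    Stab rho (@fopt3 n) <= Stab rho f.

(* F*(3,rho) = E < Z u/||Z u||, Z v/||Z v|| >, Z a 3 x m matrix of iid
   standard Gaussians, u, v unit vectors with <u,v> = rho.  We take m = 2,
   u = (1,0), v = (rho, sqrt(1-rho^2)). *)
Definition ustar : 'cV[R]_2 := \col_(j < 2) (if j == 0 :> nat then 1 else 0).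
Definition vstar (rho : R) : 'cV[R]_2 :=
  \col_(j < 2) (if j == 0 :> nat then rho else Num.sqrt (1 - rho ^+ 2)).

Definition Fstar3 (rho : R) : R :=
  gaussE (fun w : 'rV[R]_(3 * 2) =>
    let Z : 'M[R]_(3, 2) := vec_mx w in
    dotm (normalize (Z *m ustar)) (normalize (Z *m vstar rho))).

Definition alphaGP : R :=
  inf [set ((4^-1 - 4^-1 * Fstar3 rho) / (4^-1 - 3 / 4 * rho)) | rho in
       [set rho : R | -1 <= rho /\ rho < 3^-1]].

(* w u v = weight of the undirected edge {u,v}; symmetric, no self-loops,
   nonnegative, total weight (over unordered pairs u < v) equal to 1.
   Pairs with w u v = 0 are non-edges. *)
Definition wgraph (n : nat) (w : 'I_n -> 'I_n -> R) : Prop :=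
  [/\ forall u v, 0 <= w u v,
      forall u v, w u v = w v u,
      forall u, w u u = 0
    & \sum_(u < n) \sum_(v < n | (u < v)%N) w u v = 1].

Definition SDP_QMC (n : nat) (w : 'I_n -> 'I_n -> R) : R :=
  sup [set (\sum_(u < n) \sum_(v < n | (u < v)%N)
              w u v * (4^-1 - 3 / 4 * dotm (f u) (f v))) |
       f in [set f : 'I_n -> 'rV[R]_n | forall u, dotm (f u) (f u) = 1]].

Local Open Scope complex_scope.
Definition C := R[i].

Definition pauliI : 'M[C]_2 := \matrix_(a < 2, b < 2) (if a == b then 1 else 0).
Definition pauliX : 'M[C]_2 := \matrix_(a < 2, b < 2) (if a == b then 0 else 1).
Definition pauliY : 'M[C]_2 :=
  \matrix_(a < 2, b < 2)
    (if a == b then 0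
     else if a == 0 :> nat then (- 1) *i
     else 1 *i).
Definition pauliZ : 'M[C]_2 :=
  \matrix_(a < 2, b < 2)
    (if a == b then (if a == 0 :> nat then 1 else -1) else 0).

Definition kron2 (A B : 'M[C]_2) (p q : 'I_2 * 'I_2) : C :=
  A p.1 q.1 * B p.2 q.2.

Definition hQMC (p q : 'I_2 * 'I_2) : C :=
  (4%:R)^-1 * (kron2 pauliI pauliI p q - kron2 pauliX pauliX p q
                - kron2 pauliY pauliY p q - kron2 pauliZ pauliZ p q).

(* computational basis of (C^2)^{(x) V} *)
Definition basis (n : nat) := {ffun 'I_n -> 'I_2}.

(* h_{u,v}: h acting on qubits u and v, identity elsewhere *)
Definition h_edge (n : nat) (u v : 'I_n) (s t : basis n) : C :=
  hQMC (s u, s v) (t u, t v) *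
  \prod_(x < n | (x != u) && (x != v)) (if s x == t x then 1 else 0).

Definition H_G (n : nat) (w : 'I_n -> 'I_n -> R) : 'M[C]_(#|{: basis n}|) :=
  \matrix_(i, j)
    \sum_(u < n) \sum_(v < n | (u < v)%N)
       (w u v)%:C * h_edge u v (enum_val i) (enum_val j).

(* QMaxCut(G) = lambda_max(H_G) (H_G is Hermitian, so its eigenvalues are real) *)
Definition QMaxCut (n : nat) (w : 'I_n -> 'I_n -> R) : R :=
  sup [set lam : R | eigenvalue (H_G w) (lam%:C)].

End Defs.

(* Main.v *)
(* Lower bound: rounding an SDP solution [f] to the unit vectors [Z f(u) / |Z f(u)|] with one Gaussian matrix [Z]
   and taking the corresponding product state has expected energy [sum w (1/4 - 1/4 F*(3, <f(u), f(v)>))], which is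
   termwise at least [alphaGP] times the SDP value.

   Upper bound: for [rho] in [[-1, 0]], discretise a pair of rho-correlated Gaussians in high dimension and replace
   each cell by many copies. The normalised positions are vectors of average inner product close to [rho], hence the
   SDP value is at least about [1/4 - 3/4 rho]. A product state on the cells is a map from Gaussian space to the ball
   (average the copies of each cell), so (H3) bounds product energies by [1/4 - 1/4 F*(3, rho)]. On dense graphs
   product states are asymptotically optimal: measuring a qubit whose correlations with the others are not small
   increases the total squared Bloch length by a fixed amount, so after finitely many measurements all remaining
   correlations are small and the energy is that of a product state.

   For [rho] in [(0, 1/3)] the bound [F*(3, rho) <= 1/2 + 3/2 rho], which follows from the Dunkl-Williams inequality,
   makes the ratio at least [1/2], and this is at least the ratio at [rho = -1]. *)

(* (H3) speaks of maps into the ball, that is of product states, while [QMaxCut] allows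
   entanglement. The mean-field bound closes this gap, and its error tends to 0 when every weight is
   at most a constant over the squared number of vertices. This fixes the order of the choices:
   first the dimension and the cells, which determine that constant, then the parameter of the
   mean-field bound, and last the number of copies. Rounding, (H3) and [Fstar3] each use Gaussian
   vectors of a different dimension; they are compared through invariance under linear isometries,
   which has to be derived from the iterated one-dimensional integrals of [gaussE]. In the
   discretised graph single edges may have any inner product: the SDP value sees only the average,
   and an upper bound on it is enough. In the lower bound, edges with inner product at least 1/3
   contribute a nonpositive amount to the SDP and so do no harm. (H3) stops at [rho = 0], which is
   why the range up to 1/3 gets a direct estimate. *)
Require Import Defs.
From HB Require Import structures.
From mathcomp Require Import all_boot all_order all_algebra.
From mathcomp Require Import all_classical all_reals all_analysis.
From mathcomp Require Import complex ring lra measurable_realfun.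
Set Implicit Arguments.
Unset Strict Implicit.
Unset Printing Implicit Defensive.
Import Order.TTheory GRing.Theory Num.Theory.
Import numFieldNormedType.Exports.
Local Open Scope classical_set_scope.
Local Open Scope ring_scope.

(** * Rotation invariance of the Gaussian measure *)

Section lebesgue_plane.
Context {R : realType}.
Local Notation mu := (@lebesgue_measure R).
Local Open Scope ereal_scope.

(** Lebesgue measure is determined by the lengths of bounded half-open intervals, so it suffices to
    compare the image measure on these. *)
Lemma lebesgue_measure_shift (a : R) (A : set (measurableTypeR R)) :
  measurable A -> mu ((fun x => x + a)%R @^-1` A) = mu A.
Proof.
move=> mA.
have mf : measurable_fun [set: measurableTypeR R] (fun x : measurableTypeR R => (x + a)%R : measurableTypeR R).
  exact: measurable_funD.
pose nu := pushforward mu (fun x : measurableTypeR R => (x + a)%R : measurableTypeR R).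
pose f : {mfun measurableTypeR R >-> measurableTypeR R} := HB.pack (fun x : measurableTypeR R => (x + a)%R : measurableTypeR R)
  (isMeasurableFun.Build _ _ _ _ _ mf).
rewrite [RHS](@lebesgue_measure_unique _ (pushforward mu f))//=.
move=> X [[b c] /= _ <-]; rewrite /pushforward.
have -> : (fun x => (x + a)%R) @^-1` `]b, c]%classic = `](b - a)%R, (c - a)%R]%classic.
  by apply/seteqP; split => x /=; rewrite !in_itv/= ltrBlDr lerBrDr.
rewrite !lebesgue_measure_itv/= !lte_fin ltrD2r; case: ifP => // _.
by rewrite -!EFinB; congr EFin; lra.
Qed.

Lemma lebesgue_measure_opp (A : set (measurableTypeR R)) :
  measurable A -> mu (-%R @^-1` A) = mu A.
Proof.
move=> mA.
have mf : measurable_fun [set: measurableTypeR R] (fun x : measurableTypeR R => (- x)%R : measurableTypeR R).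
  exact: measurable_funN.
pose f : {mfun measurableTypeR R >-> measurableTypeR R} := HB.pack (fun x : measurableTypeR R => (- x)%R : measurableTypeR R)
  (isMeasurableFun.Build _ _ _ _ _ mf).
rewrite [RHS](@lebesgue_measure_unique _ (pushforward mu f))//=.
move=> X [[b c] /= _ <-]; rewrite /pushforward.
have -> : (fun x => (- x)%R) @^-1` `]b, c]%classic = `[(- c)%R, (- b)%R[%classic.
  by apply/seteqP; split => x /=; rewrite !in_itv/= => /andP[? ?]; apply/andP; split; lra.
rewrite !lebesgue_measure_itv/= !lte_fin ltrN2; case: ifP => // _.
by rewrite -!EFinB; congr EFin; lra.
Qed.

Lemma ge0_integral_shift (a : R) (f : R -> \bar R) :
  measurable_fun setT f -> (forall x, 0 <= f x) ->
  \int[mu]_x f (x + a)%R = \int[mu]_x f x.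
Proof.
move=> mf f0.
have mg : measurable_fun [set: measurableTypeR R] (fun x : measurableTypeR R => (x + a)%R : measurableTypeR R).
  exact: measurable_funD.
have := @ge0_integral_pushforward _ _ _ _ R _ mg mu setT f measurableT mf (fun x _ => f0 x).
rewrite preimage_setT => <-.
by apply: eq_measure_integral => A mA _; apply: lebesgue_measure_shift.
Qed.

Lemma ge0_integral_opp (f : R -> \bar R) :
  measurable_fun setT f -> (forall x, 0 <= f x) ->
  \int[mu]_x f (- x)%R = \int[mu]_x f x.
Proof.
move=> mf f0.
have mg : measurable_fun [set: measurableTypeR R] (fun x : measurableTypeR R => (- x)%R : measurableTypeR R).
  exact: measurable_funN.
have := @ge0_integral_pushforward _ _ _ _ R _ mg mu setT f measurableT mf (fun x _ => f0 x).
rewrite preimage_setT => <-.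
by apply: eq_measure_integral => A mA _; apply: lebesgue_measure_opp.
Qed.

Lemma ge0_integral_shear1 (k : R) (G : R * R -> \bar R) :
  measurable_fun setT G -> (forall x, 0 <= G x) ->
  \int[mu \x mu]_p G (p.1 + k * p.2, p.2)%R = \int[mu \x mu]_p G p.
Proof.
move=> mG G0.
rewrite fubini_tonelli2//; last first.
  apply: measurableT_comp => //; apply: measurable_fun_pair => //.
  by apply: measurable_funD => //; apply: measurable_funM.
rewrite [RHS]fubini_tonelli2//; apply: eq_integral => y _; rewrite /fubini_G/=.
apply: (@ge0_integral_shift (k * y) (fun x => G (x, y))) => //.
by apply: measurableT_comp => //; exact: measurable_pair2.
Qed.

Lemma ge0_integral_shear2 (k : R) (G : R * R -> \bar R) :
  measurable_fun setT G -> (forall x, 0 <= G x) ->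
  \int[mu \x mu]_p G (p.1, p.2 + k * p.1)%R = \int[mu \x mu]_p G p.
Proof.
move=> mG G0.
rewrite fubini_tonelli1//; last first.
  apply: measurableT_comp => //; apply: measurable_fun_pair => //.
  by apply: measurable_funD => //; apply: measurable_funM.
rewrite [RHS]fubini_tonelli1//; apply: eq_integral => y _; rewrite /fubini_F/=.
apply: (@ge0_integral_shift (k * y) (fun x => G (y, x))) => //.
by apply: measurableT_comp => //; exact: measurable_pair1.
Qed.

(* A rotation other than the half-turn is a product of three shears. *)
Lemma ge0_integral_rotation (c s : R) (G : R * R -> \bar R) :
  (c ^+ 2 + s ^+ 2 = 1)%R -> (c != -1)%R ->
  measurable_fun setT G -> (forall x, 0 <= G x) ->
  \int[mu \x mu]_p G (c * p.1 - s * p.2, s * p.1 + c * p.2)%R =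
  \int[mu \x mu]_p G p.
Proof.
(* [t] is the tangent of half the rotation angle; the shears have slopes [- t], [s], [- t], and the
   half-turn is the one angle at which [t] is undefined. *)
move=> cs c1 mG G0; pose t := (s / (1 + c))%R.
have c10 : (1 + c != 0)%R by rewrite addrC addr_eq0.
have mG1 : measurable_fun setT (fun p : R * R => G (p.1 + (- t) * p.2, p.2)%R).
  apply: measurableT_comp => //; apply: measurable_fun_pair => //.
  by apply: measurable_funD => //; apply: measurable_funM.
rewrite -[RHS](ge0_integral_shear1 (- t))//.
rewrite -[RHS](ge0_integral_shear2 s (G := fun p : R * R => G (p.1 + (- t) * p.2, p.2)%R))//=.
rewrite -[RHS](ge0_integral_shear1 (- t)
  (G := fun p : R * R => G (p.1 + (- t) * (p.2 + s * p.1), (p.2 + s * p.1))%R))//=; last first.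
  have m2 : measurable_fun setT (fun p : R * R => p.2 + s * p.1)%R.
    by apply: measurable_funD => //; apply: measurable_funM.
  apply: measurableT_comp => //; apply: measurable_fun_pair => //.
  by apply: measurable_funD => //; apply: measurable_funM.
have st : (s * t = 1 - c)%R by apply: (mulIf c10); rewrite /t mulrA divfK//; move: cs; lra.
have t1c : (t * (1 + c) = s)%R by rewrite /t divfK.
apply: eq_integral => -[x y] _ /=.
have e1 : (s * t * x = (1 - c) * x)%R by rewrite st.
have e2 : (s * t * y = (1 - c) * y)%R by rewrite st.
have e3 : (s * t * t * y = (1 - c) * t * y)%R by rewrite st.
have e4 : (t * (1 + c) * y = s * y)%R by rewrite t1c.
by congr (G (_, _)); lra.
Qed.

End lebesgue_plane.

(** * The standard normal law and its planar rotations *)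

Section normal_integral.
Context {R : realType}.
Local Notation mu := (@lebesgue_measure R).
Local Notation N01 := (normal_prob (0 : R) 1).
Local Open Scope ereal_scope.

(** The Radon-Nikodym derivative of [normal_prob] agrees with [normal_pdf] almost everywhere, as
    both have the same integral over every measurable set. *)
Lemma ge0_integral_normal_prob (f : R -> \bar R) :
  measurable_fun setT f -> (forall x, 0 <= f x) ->
  \int[N01]_x f x = \int[mu]_x (f x * (normal_pdf 0 1 x)%:E).
Proof.
move=> mf f0.
have dom : N01 `<< mu by exact: normal_prob_dominates.
rewrite -(Radon_Nikodym_SigmaFinite.change_of_variables dom f0 measurableT mf).
apply: ae_eq_integral => //.
- apply: emeasurable_funM => //.
  exact: measurable_int (Radon_Nikodym_SigmaFinite.f_integrable dom).
- apply: emeasurable_funM => //; apply/measurable_EFinP; exact: measurable_normal_pdf.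
- apply: ae_eqe_mul2l; apply: integral_ae_eq => //.
  + exact: Radon_Nikodym_SigmaFinite.f_integrable.
  + apply/measurable_EFinP; exact: measurable_normal_pdf.
  + by move=> E _ mE; rewrite -Radon_Nikodym_SigmaFinite.f_integral.
Qed.

Lemma integral_normal_prob (f : R -> \bar R) :
  N01.-integrable setT f ->
  \int[N01]_x f x = \int[mu]_x (f x * (normal_pdf 0 1 x)%:E).
Proof.
move=> intf.
have mf : measurable_fun setT f by exact: measurable_int intf.
have dom : N01 `<< mu by exact: normal_prob_dominates.
rewrite -(Radon_Nikodym_change_of_variables dom measurableT intf).
apply: ae_eq_integral => //.
- exact: emeasurable_funM.
- apply: emeasurable_funM => //; apply/measurable_EFinP; exact: measurable_normal_pdf.
- apply: ae_eqe_mul2l; apply: integral_ae_eq => //.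
  + exact: Radon_Nikodym_integrable.
  + apply/measurable_EFinP; exact: measurable_normal_pdf.
  + by move=> E _ mE; rewrite -Radon_Nikodym_integral.
Qed.

Lemma normal_pdf01 (x : R) : normal_pdf 0 1 x = (normal_peak 1 * expR (- (x ^+ 2) / 2))%R.
Proof. by rewrite normal_pdfE ?oner_neq0// /normal_fun subr0 expr1n. Qed.

Lemma ge0_integral_normal2 (G : R * R -> \bar R) :
  measurable_fun setT G -> (forall x, 0 <= G x) ->
  \int[N01 \x N01]_p G p =
  \int[mu \x mu]_p (G p * (normal_peak 1 ^+ 2 * expR (- (p.1 ^+ 2 + p.2 ^+ 2) / 2))%:E).
Proof.
move=> mG G0.
have mE : measurable_fun setT (fun p : R * R => G p * (normal_peak 1 ^+ 2 * expR (- (p.1 ^+ 2 + p.2 ^+ 2) / 2))%:E).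
  apply: emeasurable_funM => //; apply/measurable_EFinP; apply: measurable_funM => //.
  apply: (measurableT_comp (@measurable_expR R)).
  apply: measurable_funM => //; apply: measurable_funN.
  by apply: measurable_funD; apply: measurable_funX.
rewrite fubini_tonelli1// [RHS]fubini_tonelli1//; last first.
  move=> x; apply: mule_ge0 => //.
  by rewrite lee_fin mulr_ge0// ?expR_ge0// exprn_ge0// normal_peak_ge0.
rewrite ge0_integral_normal_prob; first last.
- by move=> x; apply: integral_ge0.
- exact: measurable_fun_fubini_tonelli_F.
apply: eq_integral => x _; rewrite /fubini_F.
have mGx : measurable_fun setT (fun y => G (x, y)).
  by apply: measurableT_comp => //; exact: measurable_pair1.
have phi0 (z : R) : 0 <= (normal_pdf (0:R) 1 z)%:E by rewrite lee_fin normal_pdf_ge0.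
rewrite ge0_integral_normal_prob// muleC -ge0_integralZl//; first last.
- by move=> y _; apply: mule_ge0.
- by apply: emeasurable_funM => //; apply/measurable_EFinP; exact: measurable_normal_pdf.
apply: eq_integral => y _ /=.
rewrite muleCA -EFinM; congr (_ * _%:E); rewrite !normal_pdf01.
rewrite (_ : - (x ^+ 2 + y ^+ 2) / 2 = - (x ^+ 2) / 2 + (- (y ^+ 2) / 2))%R; last by lra.
by rewrite expRD; ring.
Qed.

(** The product density depends on [p] only through [p.1 ^+ 2 + p.2 ^+ 2], which a rotation fixes,
    so the claim reduces to planar Lebesgue measure. *)
Lemma ge0_integral_normal2_rotation (c s : R) (G : R * R -> \bar R) :
  (c ^+ 2 + s ^+ 2 = 1)%R -> (c != -1)%R ->
  measurable_fun setT G -> (forall x, 0 <= G x) ->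
  \int[N01 \x N01]_p G (c * p.1 - s * p.2, s * p.1 + c * p.2)%R =
  \int[N01 \x N01]_p G p.
Proof.
move=> cs c1 mG G0.
have mE : measurable_fun setT (fun p : R * R => G p * (normal_peak 1 ^+ 2 * expR (- (p.1 ^+ 2 + p.2 ^+ 2) / 2))%:E).
  apply: emeasurable_funM => //; apply/measurable_EFinP; apply: measurable_funM => //.
  apply: (measurableT_comp (@measurable_expR R)).
  apply: measurable_funM => //; apply: measurable_funN.
  by apply: measurable_funD; apply: measurable_funX.
rewrite ge0_integral_normal2//; last first.
  apply: (measurableT_comp mG); apply: measurable_fun_pair.
    by apply: measurable_funB; apply: measurable_funM.
  by apply: measurable_funD; apply: measurable_funM.
rewrite [RHS]ge0_integral_normal2//.
rewrite -(ge0_integral_rotation cs c1 mE); last first.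
  move=> x; apply: mule_ge0 => //.
  by rewrite lee_fin mulr_ge0// ?expR_ge0// exprn_ge0// normal_peak_ge0.
apply: eq_integral => -[x y] _ /=; congr (_ * (_ * expR (_ / 2))%:E).
congr (- _)%R.
have e1 : ((c ^+ 2 + s ^+ 2) * x ^+ 2 = x ^+ 2)%R by rewrite cs mul1r.
have e2 : ((c ^+ 2 + s ^+ 2) * y ^+ 2 = y ^+ 2)%R by rewrite cs mul1r.
by move: e1 e2; lra.
Qed.

Lemma ge0_integral_normal_opp (f : R -> \bar R) :
  measurable_fun setT f -> (forall x, 0 <= f x) ->
  \int[N01]_x f (- x)%R = \int[N01]_x f x.
Proof.
move=> mf f0.
rewrite !ge0_integral_normal_prob//; last first.
  by apply: measurableT_comp => //; exact: measurable_funN.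
transitivity (\int[mu]_x (fun x => f x * (normal_pdf 0 1 x)%:E) (- x)%R).
  by apply: eq_integral => x _; rewrite !normal_pdf01 sqrrN.
apply: ge0_integral_opp.
- by apply: emeasurable_funM => //; apply/measurable_EFinP; exact: measurable_normal_pdf.
- by move=> x; apply: mule_ge0 => //; rewrite lee_fin normal_pdf_ge0.
Qed.

End normal_integral.

(** * Measurable structure on row vectors *)

Section measurable_rV.
Context {R : realType}.
Variable n : nat.

Let coors : 'I_n -> 'rV[R]_n -> R := fun i x => x ord0 i.

(** Generating by the coordinates makes measurability of a vector-valued map a coordinatewise
    matter; [measurable_borel_rV] makes the link with the Borel sets of (H3). *)
Let rV_sigma : set (set 'rV[R]_n) := @g_sigma_preimage _ (measurableTypeR R) 'rV[R]_n n coors.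

Let rV_set0 : rV_sigma set0.
Proof. exact: sigma_algebra0. Qed.

Let rV_setC A : rV_sigma A -> rV_sigma (~` A).
Proof. exact: sigma_algebraC. Qed.

Let rV_bigcup (F : (set 'rV[R]_n)^nat) : (forall i, rV_sigma (F i)) ->
  rV_sigma (\bigcup_i (F i)).
Proof. exact: sigma_algebra_bigcup. Qed.

HB.instance Definition _ := @isMeasurable.Build default_measure_display
  'rV[R]_n rV_sigma rV_set0 rV_setC rV_bigcup.

Lemma measurable_coor (i : 'I_n) : measurable_fun [set: 'rV[R]_n] (fun x : 'rV[R]_n => x ord0 i).
Proof.
move=> _ Y mY; rewrite setTI; apply: sub_sigma_algebra => /=.
rewrite -bigcup_seq/=; exists i => /=; first by rewrite mem_index_enum.
by exists Y => //; rewrite setTI.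
Qed.

Lemma measurable_fun_rVP d (T : measurableType d) (f : T -> 'rV[R]_n) :
  (forall i, measurable_fun setT (fun x => f x ord0 i)) -> measurable_fun setT f.
Proof.
move=> mf _ A mA; rewrite setTI.
have : @g_sigma_preimage _ (measurableTypeR R) T n (fun i => coors i \o f) (f @^-1` A).
  by rewrite g_sigma_preimage_comp; exists A; rewrite ?setTI.
apply: smallest_sub => //; first exact: sigma_algebra_measurable.
rewrite -bigcup_seq/=; apply: bigcup_sub => i _ B [C mC <-]; exact: mf.
Qed.

End measurable_rV.

Lemma measurable_mulmx {R : realType} n m (T : 'M[R]_(n, m)) :
  measurable_fun [set: 'rV[R]_n] (fun x : 'rV[R]_n => x *m T).
Proof.
apply: measurable_fun_rVP => j; under eq_fun do rewrite mxE.
apply: measurable_sum => i; apply: measurable_funM => //; exact: measurable_coor.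
Qed.

Definition rV_cons {R : realType} k (p : measurableTypeR R * 'rV[R]_k) : 'rV[R]_k.+1 := row_mx (p.1%:M : 'rV[R]_1) p.2.

Lemma measurable_rV_cons {R : realType} k : measurable_fun [set: measurableTypeR R * 'rV[R]_k] (@rV_cons R k).
Proof.
apply: measurable_fun_rVP => i.
under eq_fun do rewrite /rV_cons (@mxE _ 1 (1 + k)).
case: split_ordP => j _.
  by under eq_fun do rewrite mxE (ord1 j) eqxx mulr1n; exact: measurable_fst.
exact: (measurableT_comp (@measurable_coor R k j) measurable_snd).
Qed.

HB.instance Definition _ {R : realType} k := isMeasurableFun.Build _ _ _ _ _ (@measurable_rV_cons R k).

(** * The Gaussian law on [R^n] and its invariance under isometries *)

Section gaussian_probability.
Context {R : realType}.

(** The image law under [rV_cons] copies the recursion of [gaussE], so that the two can be matched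
    one coordinate at a time. *)
Definition gauss_step k (P : probability 'rV[R]_k R) : probability 'rV[R]_k.+1 R :=
  distribution (normal_prob (0 : R) 1 \x P)%E (@rV_cons R k : {mfun _ >-> _}).

Fixpoint gaussP (n : nat) : probability 'rV[R]_n R :=
  match n return probability 'rV[R]_n R with
  | 0 => dirac (0 : 'rV[R]_0)
  | k.+1 => gauss_step (gaussP k)
  end.

Lemma ge0_integral_gaussPS k (f : 'rV[R]_k.+1 -> \bar R) :
  measurable_fun setT f -> (forall x, 0 <= f x)%E ->
  (\int[gaussP k.+1]_x f x =
   \int[normal_prob (0 : R) 1 \x gaussP k]_p f (rV_cons p))%E.
Proof.
move=> mf f0.
have := @ge0_integral_pushforward _ _ _ _ R _ (@measurable_rV_cons R k)
  (normal_prob (0 : R) 1 \x gaussP k)%E setT f measurableT mf (fun x _ => f0 x).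
by rewrite preimage_setT.
Qed.

Lemma ge0_integral_gaussPS_iter k (f : 'rV[R]_k.+1 -> \bar R) :
  measurable_fun setT f -> (forall x, 0 <= f x)%E ->
  (\int[gaussP k.+1]_x f x =
   \int[normal_prob (0 : R) 1]_t \int[gaussP k]_x f (rV_cons (t, x)))%E.
Proof.
move=> mf f0; rewrite ge0_integral_gaussPS//.
apply: (@fubini_tonelli1 _ _ _ _ _ _ _ (fun p => f (rV_cons p))) => //.
exact: (measurableT_comp mf (@measurable_rV_cons R k)).
Qed.

Lemma measurable_rV_cons1 k (t : R) : measurable_fun setT (fun x : 'rV[R]_k => rV_cons (t, x)).
Proof.
apply: (measurableT_comp (@measurable_rV_cons R k)); exact: measurable_pair1.
Qed.

(** Splitting off two coordinates lets a planar rotation act on them while the others are integrated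
    out. *)
Let cons2 k (p : (measurableTypeR R * measurableTypeR R) * 'rV[R]_k) : 'rV[R]_k.+2 :=
  rV_cons (p.1.1, rV_cons (p.1.2, p.2)).

Let measurable_cons2 k : measurable_fun setT (@cons2 k).
Proof.
apply: (measurableT_comp (@measurable_rV_cons R k.+1)).
apply: measurable_fun_pair; first exact: (measurableT_comp measurable_fst measurable_fst).
apply: (measurableT_comp (@measurable_rV_cons R k)).
by apply: measurable_fun_pair; first exact: (measurableT_comp measurable_snd measurable_fst).
Qed.

Let integral2 k (f : 'rV[R]_k.+2 -> \bar R) (p : R * R) : \bar R :=
  (\int[gaussP k]_x f (rV_cons (p.1, rV_cons (p.2, x))))%E.

Let measurable_integral2 k (f : 'rV[R]_k.+2 -> \bar R) :
  measurable_fun setT f -> (forall x, 0 <= f x)%E ->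
  measurable_fun [set: measurableTypeR R * measurableTypeR R] (integral2 f).
Proof.
move=> mf f0.
apply: (@measurable_fun_fubini_tonelli_F _ _ _ _ _ _ (fun p => f (@cons2 k p))) => //.
exact: (measurableT_comp mf (@measurable_cons2 k)).
Qed.

Let integral_gaussPSS k (f : 'rV[R]_k.+2 -> \bar R) :
  measurable_fun setT f -> (forall x, 0 <= f x)%E ->
  (\int[gaussP k.+2]_x f x =
   \int[normal_prob (0 : R) 1 \x normal_prob (0 : R) 1]_p integral2 f p)%E.
Proof.
move=> mf f0; rewrite ge0_integral_gaussPS_iter//.
rewrite [RHS]fubini_tonelli1; first last.
- by move=> p; apply: integral_ge0.
- exact: measurable_integral2.
apply: eq_integral => t _; rewrite ge0_integral_gaussPS_iter//.
exact: (measurableT_comp mf (measurable_rV_cons1 t)).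
Qed.

(** Stated for nonnegative functions, so that Tonelli applies without integrability conditions. *)
Definition gauss_inv n (O : 'M[R]_n) : Prop :=
  forall f : 'rV[R]_n -> \bar R, measurable_fun setT f -> (forall x, 0 <= f x)%E ->
  (\int[gaussP n]_x f (x *m O) = \int[gaussP n]_x f x)%E.

Lemma gauss_inv1 n : gauss_inv (1%:M : 'M[R]_n).
Proof. by move=> f mf f0; apply: eq_integral => x _; rewrite mulmx1. Qed.

Lemma gauss_invM n (O1 O2 : 'M[R]_n) : gauss_inv O1 -> gauss_inv O2 -> gauss_inv (O1 *m O2).
Proof.
move=> H1 H2 f mf f0; rewrite -(H2 f)//.
rewrite -(H1 (fun x => f (x *m O2)))//; first by apply: eq_integral => x _; rewrite mulmxA.
exact: (measurableT_comp mf (measurable_mulmx O2)).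
Qed.

Lemma gauss_inv_lift k (O : 'M[R]_k) : gauss_inv O -> gauss_inv (block_mx (1%:M : 'M[R]_1) 0 0 O : 'M[R]_(1 + k)).
Proof.
move=> HO f mf f0; rewrite !ge0_integral_gaussPS_iter//; last first.
  exact: (measurableT_comp mf (measurable_mulmx (block_mx (1%:M : 'M[R]_1) 0 0 O : 'M[R]_(k.+1)))).
apply: eq_integral => t _; rewrite -(HO (fun x => f (rV_cons (t, x)))) //; last first.
  exact: (measurableT_comp mf (measurable_rV_cons1 t)).
apply: eq_integral => x _; rewrite /rV_cons/=; congr f.
by rewrite (@mul_row_block _ 1 1 k) mulmx1 !mulmx0 addr0 add0r.
Qed.

Lemma gauss_inv_opp k : gauss_inv (block_mx ((-1)%:M : 'M[R]_1) 0 0 1%:M : 'M[R]_(1 + k)).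
Proof.
move=> f mf f0.
have mF : measurable_fun setT (fun t : R => \int[gaussP k]_x f (rV_cons (t, x)))%E.
  apply: (@measurable_fun_fubini_tonelli_F _ _ _ _ _ _ (fun p => f (rV_cons p))) => //.
  exact: (measurableT_comp mf (@measurable_rV_cons R k)).
rewrite !ge0_integral_gaussPS_iter//; last first.
  exact: (measurableT_comp mf (measurable_mulmx (block_mx ((-1)%:M : 'M[R]_1) 0 0 1%:M : 'M[R]_(k.+1)))).
rewrite -(ge0_integral_normal_opp mF); last by move=> t; apply: integral_ge0.
apply: eq_integral => t _; apply: eq_integral => x _; rewrite /rV_cons/=; congr f.
rewrite (@mul_row_block _ 1 1 k) mulmx1 !mulmx0 addr0 add0r; congr row_mx.
by rewrite -scalar_mxM mulrN1.
Qed.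

Definition rot_mx k (c s : R) : 'M[R]_(1 + (1 + k)) :=
  block_mx c%:M (row_mx s%:M 0) (col_mx (- s)%:M 0) (block_mx c%:M 0 0 1%:M).

Lemma mul_cons2_rot_mx k c s (t u : R) (x : 'rV[R]_k) :
  rV_cons (t, rV_cons (u, x)) *m rot_mx k c s =
  rV_cons (c * t - s * u, rV_cons (s * t + c * u, x)).
Proof.
rewrite /rV_cons /rot_mx /=.
rewrite (@mul_row_block _ 1 1 (1 + k)) (@mul_row_col _ _ 1 k) mul_mx_row (@mul_row_block _ 1 1 k).
rewrite !mulmx0 !mulmx1 !addr0 !add0r (@add_row_mx _ 1 1 k) add0r -!scalar_mxM -!raddfD/=.
by congr (row_mx _%:M (row_mx _%:M _)); ring.
Qed.

Lemma gauss_inv_rot k (c s : R) : c ^+ 2 + s ^+ 2 = 1 -> c != -1 -> gauss_inv (rot_mx k c s).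
Proof.
move=> cs c1 f mf f0.
rewrite !integral_gaussPSS//; last first.
  exact: (measurableT_comp mf (measurable_mulmx (rot_mx k c s : 'M[R]_(k.+2)))).
rewrite -(ge0_integral_normal2_rotation cs c1 (measurable_integral2 mf f0)); last first.
  by move=> p; apply: integral_ge0.
apply: eq_integral => -[t u] _; apply: eq_integral => x _ /=.
by rewrite mul_cons2_rot_mx.
Qed.

Lemma rot_mx_orthogonal k (c s : R) : c ^+ 2 + s ^+ 2 = 1 -> (rot_mx k c s)^T *m rot_mx k c s = 1%:M.
Proof.
move=> cs; rewrite /rot_mx !tr_block_mx tr_row_mx tr_col_mx !tr_scalar_mx !trmx0.
rewrite (@mulmx_block _ 1 (1 + k) 1 (1 + k)) (@mul_row_block _ 1 1 k) (@mul_block_col _ 1 k 1 k) (@mulmx_block _ 1 k 1 k)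
  (@mul_col_row _ 1 k 1 1 k) (@mul_row_col _ 1 1 k 1) (@mul_mx_row _ 1 1 1 k) (@mul_col_mx _ 1 k 1).
rewrite !mulmx0 !mul0mx !mulmx1 !addr0 !add0r -!scalar_mxM.
rewrite (@add_row_mx _ 1 1 k) add_col_mx (@add_block_mx _ 1 k 1 k) !addr0 !add0r -!raddfD/=.
rewrite [RHS](@scalar_mx_block _ 1 (1 + k)) (@scalar_mx_block _ 1 k).
have -> : c * c + - s * - s = 1 by rewrite -cs; ring.
have -> : s * s + c * c = 1 by rewrite -cs; ring.
have -> : c * s + - s * c = 0 by ring.
have -> : s * c + c * - s = 0 by ring.
by rewrite !raddf0 row_mx0 col_mx0.
Qed.

(** A Givens reduction: the lower part is brought to [(r, 0)] by induction, then one rotation in the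
    first two coordinates clears [r]. Only sign changes and rotations occur, and these preserve the
    Gaussian law. The sign [0 <= r] later turns [r ^+ 2 = 1] into [r = 1]. *)
Lemma gauss_inv_column k (c : 'cV[R]_(1 + k)) :
  exists (O : 'M[R]_(1 + k)) (r : R), [/\ gauss_inv (O : 'M[R]_k.+1), O^T *m O = 1%:M, 0 <= r &
    O *m c = col_mx (r%:M : 'cV[R]_1) 0].
Proof.
have flip j (B : 'M[R]_(1 + j)) (a : R) : gauss_inv (B : 'M[R]_j.+1) -> B^T *m B = 1%:M ->
    exists (O : 'M[R]_(1 + j)) (r : R), [/\ gauss_inv (O : 'M[R]_j.+1), O^T *m O = 1%:M, 0 <= r &
    forall c : 'cV[R]_(1 + j), B *m c = col_mx (a%:M : 'cV[R]_1) 0 ->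
    O *m c = col_mx (r%:M : 'cV[R]_1) 0].
  move=> iB oB; have [a0|a0] := leP 0 a; first by exists B, a.
  exists (block_mx ((-1)%:M : 'M[R]_1) 0 0 1%:M *m B), (- a); split.
  - by apply: gauss_invM => //; exact: gauss_inv_opp.
  - rewrite trmx_mul mulmxA -(mulmxA B^T) tr_block_mx mulmx_block !trmx0 trmx1 tr_scalar_mx.
    rewrite !mulmx0 !mul0mx mulmx1 !addr0 !add0r -scalar_mxM mulrNN mulr1.
    by rewrite -scalar_mx_block mulmx1.
  - lra.
  - move=> c' Bc; rewrite -mulmxA Bc mul_block_col !mulmx0 mul0mx !addr0 -scalar_mxM.
    by rewrite mulN1r.
elim: k c => [|k IH] c.
  have [Q [r [iO oO r0 Or]]] := flip 0%N 1%:M (c ord0 ord0) (@gauss_inv1 _) (etrans (mulmx1 _) (trmx1 _ _)).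
  exists Q, r; split => //; apply: Or; rewrite mul1mx.
  apply/colP => i; rewrite (@mxE _ (1 + 0) 1) (ord1 i); case: split_ordP => j //= _.
  by rewrite (ord1 j) mxE eqxx.
have [Q' [r [iO' oO' r0 Or]]] := IH (dsubmx (c : 'cV[R]_(1 + (1 + k)))).
set a := usubmx (c : 'cV[R]_(1 + (1 + k))) ord0 ord0.
have ca : c = col_mx a%:M (dsubmx (c : 'cV[R]_(1 + (1 + k)))).
  rewrite -[LHS](@vsubmxK _ 1 (1 + k)); congr col_mx.
  by apply/matrixP => i j; rewrite !(ord1 i) !(ord1 j) [RHS]mxE eqxx.
pose B : 'M[R]_(1 + (1 + k)) := block_mx (1%:M : 'M[R]_1) 0 0 Q'.
have iB : gauss_inv (B : 'M[R]_k.+2) by exact: gauss_inv_lift.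
have oB : B^T *m B = 1%:M.
  rewrite /B tr_block_mx mulmx_block !trmx0 trmx1 !mulmx0 !mul0mx mulmx1 !addr0 !add0r oO'.
  by rewrite -scalar_mx_block.
have Bc : B *m c = col_mx a%:M (col_mx r%:M 0).
  by rewrite ca /B mul_block_col mul1mx !mul0mx addr0 add0r Or.
have [r0'|r0'] := eqVneq r 0.
  have [Q [r' [iO oO r'0 Or']]] := flip _ B a iB oB.
  exists Q, r'; split => //; apply: Or'.
  by rewrite Bc r0' raddf0 col_mx0.
have rp : 0 < r by rewrite lt_neqAle eq_sym r0'.
pose h := Num.sqrt (a ^+ 2 + r ^+ 2).
have h2 : h ^+ 2 = a ^+ 2 + r ^+ 2 by rewrite sqr_sqrtr// addr_ge0// sqr_ge0.
have hp : 0 < h by rewrite sqrtr_gt0 ltr_pwDr// ?sqr_ge0// exprn_gt0.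
have hN0 : h != 0 by rewrite gt_eqF.
have cs : (a / h) ^+ 2 + (r / h) ^+ 2 = 1.
  by rewrite !exprMn -mulrDl -h2 -exprMn divff// expr1n.
(* The excluded half-turn would force [r = 0], the case settled above. *)
have c1 : a / h != -1.
  apply/eqP => e; have : a = - h by rewrite -(divfK hN0 a) e mulN1r.
  move=> ah; move: h2; rewrite ah sqrrN => /eqP; rewrite -subr_eq0 opprD addrA subrr add0r oppr_eq0.
  by rewrite expf_eq0 (negbTE r0').
exists (rot_mx k (a / h) (r / h) *m B), h; split => //.
- by apply: gauss_invM => //; exact: gauss_inv_rot.
- by rewrite trmx_mul mulmxA -(mulmxA B^T) rot_mx_orthogonal// mulmx1.
- exact: ltW.
rewrite -mulmxA Bc /rot_mx (@mul_block_col _ 1 (1 + k) 1 (1 + k)) (@mul_row_col _ 1 1 k) (@mul_col_mx _ 1 k 1) (@mul_block_col _ 1 k 1 k).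
rewrite !mulmx0 !mul0mx !addr0 add_col_mx -!scalar_mxM addr0 -!raddfD/=.
have -> : a / h * a + r / h * r = h.
  by apply: (mulIf hN0); rewrite mulrDl -!mulrA !(mulrCA h^-1) !mulVf// !mulr1 -!expr2 h2.
have -> : - (r / h) * a + a / h * r = 0 by ring.
by rewrite raddf0 col_mx0.
Qed.

(** QR decomposition by induction on the number of columns: after an invariant change of variable
    the first column is the first unit vector, orthonormality clears the rest of the first row, and
    the remaining block is again an isometry. *)
Lemma ge0_integral_gauss_isometry m n (T : 'M[R]_(n, m)) (f : 'rV[R]_m -> \bar R) :
  T^T *m T = 1%:M -> measurable_fun setT f -> (forall x, 0 <= f x)%E ->
  (\int[gaussP n]_x f (x *m T) = \int[gaussP m]_x f x)%E.
Proof.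
elim: m n T f => [|m IH] n T f oT mf f0.
  have fc x : f x = f 0 by rewrite (_ : x = 0)//; apply/rowP => -[].
  under eq_integral do rewrite fc; under [RHS]eq_integral do rewrite fc.
  by rewrite !integral_cst//= !probability_setT.
case: n T oT => [|n] T oT.
  move: oT => /matrixP/(_ ord0 ord0); rewrite !mxE big_ord0 eqxx => /eqP.
  by rewrite eq_sym oner_eq0.
have [Q [r [iO oO r0 Or]]] := @gauss_inv_column n (lsubmx (T : 'M[R]_(1 + n, 1 + m))).
pose OT : 'M[R]_(1 + n, 1 + m) := Q *m T.
have oOT : OT^T *m OT = 1%:M by rewrite /OT trmx_mul mulmxA -(mulmxA T^T) oO mulmx1.
pose A := usubmx (Q *m rsubmx (T : 'M[R]_(1 + n, 1 + m))).
pose T' := dsubmx (Q *m rsubmx (T : 'M[R]_(1 + n, 1 + m))).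
have eOT : OT = block_mx r%:M A 0 T'.
  rewrite /OT -[T in LHS](@hsubmxK _ (1 + n) 1 m) (@mul_mx_row _ (1 + n) (1 + n) 1 m) Or /A /T' block_mxEh.
  by rewrite vsubmxK.
move: oOT; rewrite eOT tr_block_mx mulmx_block !trmx0 !(mul0mx, mulmx0, addr0, add0r) tr_scalar_mx -scalar_mxM.
rewrite [RHS](@scalar_mx_block _ 1 m) => /eq_block_mx[r1 A0 _ oT'].
have {r1} r1 : r = 1.
  move: r1 => /matrixP/(_ ord0 ord0); rewrite !mxE eqxx !mulr1n => /eqP.
  by rewrite -expr2 sqrp_eq1// => /eqP.
move: A0; rewrite r1 mul_scalar_mx scale1r => A0.
rewrite A0 trmx0 mul0mx add0r in oT'.
rewrite A0 r1 in eOT.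
have mfT : measurable_fun setT (fun x => f (x *m T)).
  exact: (measurableT_comp mf (measurable_mulmx T)).
rewrite -(iO (fun x => f (x *m T)) mfT)//.
transitivity (\int[gaussP n.+1]_x f (x *m OT))%E.
  by apply: eq_integral => x _; rewrite /OT mulmxA.
rewrite ge0_integral_gaussPS_iter//; last first.
  exact: (measurableT_comp mf (measurable_mulmx (OT : 'M[R]_(n.+1, m.+1)))).
rewrite [RHS]ge0_integral_gaussPS_iter//.
apply: eq_integral => t _; rewrite -(IH n T' (fun x => f (rV_cons (t, x))))//; last first.
  exact: (measurableT_comp mf (measurable_rV_cons1 t)).
apply: eq_integral => x _; congr f; rewrite eOT /rV_cons/=.
by rewrite (@mul_row_block _ 1 1 n) mulmx1 !mulmx0 addr0 add0r.
Qed.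

Lemma integral_gauss_isometry m n (T : 'M[R]_(n, m)) (f : 'rV[R]_m -> \bar R) :
  T^T *m T = 1%:M -> measurable_fun setT f ->
  (\int[gaussP n]_x f (x *m T) = \int[gaussP m]_x f x)%E.
Proof.
move=> oT mf; rewrite integralE [RHS]integralE; congr (_ - _)%E.
  rewrite -(ge0_integral_gauss_isometry oT (measurable_funepos mf) (funepos_ge0 f)).
  by apply: eq_integral => x _; rewrite !funeposE.
rewrite -(ge0_integral_gauss_isometry oT (measurable_funeneg mf) (funeneg_ge0 f)).
by apply: eq_integral => x _; rewrite !funenegE.
Qed.

Lemma Rintegral_gauss_isometry m n (T : 'M[R]_(n, m)) (g : 'rV[R]_m -> R) :
  T^T *m T = 1%:M -> measurable_fun setT g ->
  \int[gaussP n]_x g (x *m T) = \int[gaussP m]_x g x.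
Proof.
move=> oT mg; rewrite /Rintegral; congr fine.
by apply: (integral_gauss_isometry oT (f := EFin \o g)); exact/measurable_EFinP.
Qed.

Lemma bounded_integrable_probability d (S : measurableType d) (P : probability S R) (g : S -> R) (M : R) :
  measurable_fun setT g -> (forall x, `|g x| <= M) -> P.-integrable setT (EFin \o g).
Proof.
move=> mg gM; apply: measurable_bounded_integrable => //.
  by rewrite -ge0_fin_numE// fin_num_measure.
by exists M; split; [exact: num_real|move=> N MN x _ /=; exact: le_trans (ltW MN)].
Qed.

(** Boundedness gives integrability at every level, so that Fubini applies and every inner integral
    is finite, which [Rintegral] needs to keep its value. *)
Lemma gaussE_integral n (g : 'rV[R]_n -> R) (M : R) :
  measurable_fun setT g -> (forall x, `|g x| <= M) ->
  gaussE g = \int[gaussP n]_x g x.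
Proof.
elim: n g => [|k IH] g mg gM.
  by rewrite /Rintegral integral_dirac// ?diracT ?mul1e//; exact/measurable_EFinP.
have mc t : measurable_fun setT (fun x : 'rV[R]_k => g (rV_cons (t, x))).
  exact: (measurableT_comp mg (measurable_rV_cons1 t)).
have ig : (normal_prob (0 : R) 1 \x gaussP k)%E.-integrable setT (fun p => (g (rV_cons p))%:E).
  apply: (@bounded_integrable_probability _ _ (normal_prob (0 : R) 1 \x gaussP k)%E (fun p => g (rV_cons p)) M) => //.
  exact: (measurableT_comp mg (@measurable_rV_cons R k)).
have -> : \int[gaussP k.+1]_x g x = fine (\int[normal_prob (0 : R) 1]_t \int[gaussP k]_x (g (rV_cons (t, x)))%:E)%E.
  have h := integral12_prod_meas1 ig.
  rewrite -[in RHS]/(fubini_F (gaussP k) (fun p => (g (rV_cons p))%:E) _).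
  rewrite [X in fine X](h) /Rintegral; congr fine.
  have := @integral_pushforward _ _ _ _ R _ (@measurable_rV_cons R k)
    (normal_prob (0 : R) 1 \x gaussP k)%E setT (EFin \o g).
  rewrite preimage_setT; apply => //; exact/measurable_EFinP.
have fin t : (\int[gaussP k]_x (g (rV_cons (t, x)))%:E)%E = (gaussE (fun x => g (rV_cons (t, x))))%:E.
  rewrite IH// /Rintegral fineK//; apply: integrable_fin_num => //.
  by apply: (@bounded_integrable_probability _ _ _ _ M).
rewrite integral_normal_prob; last first.
  exact: integrable_fubini_F ig.
rewrite /= /Rintegral; congr fine; apply: eq_integral => t _.
by rewrite fin -EFinM mulrC.
Qed.

End gaussian_probability.

(** * Mean-field bound for dense spin systems *)

(** Here [p1], [p2] are the weights of two measurement branches and [a1 / p1], [a2 / p2] the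
    expectations in them. The exact gain in mean square is [(a1 * p2 - a2 * p1) ^+ 2 / (p1 * p2 *
    (p1 + p2))]; the correction term on the left has the same numerator, with [p1 * p2] replaced by
    the larger [(p1 + p2) ^+ 2 / 4]. In a branch of weight 0 the hypotheses make the numerator 0 as
    well. *)
Lemma split_gain (R : realFieldType) (p1 p2 a1 a2 : R) :
  `|a1| <= p1 -> `|a2| <= p2 ->
  (a1 + a2) ^+ 2 / (p1 + p2) +
    ((a1 - a2) * (p1 + p2) - (a1 + a2) * (p1 - p2)) ^+ 2 / (p1 + p2) ^+ 3
  <= a1 ^+ 2 / p1 + a2 ^+ 2 / p2.
Proof.
move=> h1 h2.
have [p10|p10] := eqVneq p1 0.
  have -> : a1 = 0 by apply/eqP; rewrite -normr_le0 -p10.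
  rewrite p10 !add0r invr0 mulr0 add0r.
  have -> : - a2 * p2 - a2 * - p2 = 0 by ring.
  by rewrite expr0n/= mul0r addr0.
have [p20|p20] := eqVneq p2 0.
  have -> : a2 = 0 by apply/eqP; rewrite -normr_le0 -p20.
  rewrite p20 subr0 !addr0 subr0 subrr expr0n/= !mul0r !addr0//.
have p1p : 0 < p1 by rewrite lt_neqAle eq_sym p10 (le_trans _ h1).
have p2p : 0 < p2 by rewrite lt_neqAle eq_sym p20 (le_trans _ h2).
have pp : p1 + p2 != 0 by rewrite gt_eqF// addr_gt0.
rewrite -subr_ge0.
have -> : a1 ^+ 2 / p1 + a2 ^+ 2 / p2 - ((a1 + a2) ^+ 2 / (p1 + p2) +
    ((a1 - a2) * (p1 + p2) - (a1 + a2) * (p1 - p2)) ^+ 2 / (p1 + p2) ^+ 3) =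
    ((a1 * p2 - a2 * p1) * (p1 - p2)) ^+ 2 / (p1 * p2 * (p1 + p2) ^+ 3).
  by field; rewrite pp p10 p20.
by rewrite divr_ge0 ?sqr_ge0// !mulr_ge0 ?exprn_ge0 ?addr_ge0 ?ltW.
Qed.

Section mean_field.
Context {R : realType} {W : lmodType R} {n : nat}.
Variables (ip : W -> W -> R) (S : 'I_n -> 'I_3 -> W -> W).
Hypothesis ipD : forall x y z, ip (x + y) z = ip x z + ip y z.
Hypothesis ipZ : forall c x z, ip (c *: x) z = c * ip x z.
Hypothesis ipC : forall x y, ip x y = ip y x.
Hypothesis ip_ge0 : forall x, 0 <= ip x x.
Hypothesis SD : forall u a x y, S u a (x + y) = S u a x + S u a y.
Hypothesis SZ : forall u a c x, S u a (c *: x) = c *: S u a x.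
Hypothesis S_sym : forall u a x y, ip x (S u a y) = ip (S u a x) y.
Hypothesis S_inv : forall u a x, S u a (S u a x) = x.
Hypothesis S_comm : forall u v a b x, u != v -> S u a (S v b x) = S v b (S u a x).
Hypothesis S_anti : forall u a b x, a != b -> S u a (S u b x) = - S u b (S u a x).

Let ipDr x y z : ip x (y + z) = ip x y + ip x z.
Proof. by rewrite ipC ipD !(ipC x). Qed.
Let ipZr c x y : ip x (c *: y) = c * ip x y.
Proof. by rewrite ipC ipZ ipC. Qed.
Let ipNr x y : ip x (- y) = - ip x y.
Proof. by rewrite -scaleN1r ipZr mulN1r. Qed.
Let ipN x y : ip (- x) y = - ip x y.
Proof. by rewrite -scaleN1r ipZ mulN1r. Qed.

(** Vectors are not normalised: [N] is the weight of a branch. Energy and potential below are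
    homogeneous of degree 2 in the vector, so that contributions of branches can be added. *)
Let N x := ip x x.
Let e u a x := ip x (S u a x).
Let e2 u v a x := ip x (S u a (S v a x)).

Let N_S u a x : N (S u a x) = N x.
Proof. by rewrite /N -S_sym S_inv. Qed.

Let ip_le x y : N y = N x -> `|ip x y| <= N x.
Proof.
move=> yx; have h1 := ip_ge0 (x + y); have h2 := ip_ge0 (x - y).
rewrite ler_norml; move: h1 h2 yx; rewrite /N !ipD !ipDr !ipN !ipNr (ipC y x) => h1 h2 yx.
by apply/andP; split; lra.
Qed.

Let e_le u a x : `|e u a x| <= N x.
Proof. exact/ip_le/N_S. Qed.

Let e2_le u v a x : `|e2 u v a x| <= N x.
Proof. by apply: ip_le; rewrite !N_S. Qed.

Let ip_sum_r (I : finType) x (F : I -> W) : ip x (\sum_i F i) = \sum_i ip x (F i).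
Proof.
have ip0 : ip x 0 = 0 by rewrite -(scale0r 0) ipZr mul0r.
exact: (big_morph (ip x) (ipDr x) ip0).
Qed.

(* With B = sum_a b_a S^a and b_a = <S^a>, anticommutation gives B^2 = |b|^2. *)
Let bloch u x : \sum_(a < 3) e u a x ^+ 2 <= N x ^+ 2.
Proof.
set s := \sum_(a < 3) _.
have s0 : 0 <= s by apply: sumr_ge0 => a _; exact: sqr_ge0.
pose B := \sum_(a < 3) e u a x *: S u a x.
have xB : ip x B = s.
  by rewrite /B ip_sum_r; apply: eq_bigr => a _; rewrite ipZr expr2.
have BB : ip B B = s * N x.
  rewrite {1}/B ipC ip_sum_r /s mulr_suml; apply: eq_bigr => a _.
  rewrite ipZr ipC /B ip_sum_r (bigD1 a)//= big1 ?addr0.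
    by rewrite ipZr -/(N _) N_S; ring.
  move=> b ba; rewrite ipZr.
  suff -> : ip (S u a x) (S u b x) = 0 by rewrite mulr0.
  have h : ip (S u a x) (S u b x) = - ip (S u a x) (S u b x).
    by rewrite -{1}S_sym (S_anti _ _ ) 1?eq_sym// ipNr S_sym ipC.
  by move: h; lra.
have h := ip_ge0 (N x *: x - B).
move: h; rewrite ipD !ipDr !ipN !ipNr !ipZ !ipZr -/(N x) xB (ipC B x) xB BB => h.
have {h} : 0 <= N x * (N x ^+ 2 - s) by move: h; lra.
have := ip_ge0 x; rewrite -/(N x) le_eqVlt => /predU1P[N0 _|Np].
  by rewrite /s big1 ?sqr_ge0// => a _; have := e_le u a x; rewrite -N0 normr_le0 => /eqP->; rewrite expr0n.
by rewrite pmulr_rge0// subr_ge0.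
Qed.

Variables (w : 'I_n -> 'I_n -> R) (C c t : R).
Hypothesis n_gt0 : (0 < n)%N.
Hypothesis C_ge0 : 0 <= C.
Hypothesis w_ge0 : forall u v, 0 <= w u v.
Hypothesis w_le : forall u v, w u v <= C / n%:R ^+ 2.
Hypothesis c_ge : forall b : 'I_n -> 'rV[R]_3, (forall u, in_ball (b u)) ->
  \sum_(u < n) \sum_(v < n | (u < v)%N) w u v * (4^-1 - 4^-1 * dotm (b u) (b v)) <= c.
Hypothesis t_gt0 : 0 < t.
Hypothesis n_gt : 3 / n%:R < t ^+ 2.

Let F x u v := w u v * (4^-1 * (N x - \sum_(a < 3) e2 u v a x)).

(** [A] is the set of vertices already measured; edges that touch it are discarded. *)
Let energy (A : {set 'I_n}) x :=
  \sum_(u < n | u \notin A) \sum_(v < n | (v \notin A) && (u < v)%N) F x u v.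

(** The potential: the total squared Bloch length of the unmeasured vertices over [n], times the
    weight [N x]. *)
Let Phi (A : {set 'I_n}) x := n%:R^-1 * \sum_(u < n | u \notin A) \sum_(a < 3) e u a x ^+ 2 / N x.

(** [N x ^+ 2] times the covariance of the two spins in the normalised state. *)
Let cov u a v b x := ip x (S u a (S v b x)) * N x - e u a x * e v b x.

(** The exchange rate between energy and potential: per unit weight, one measurement costs at most
    [2 * C / n] in energy and, when it is chosen, raises the potential by at least
    [t ^+ 2 - 3 / n]. *)
Let K := (2 * C / n%:R) / (t ^+ 2 - 3 / n%:R).

Let nR_gt0 : 0 < n%:R :> R.
Proof. by rewrite ltr0n. Qed.

Let K_ge0 : 0 <= K.
Proof. by rewrite divr_ge0 ?divr_ge0 ?mulr_ge0 ?ler0n// subr_ge0 ltW. Qed.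

(** The unnormalised states after the outcomes +1 and -1 of measuring [S q b]. *)
Let xp q b x := 2^-1 *: (x + S q b x).
Let xm q b x := 2^-1 *: (x - S q b x).

(** An observable commuting with the measured spin has no cross terms between the branches: the sum
    over the branches keeps its expectation, and their difference is its correlation with the
    spin. *)
Let split_form q b x (A : W -> W) : (forall y z, A (y + z) = A y + A z) ->
  (forall k y, A (k *: y) = k *: A y) -> (forall y, A (S q b y) = S q b (A y)) ->
  ip (xp q b x) (A (xp q b x)) + ip (xm q b x) (A (xm q b x)) = ip x (A x) /\
  ip (xp q b x) (A (xp q b x)) - ip (xm q b x) (A (xm q b x)) = ip x (A (S q b x)).
Proof.
move=> AD AZ AS.
have h1 : ip (S q b x) (A (S q b x)) = ip x (A x) by rewrite AS -S_sym S_inv.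
have h2 : ip (S q b x) (A x) = ip x (A (S q b x)) by rewrite AS -S_sym.
have AN y : A (- y) = - A y by rewrite -scaleN1r AZ scaleN1r.
rewrite /xp /xm !AZ !ipZ !ipZr !AD !AN !ipD !ipDr !ipN !ipNr h1 h2.
by split; field.
Qed.

Let N_split q b x : N (xp q b x) + N (xm q b x) = N x /\ N (xp q b x) - N (xm q b x) = e q b x.
Proof. by apply: (@split_form q b x id). Qed.

Let energy_split (A : {set 'I_n}) q b x : q \in A ->
  energy A x = energy A (xp q b x) + energy A (xm q b x).
Proof.
move=> qA; rewrite /energy -big_split/=; apply: eq_bigr => u uA.
rewrite -big_split/=; apply: eq_bigr => v /andP[vA uv].
rewrite /F -mulrDr -mulrDr; congr (_ * (_ * _)).
have uq : u != q by apply: contraNneq uA => ->.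
have vq : v != q by apply: contraNneq vA => ->.
rewrite addrACA -opprD -big_split/= (proj1 (N_split q b x)); congr (_ - _).
apply: eq_bigr => a _; apply/esym.
apply: (proj1 (@split_form q b x (fun y => S u a (S v a y)) _ _ _)).
- by move=> y z; rewrite !SD.
- by move=> k y; rewrite !SZ.
- by move=> y; rewrite (S_comm _ _ _ vq) (S_comm _ _ _ uq).
Qed.

(** [split_gain] is applied at each vertex and axis, with the weights of the two branches as [p1]
    and [p2]; its correction term becomes [cov u a q b x ^+ 2 / N x ^+ 3]. *)
Let Phi_split (A : {set 'I_n}) q b x : q \in A ->
  Phi A x + n%:R^-1 * (\sum_(u < n | u \notin A) \sum_(a < 3) cov u a q b x ^+ 2 / N x ^+ 3) <=
  Phi A (xp q b x) + Phi A (xm q b x).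
Proof.
move=> qA; rewrite /Phi -!mulrDr ler_pM2l ?invr_gt0// -!big_split/=.
apply: ler_sum => u uA; rewrite -!big_split/=; apply: ler_sum => a _.
have uq : u != q by apply: contraNneq uA => ->.
have [h1 h2] := N_split q b x.
have [|||g1 g2] := @split_form q b x (S u a).
- exact: SD.
- exact: SZ.
- by move=> y; rewrite S_comm.
have := split_gain (e_le u a (xp q b x)) (e_le u a (xm q b x)).
by rewrite h1 h2 /e g1 g2.
Qed.

Let F_le x u v : F x u v <= C / n%:R ^+ 2 * N x.
Proof.
apply: (@le_trans _ _ (w u v * N x)); last by rewrite ler_wpM2r// ip_ge0.
rewrite ler_wpM2l// !big_ord_recl big_ord0.
have := e2_le u v ord0 x; have := e2_le u v (lift ord0 ord0) x.
have := e2_le u v (lift ord0 (lift ord0 ord0)) x.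
by rewrite !ler_norml => /andP[? _] /andP[? _] /andP[? _]; lra.
Qed.

(** Vertex [q] lies on at most [n] edges in each orientation, and each of them carries at most
    [C / n ^+ 2] times the weight. *)
Let energy_remove (A : {set 'I_n}) q x : q \notin A ->
  energy A x <= energy (q |: A) x + 2 * C / n%:R * N x.
Proof.
move=> qA.
have n2 k : (k <= n)%N -> (C / n%:R ^+ 2 * N x) *+ k <= C / n%:R * N x.
  move=> kn; apply: (@le_trans _ _ ((C / n%:R ^+ 2 * N x) *+ n)).
    by rewrite -!(mulr_natr (_ * _)) ler_wpM2l ?ler_nat// mulr_ge0 ?divr_ge0 ?exprn_ge0 ?ip_ge0// ltW.
  by rewrite -mulr_natr le_eqVlt; apply/orP; left; apply/eqP; field; rewrite gt_eqF.
have sle (P : pred 'I_n) : \sum_(u < n | P u) C / n%:R ^+ 2 * N x <= C / n%:R * N x.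
  by rewrite sumr_const; apply: n2; apply: leq_trans (max_card _) _; rewrite card_ord.
have notin u : (u \notin q |: A) = (u \notin A) && (u != q).
  by rewrite !inE negb_or andbC.
rewrite /energy (bigD1 q)//=.
have -> : \sum_(u < n | u \notin q |: A) \sum_(v < n | (v \notin q |: A) && (u < v)%N) F x u v =
  \sum_(u < n | (u \notin A) && (u != q)) \sum_(v < n | ((v \notin A) && (u < v)%N) && (v != q)) F x u v.
  by apply: eq_big => // u _; apply: eq_bigl => v; rewrite notin andbAC.
rewrite addrC -lerBrDr -addrA -lerBlDl -sumrB.
apply: (@le_trans _ _ (\sum_(u < n | (u \notin A) && (u != q)) C / n%:R ^+ 2 * N x)).
  apply: ler_sum => u /andP[uA uq].
  case: (boolP ((q \notin A) && (u < q)%N)) => uq'.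
    by rewrite (bigD1 q)//= addrK F_le.
  rewrite [X in X - _](eq_bigl (fun v => ((v \notin A) && (u < v)%N) && (v != q))) ?subrr.
    by rewrite mulr_ge0 ?divr_ge0 ?exprn_ge0 ?ip_ge0// ltW.
  move=> v; case: eqVneq => [->|]; first by rewrite (negbTE uq').
  by rewrite andbT.
apply: le_trans (sle _) _.
rewrite lerBrDr -lerBrDl.
apply: (@le_trans _ _ (\sum_(v < n | (v \notin A) && (q < v)%N) C / n%:R ^+ 2 * N x)).
  by apply: ler_sum => v _; exact: F_le.
apply: le_trans (sle _) _.
by rewrite le_eqVlt; apply/orP; left; apply/eqP; ring.
Qed.

Let Phi_remove (A : {set 'I_n}) q x : q \notin A -> 0 < N x ->
  Phi A x <= Phi (q |: A) x + 3 / n%:R * N x.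
Proof.
move=> qA Nx; rewrite /Phi (bigD1 q)//= mulrDr addrC.
rewrite (eq_bigl (fun u => u \notin q |: A)); last by move=> u; rewrite !inE negb_or andbC.
rewrite lerD2l mulrC; apply: (@le_trans _ _ (N x / n%:R)).
  by rewrite ler_pM2r ?invr_gt0// -mulr_suml ler_pdivrMr//; exact: bloch.
by rewrite mulrAC ler_pM2r ?invr_gt0//; lra.
Qed.

(** A measured vertex gets the vector 0, which gives its edges the nonnegative product energy
    [w / 4]; adding these edges back can only increase the sum that [c] bounds. *)
Let b_of (A : {set 'I_n}) x u : 'rV[R]_3 := \row_(a < 3) (if u \in A then 0 else e u a x / N x).

Let b_of_ball (A : {set 'I_n}) x u : 0 < N x -> in_ball (b_of A x u).
Proof.
move=> Nx; rewrite /in_ball /enorm -[leRHS]sqrtr1 ler_wsqrtr// /dotm big_ord1.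
have [uA|uA] := boolP (u \in A).
  by rewrite big1 ?ler01// => a _; rewrite mxE uA mul0r.
apply: (@le_trans _ _ ((\sum_(a < 3) e u a x ^+ 2) / N x ^+ 2)); last first.
  by rewrite ler_pdivrMr ?exprn_gt0// mul1r bloch.
rewrite mulr_suml; apply: ler_sum => a _; rewrite mxE (negbTE uA) le_eqVlt; apply/orP; left.
by apply/eqP; field; rewrite gt_eqF.
Qed.

(** The edge energy is the product energy minus [w / 4] times the sum of the covariances over [N x];
    each covariance is then bounded by the arithmetic-geometric mean inequality with parameter
    [t]. *)
Let F_stop (A : {set 'I_n}) x u v : 0 < N x -> u \notin A -> v \notin A -> u != v ->
  F x u v <= N x * (w u v * (4^-1 - 4^-1 * dotm (b_of A x u) (b_of A x v))) +
    C / n%:R ^+ 2 / 8 * \sum_(a < 3) (cov v a u a x ^+ 2 / N x ^+ 3 / t + t * N x).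
Proof.
move=> Nx uA vA uv; have NxN0 : N x != 0 by rewrite gt_eqF.
have dE : dotm (b_of A x u) (b_of A x v) = \sum_(a < 3) e u a x * e v a x / N x ^+ 2.
  rewrite /dotm big_ord1; apply: eq_bigr => a _.
  by rewrite !mxE (negbTE uA) (negbTE vA); field.
have e2E a : e2 u v a x = cov v a u a x / N x + e u a x * e v a x / N x.
  by rewrite /cov /e2 (S_comm _ _ _ uv); field.
have -> : F x u v = N x * (w u v * (4^-1 - 4^-1 * dotm (b_of A x u) (b_of A x v))) -
    w u v / 4 * \sum_(a < 3) cov v a u a x / N x.
  rewrite /F dE (eq_bigr _ (fun a _ => e2E a)) big_split/=.
  have -> : \sum_(a < 3) e u a x * e v a x / N x = N x * \sum_(a < 3) e u a x * e v a x / N x ^+ 2.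
    by rewrite mulr_sumr; apply: eq_bigr => a _; field.
  by field.
rewrite lerD2l -mulrN -sumrN.
apply: (@le_trans _ _ (w u v / 8 * \sum_(a < 3) (cov v a u a x ^+ 2 / N x ^+ 3 / t + t * N x))).
  rewrite !mulr_sumr; apply: ler_sum => a _.
  rewrite -!mulrA ler_wpM2l//.
  set k := cov v a u a x.
  have -> : k * (k * (N x ^- 3 * t^-1)) + t * N x = (k / N x + t * N x) ^+ 2 / (t * N x) - 2 * (k / N x).
    by field; rewrite NxN0 gt_eqF.
  have : 0 <= (k / N x + t * N x) ^+ 2 / (t * N x) by rewrite divr_ge0 ?sqr_ge0// mulr_ge0 ?ltW.
  by lra.
rewrite ler_wpM2r// ?ler_pM2r ?invr_gt0 ?ltr0n//.
apply: sumr_ge0 => a _; apply: addr_ge0; last by rewrite mulr_ge0 ?ltW.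
apply: divr_ge0; last exact: ltW.
by apply: divr_ge0; [exact: sqr_ge0|rewrite exprn_ge0// ltW].
Qed.

(** If no measurement pays, then for each [u] the squared covariances sum to at most
    [3 * n * t ^+ 2] times the weight, one share for each axis along which [u] could be measured.
    With the [t * N x] terms of [F_stop] the total error is [6 / 8 * C * t] per unit weight. *)
Let energy_stop (A : {set 'I_n}) x : 0 < N x ->
  (forall q b, q \notin A -> n%:R^-1 * (\sum_(u < n | u \notin q |: A) \sum_(a < 3)
     cov u a q b x ^+ 2 / N x ^+ 3) <= t ^+ 2 * N x) ->
  energy A x <= (c + C * t) * N x.
Proof.
move=> Nx stop.
pose X u v := \sum_(a < 3) cov v a u a x ^+ 2 / N x ^+ 3.
have X0 u v : 0 <= X u v.
  by apply: sumr_ge0 => a _; rewrite divr_ge0 ?sqr_ge0 ?exprn_ge0 ?ltW.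
have NxN0 : N x != 0 by rewrite gt_eqF.
have nN0 : n%:R != 0 :> R by rewrite gt_eqF.
pose D u v := w u v * (4^-1 - 4^-1 * dotm (b_of A x u) (b_of A x v)).
have Dle : \sum_(u < n | u \notin A) \sum_(v < n | (v \notin A) && (u < v)%N) D u v <= c.
  apply: le_trans (c_ge (fun u => b_of_ball A u Nx)).
  have D0 u v : (u \in A) || (v \in A) -> 0 <= D u v.
    move=> uvA; rewrite /D (_ : dotm _ _ = 0) ?mulr0 ?subr0 ?mulr_ge0 ?invr_ge0 ?ler0n//.
    rewrite /dotm big_ord1 big1// => a _; rewrite !mxE.
    by move: uvA => /orP[] ->; rewrite ?mul0r ?mulr0.
  rewrite big_mkcond/=; apply: ler_sum => u _; case: ifPn => uA; last first.
    by apply: sumr_ge0 => v _; apply: D0; move: uA; rewrite negbK => ->.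
  rewrite big_mkcond [leRHS]big_mkcond/=; apply: ler_sum => v _.
  by case: (ltnP u v) => _; rewrite ?andbF// andbT; case: ifPn => // vA; apply: D0; move: vA; rewrite negbK orbC => ->.
have XS u : u \notin A -> \sum_(v < n | (v \notin A) && (u < v)%N) X u v <= 3 * n%:R * t ^+ 2 * N x.
  move=> uA; apply: (@le_trans _ _ (\sum_(b < 3) \sum_(v < n | v \notin u |: A) \sum_(a < 3)
     cov v a u b x ^+ 2 / N x ^+ 3)).
    rewrite [leRHS]exchange_big/= big_mkcond [leRHS]big_mkcond/=; apply: ler_sum => v _.
    rewrite !inE negb_or.
    have Y0 : 0 <= \sum_(j < 3) \sum_(a < 3) cov v a u j x ^+ 2 / N x ^+ 3.
      by apply: sumr_ge0 => j _; apply: sumr_ge0 => a _; rewrite divr_ge0 ?sqr_ge0 ?exprn_ge0 ?ltW.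
    case: ifPn => [/andP[vA uv]|_]; last by case: ifP.
    rewrite vA andbT; have -> : v != u by apply: contraTneq uv => ->; rewrite ltnn.
    apply: ler_sum => a _; rewrite (bigD1 a)//= lerDl.
    by apply: sumr_ge0 => j _; rewrite divr_ge0 ?sqr_ge0 ?exprn_ge0 ?ltW.
  have h b := stop u b uA.
  apply: (@le_trans _ _ (\sum_(b < 3) n%:R * (t ^+ 2 * N x))).
    by apply: ler_sum => b _; rewrite -ler_pdivrMl// h.
  by rewrite sumr_const card_ord -mulr_natl; rewrite le_eqVlt; apply/orP; left; apply/eqP; ring.
have := @ler_sum R 'I_n (index_enum _) (fun u => u \notin A) (fun u => \sum_(v < n | (v \notin A) && (u < v)%N) F x u v)
  (fun u => N x * (\sum_(v < n | (v \notin A) && (u < v)%N) D u v) + C / n%:R ^+ 2 / 8 * (6 * n%:R * t * N x)).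
rewrite -/(energy A x) => /(_ _)/le_trans; apply.
  move=> u uA; rewrite mulr_sumr.
  have -> : C / n%:R ^+ 2 / 8 * (6 * n%:R * t * N x) =
     C / n%:R ^+ 2 / 8 * ((3 * n%:R * t ^+ 2 * N x) / t + n%:R * (3 * t * N x)).
    by field; rewrite nN0 gt_eqF.
  apply: (@le_trans _ _ (\sum_(v < n | (v \notin A) && (u < v)%N) (N x * D u v) + C / n%:R ^+ 2 / 8 *
     ((\sum_(v < n | (v \notin A) && (u < v)%N) X u v) / t + \sum_(v < n | (v \notin A) && (u < v)%N) (3 * t * N x)))).
    rewrite mulr_suml -big_split mulr_sumr -big_split/=; apply: ler_sum => v /andP[vA uv].
    have uv' : u != v by apply: contraTneq uv => ->; rewrite ltnn.
    apply: le_trans (F_stop Nx uA vA uv') _; rewrite lerD2l.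
    rewrite big_split/= sumr_const card_ord -mulr_suml /X.
    by rewrite (_ : t * N x *+ 3 = 3 * t * N x)//; ring.
  rewrite lerD2l ler_wpM2l ?mulr_ge0 ?divr_ge0 ?exprn_ge0 ?invr_ge0 ?ler0n//.
  apply: lerD; first by rewrite ler_pM2r ?invr_gt0// XS.
  have h3 : 0 <= 3 * t * N x by rewrite !mulr_ge0 ?ltW.
  rewrite sumr_const -(mulr_natl (3 * t * N x)) ler_wpM2r// ler_nat.
  by apply: leq_trans (max_card _) _; rewrite card_ord.
rewrite big_split/= -mulr_sumr sumr_const.
apply: (@le_trans _ _ (N x * c + C / n%:R ^+ 2 / 8 * (6 * n%:R * t * N x) *+ n)).
  apply: lerD; first by apply: ler_wpM2l => //; exact: ltW.
  rewrite -!(mulr_natr (_ * _)) ler_wpM2l//; last first.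
    by rewrite ler_nat; apply: leq_trans (max_card _) _; rewrite card_ord.
  by rewrite !mulr_ge0 ?divr_ge0 ?exprn_ge0 ?invr_ge0 ?ler0n// ltW.
rewrite -mulr_natr.
have -> : C / n%:R ^+ 2 / 8 * (6 * n%:R * t * N x) * n%:R = C * t * N x * (6 / 8) by field.
have : 0 <= C * t * N x by rewrite !mulr_ge0// ltW.
by lra.
Qed.

(** Induction on the number of unmeasured vertices. Either no measurement raises the potential
    enough, and [energy_stop] applies, or one does, and the induction hypothesis is used in both
    branches: their weights add up to [N x], and [K] times the gain in [Phi] pays for the discarded
    edges. *)
Let energy_le (A : {set 'I_n}) x : energy A x <= (c + C * t) * N x + K * (3 * N x - Phi A x).
Proof.
have [k] := ubnP #|~: A|; elim: k A x => // k IH A x kA.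
have := ip_ge0 x; rewrite -/(N x) le_eqVlt => /predU1P[N0|Nx].
  have e0 u a : e u a x = 0 by have := e_le u a x; rewrite -N0 normr_le0 => /eqP.
  rewrite /energy big1; last first.
    move=> u _; rewrite big1// => v _; rewrite /F -N0 big1 ?subr0 ?mulr0// => a _.
    by have := e2_le u v a x; rewrite -N0 normr_le0 => /eqP.
  rewrite -N0 /Phi big1 ?mulr0 ?subr0 ?mulr0 ?addr0// => u _; rewrite big1// => a _.
  by rewrite e0 expr0n/= mul0r.
have Phi_le : Phi A x <= 3 * N x.
  rewrite /Phi mulrC ler_pdivrMr//.
  apply: (@le_trans _ _ (\sum_(u < n) N x)).
    rewrite big_mkcond/=; apply: ler_sum => u _; case: ifP => _; last exact: ltW.
    rewrite -mulr_suml ler_pdivrMr//; exact: bloch.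
  rewrite sumr_const card_ord -mulr_natr.
  have := mulr_ge0 (ltW Nx) (ltW nR_gt0); lra.
have [[q [b [qA qb]]]|stop] := pselect (exists q b, q \notin A /\ t ^+ 2 * N x < n%:R^-1 * (\sum_(u < n | u \notin q |: A) \sum_(a < 3)
     cov u a q b x ^+ 2 / N x ^+ 3)); last first.
  apply: (@le_trans _ _ ((c + C * t) * N x)).
    apply: energy_stop => // q b qA; rewrite leNgt; apply/negP => h.
    by apply: stop; exists q, b.
  by rewrite lerDl mulr_ge0// subr_ge0.
have qA' : q \in q |: A by rewrite setU11.
apply: le_trans (energy_remove x qA) _.
rewrite (energy_split b x qA').
have kA' : (#|~: (q |: A)| < k)%N.
  rewrite -ltnS (leq_trans _ kA)// ltnS; apply: proper_card.
  rewrite finset.setCU properE finset.subsetIr/=; apply/negP => /fintype.subsetP/(_ q).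
  by rewrite !inE eqxx qA /= => /(_ isT).
have h1 := IH _ (xp q b x) kA'; have h2 := IH _ (xm q b x) kA'.
have h3 := Phi_split b x qA'; have h4 := Phi_remove qA Nx.
have [h5 _] := N_split q b x.
have h6 : Phi A x + (t ^+ 2 - 3 / n%:R) * N x <= Phi (q |: A) (xp q b x) + Phi (q |: A) (xm q b x).
  by move: h3 h4 qb; lra.
have h7 : K * (t ^+ 2 - 3 / n%:R) = 2 * C / n%:R by rewrite /K divfK// gt_eqF// subr_gt0.
have h8 := ler_wpM2l K_ge0 h6.
have h9 : (c + C * t) * N x = (c + C * t) * N (xp q b x) + (c + C * t) * N (xm q b x) by rewrite -mulrDr h5.
have h10 : K * (3 * N x) = K * (3 * N (xp q b x)) + K * (3 * N (xm q b x)) by rewrite -!mulrDr h5.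
have h11 : K * (t ^+ 2 - 3 / n%:R) * N x = 2 * C / n%:R * N x by rewrite h7.
by move: h1 h2 h8 h9 h10 h11; lra.
Qed.

Theorem mean_field_bound x :
  \sum_(u < n) \sum_(v < n | (u < v)%N)
    w u v * (4^-1 * (ip x x - \sum_(a < 3) ip x (S u a (S v a x)))) <=
  (c + C * t + 6 * C / n%:R / (t ^+ 2 - 3 / n%:R)) * ip x x.
Proof.
have := energy_le finset.set0 x; rewrite /energy.
under eq_bigl do rewrite inE; under eq_bigr do under eq_bigl do rewrite inE/=.
move=> /le_trans; apply.
have : 0 <= K * Phi finset.set0 x.
  rewrite mulr_ge0// mulr_ge0 ?invr_ge0 ?ler0n// sumr_ge0// => u _; rewrite sumr_ge0// => a _.
  by rewrite divr_ge0 ?sqr_ge0 ?ip_ge0.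
by rewrite /K -/(N x); lra.
Qed.

End mean_field.

(** * Qubits and the Heisenberg Hamiltonian *)

Section qubits.
Context {R : realType} {n : nat}.
Local Notation C := (Defs.C R).
Local Notation basis := Defs.basis.
Local Notation W := {ffun basis n -> Rcomplex R}.

Definition upd (t : basis n) (u : 'I_n) (b : 'I_2) : basis n :=
  [ffun x => if x == u then b else t x].

Lemma upd_eq t u b : upd t u b u = b.
Proof. by rewrite ffunE eqxx. Qed.

Lemma upd_neq t u b v : v != u -> upd t u b v = t v.
Proof. by rewrite ffunE => /negbTE->. Qed.

Lemma upd_upd t u b c : upd (upd t u b) u c = upd t u c.
Proof. by apply/ffunP => x; rewrite !ffunE; case: eqP. Qed.

Lemma upd_id t u : upd t u (t u) = t.
Proof. by apply/ffunP => x; rewrite !ffunE; case: eqP => // ->. Qed.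

Lemma upd_comm t u v b c : u != v -> upd (upd t u b) v c = upd (upd t v c) u b.
Proof.
move=> uv; apply/ffunP => x; rewrite !ffunE; case: (eqVneq x v) => [->|//].
by rewrite eq_sym (negbTE uv).
Qed.

(** States are row vectors on which matrices act from the right, as in [eigenvalue], so products
    appear in reverse order in [opM]. [Rcomplex] turns the amplitudes into a real vector space, the
    setting of the mean-field bound. *)
Definition op (u : 'I_n) (A : 'M[C]_2) (psi : W) : W :=
  [ffun t => \sum_(b < 2) (psi (upd t u b) : C) * A b (t u)].

Definition pauli (a : 'I_3) : 'M[C]_2 :=
  if a == 0 :> nat then pauliX R else if a == 1 :> nat then pauliY R else pauliZ R.

Lemma opM u A B psi : op u B (op u A psi) = op u (A *m B) psi.
Proof.
apply/ffunP => t; rewrite !ffunE.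
under eq_bigr do rewrite ffunE mulr_suml; rewrite exchange_big/=.
apply: eq_bigr => b _; rewrite mxE mulr_sumr; apply: eq_bigr => c _.
by rewrite upd_eq upd_upd mulrA.
Qed.

Lemma op_comm u v A B psi : u != v -> op u A (op v B psi) = op v B (op u A psi).
Proof.
move=> uv; apply/ffunP => t; rewrite !ffunE.
under eq_bigr do rewrite ffunE mulr_suml.
under [RHS]eq_bigr do rewrite ffunE mulr_suml.
rewrite exchange_big/=; apply: eq_bigr => b _; apply: eq_bigr => c _.
by rewrite upd_comm// !upd_neq// 1?eq_sym// mulrAC.
Qed.

Lemma opD u A (x y : W) : op u A (x + y) = op u A x + op u A y.
Proof.
apply/ffunP => t; rewrite !ffunE -big_split/=; apply: eq_bigr => b _.
by rewrite ffunE mulrDl.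
Qed.

Lemma scaleRC (k : R) (z : Rcomplex R) : k *: z = (k%:C)%C * z :> C.
Proof. by case: z => a b; apply/eqP; rewrite eq_complex/= !mul0r subr0 addr0 !eqxx. Qed.

Lemma opZ u A (k : R) (x : W) : op u A (k *: x) = k *: op u A x.
Proof.
apply/ffunP => t; rewrite !ffunE scaleRC mulr_sumr; apply: eq_bigr => b _.
by rewrite ffunE scaleRC mulrA.
Qed.

Lemma op1 u (x : W) : op u 1%:M x = x.
Proof.
apply/ffunP => t; rewrite !ffunE (bigD1 (t u))//= big1 ?addr0.
  by rewrite mxE eqxx mulr1 upd_id.
by move=> b bt; rewrite mxE (negbTE bt) mulr0.
Qed.

Lemma opN u A (x : W) : op u (- A) x = - op u A x.
Proof.
by apply/ffunP => t; rewrite !ffunE -sumrN; apply: eq_bigr => b _; rewrite mxE mulrN.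
Qed.

Definition cip (x y : W) : C := \sum_s (x s : C) * ((y s : C)^*)%C.
Definition ip (x y : W) : R := complex.Re (cip x y).

Lemma ip_sum x y : ip x y = \sum_s (complex.Re (x s) * complex.Re (y s) + complex.Im (x s) * complex.Im (y s)).
Proof.
rewrite /ip /cip (raddf_sum (@complex.Re R : {additive Rcomplex R -> R}))/=; apply: eq_bigr => s _.
by case: (x s) => a b; case: (y s) => c d /=; ring.
Qed.

Lemma ip_addl x y z : ip (x + y) z = ip x z + ip y z.
Proof.
rewrite !ip_sum -big_split; apply: eq_bigr => s _; rewrite ffunE.
by case: (x s) => a b; case: (y s) => c d /=; ring.
Qed.

Lemma ip_scalel k x z : ip (k *: x) z = k * ip x z.
Proof.
rewrite !ip_sum mulr_sumr; apply: eq_bigr => s _; rewrite ffunE.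
by case: (x s) => a b /=; ring.
Qed.

Lemma ip_sym x y : ip x y = ip y x.
Proof. by rewrite !ip_sum; apply: eq_bigr => s _; rewrite mulrC (mulrC (complex.Im _)). Qed.

Lemma ip_self x : ip x x = \sum_s (complex.Re (x s) ^+ 2 + complex.Im (x s) ^+ 2).
Proof. by rewrite ip_sum; apply: eq_bigr => s _; rewrite !expr2. Qed.

Lemma ip_self_ge0 x : 0 <= ip x x.
Proof. by rewrite ip_self; apply: sumr_ge0 => s _; rewrite addr_ge0 ?sqr_ge0. Qed.

Lemma cip_op u (A : 'M[C]_2) x y : (forall i j, A i j = ((A j i)^*)%C) ->
  cip x (op u A y) = cip (op u A x) y.
Proof.
move=> Aherm; rewrite /cip.
under eq_bigr do rewrite ffunE rmorph_sum/= mulr_sumr.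
under [RHS]eq_bigr do rewrite ffunE mulr_suml.
rewrite !pair_big/=.
(* Exchanging the bit at [u] with the summation index is an involution on pairs; it moves the
   operator to the other argument. *)
rewrite (reindex_inj (h := fun p : basis n * 'I_2 => (upd p.1 u p.2, p.1 u)))/=.
  apply: eq_bigr => -[t b] _ /=; rewrite upd_upd upd_id upd_eq rmorphM/= -Aherm.
  by rewrite mulrA mulrAC.
move=> [t b] [t' b'] /= [h1 h2].
have -> : b = b' by rewrite -(upd_eq t u b) h1 upd_eq.
by congr pair; rewrite -(upd_id t u) -(upd_id t' u) h2 -(upd_upd t u b) h1 upd_upd.
Qed.

Lemma pauli_herm a i j : pauli a i j = ((pauli a j i)^*)%C.
Proof.
rewrite /pauli; do 2?case: ifP => _; rewrite !mxE; case: i => [[|[|//]] i2]; case: j => [[|[|//]] j2] //=;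
 by apply/eqP; rewrite eq_complex /= ?oppr0 ?opprK !eqxx.
Qed.

Lemma pauli_sq a : pauli a *m pauli a = 1%:M.
Proof.
apply/matrixP => i j; rewrite /pauli; do 2?case: ifP => _; rewrite !mxE !big_ord_recl big_ord0 !mxE;
 case: i => [[|[|//]] i2]; case: j => [[|[|//]] j2] //=;
 by apply/eqP; rewrite eq_complex /= ?(mul0r, mulr0, mul1r, mulr1, addr0, add0r, subr0, oppr0, opprK, mulrNN, mulrN, mulNr) ?eqxx.
Qed.

Lemma pauli_anti a b : a != b -> pauli a *m pauli b = - (pauli b *m pauli a).
Proof.
move=> ab; apply/matrixP => i j; move: ab.
case: a => [[|[|[|//]]] a2]; case: b => [[|[|[|//]]] b2] //= _; rewrite /pauli/= !mxE !big_ord_recl !big_ord0 !mxE;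
 case: i => [[|[|//]] i2]; case: j => [[|[|//]] j2] //=;
 by apply/eqP; rewrite eq_complex /= ?(mul0r, mulr0, mul1r, mulr1, addr0, add0r, subr0, oppr0, opprK, mulrNN, mulrN, mulNr) ?eqxx.
Qed.

Definition Sop u a (x : W) : W := op u (pauli a) x.

Lemma hQMC_pauli (b c i j : 'I_2) :
  hQMC R (b, c) (i, j) =
  4^-1 * ((b == i)%:R * (c == j)%:R - \sum_(a < 3) pauli a b i * pauli a c j).
Proof.
rewrite /hQMC /kron2 !big_ord_recl big_ord0 addr0 /pauli/= !opprD !addrA.
by congr (_ * (_ - _ - _ - _)); rewrite !mxE; do 2 case: eqP.
Qed.

(** The product of deltas in [h_edge] leaves only the [s] that agree with [t] off [u] and [v]; these
    are parametrised by their bits at [u] and [v]. *)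
Lemma edge_action u v (psi : W) t : u != v ->
  \sum_s (psi s : C) * h_edge R u v s t =
  4^-1 * ((psi t : C) - \sum_(a < 3) (Sop u a (Sop v a psi) t : C)).
Proof.
move=> uv.
pose P (s : basis n) := [forall x, (x != u) && (x != v) ==> (s x == t x)].
have prodE (s : basis n) : \prod_(x < n | (x != u) && (x != v)) (if s x == t x then 1 else 0) = (P s)%:R :> C.
  have [Ps|] := boolP (P s).
    by rewrite big1// => x xuv; move/forallP : Ps => /(_ x); rewrite xuv/= => ->.
  rewrite negb_forall => /existsP[x]; rewrite negb_imply => /andP[xuv /negbTE sx].
  by rewrite (bigD1 x)//= sx mul0r.
transitivity (\sum_(s | P s) (psi s : C) * hQMC R (s u, s v) (t u, t v)).
  rewrite [RHS]big_mkcond/=; apply: eq_bigr => s _; rewrite /h_edge prodE.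
  by case: (P s); rewrite ?mulr1// !mulr0.
rewrite (reindex_onto (fun p : 'I_2 * 'I_2 => upd (upd t u p.1) v p.2) (fun s => (s u, s v)))/=; last first.
  move=> s /forallP Ps; apply/ffunP => x; rewrite !ffunE.
  case: (eqVneq x v) => [->//|xv]; case: (eqVneq x u) => [->//|xu].
  by have := Ps x; rewrite xv xu/= => /eqP->.
transitivity (\sum_(p : 'I_2 * 'I_2) (psi (upd (upd t u p.1) v p.2) : C) * hQMC R (p.1, p.2) (t u, t v)).
  have E (p : 'I_2 * 'I_2) : (upd (upd t u p.1) v p.2 u, upd (upd t u p.1) v p.2 v) = p.
    by case: p => b c; rewrite upd_eq upd_neq// upd_eq.
  apply: eq_big => [p|p _]; last by rewrite E -surjective_pairing.
  rewrite E eqxx andbT; apply/forallP => x; apply/implyP => /andP[xu xv].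
  by rewrite !upd_neq.
have F (p : 'I_2 * 'I_2) : (psi (upd (upd t u p.1) v p.2) : C) * hQMC R (p.1, p.2) (t u, t v) =
    4^-1 * ((psi (upd (upd t u p.1) v p.2) : C) * ((p.1 == t u)%:R * (p.2 == t v)%:R)) -
    4^-1 * \sum_(a < 3) (psi (upd (upd t u p.1) v p.2) : C) * (pauli a p.2 (t v) * pauli a p.1 (t u)).
  rewrite hQMC_pauli mulrCA mulrBr mulr_sumr mulrBr; congr (_ - _ * _).
  by apply: eq_bigr => a _; rewrite (mulrC (pauli a _ (t u))).
rewrite (eq_bigr _ (fun p _ => F p)) sumrB -!mulr_sumr -mulrBr; congr (_ * (_ - _)).
  rewrite (bigD1 (t u, t v))//= big1 ?addr0; first by rewrite !eqxx !mulr1 upd_id upd_id.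
  move=> -[b c] /=; rewrite xpair_eqE negb_and => /orP[] /negbTE->; rewrite ?mul0r ?mulr0//.
rewrite exchange_big/=; apply: eq_bigr => a _.
rewrite /Sop !ffunE -(pair_bigA _ (fun b c => (psi (upd (upd t u b) v c) : C) * (pauli a c (t v) * pauli a b (t u))))/=.
apply: eq_bigr => b _; rewrite ffunE mulr_suml; apply: eq_bigr => c _.
by rewrite upd_neq 1?eq_sym// mulrA.
Qed.

Definition psi_of (v : 'rV[C]_(#|{: basis n}|)) : W := [ffun s => v ord0 (enum_rank s)].

Local Open Scope sesquilinear_scope.

Lemma norm_psi_of v : (v *m v ^t*) ord0 ord0 = ((ip (psi_of v) (psi_of v))%:C)%C.
Proof.
rewrite mxE (reindex (@enum_rank (basis n)))/=; last exact/onW_bij/enum_rank_bij.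
rewrite ip_self (raddf_sum (real_complex R : {additive R -> C}))/=; apply: eq_bigr => s _.
rewrite !ffunE !mxE; case: (v _ _) => a b; apply/eqP; rewrite eq_complex/=.
by apply/andP; split; apply/eqP; ring.
Qed.

Lemma energy_psi_of (w : 'I_n -> 'I_n -> R) v :
  complex.Re ((v *m H_G w *m v ^t*) ord0 ord0) =
  \sum_(u < n) \sum_(u' < n | (u < u')%N)
    w u u' * (4^-1 * (ip (psi_of v) (psi_of v) -
       \sum_(a < 3) ip (psi_of v) (Sop u a (Sop u' a (psi_of v))))).
Proof.
set psi := psi_of v.
have -> : (v *m H_G w *m v ^t*) ord0 ord0 = \sum_(u < n) \sum_(u' < n | (u < u')%N)
    ((w u u')%:C)%C * (4^-1 * (cip psi psi - \sum_(a < 3) cip (Sop u a (Sop u' a psi)) psi)).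
  rewrite mxE (reindex (@enum_rank (basis n)))/=; last exact/onW_bij/enum_rank_bij.
  transitivity (\sum_t (\sum_s (psi s : C) * \sum_(u < n) \sum_(u' < n | (u < u')%N)
       ((w u u')%:C)%C * h_edge R u u' s t) * ((psi t : C)^*)%C).
    apply: eq_bigr => t _; rewrite !mxE !ffunE; congr (_ * _).
    rewrite (reindex (@enum_rank (basis n)))/=; last exact/onW_bij/enum_rank_bij.
    by apply: eq_bigr => s _; rewrite !mxE !ffunE !enum_rankK.
  transitivity (\sum_t \sum_(u < n) \sum_(u' < n | (u < u')%N) ((w u u')%:C)%C *
      ((\sum_s (psi s : C) * h_edge R u u' s t) * ((psi t : C)^*)%C)).
    apply: eq_bigr => t _; under eq_bigr do rewrite mulr_sumr.
    rewrite exchange_big/= mulr_suml; apply: eq_bigr => u _.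
    under eq_bigr do rewrite mulr_sumr.
    rewrite exchange_big/= mulr_suml; apply: eq_bigr => u' _.
    rewrite mulrA; congr (_ * _); rewrite mulr_sumr; apply: eq_bigr => s _.
    by rewrite mulrCA.
  rewrite exchange_big/=; apply: eq_bigr => u _.
  rewrite exchange_big/=; apply: eq_bigr => u' uu'.
  rewrite -mulr_sumr; congr (_ * _).
  have nuu' : u != u' by apply: contraTneq uu' => ->; rewrite ltnn.
  have E t : (\sum_s (psi s : C) * h_edge R u u' s t) * ((psi t : C)^*)%C =
      4^-1 * ((psi t : C) * ((psi t : C)^*)%C -
        \sum_(a < 3) (Sop u a (Sop u' a psi) t : C) * ((psi t : C)^*)%C).
    by rewrite (edge_action psi t nuu') -mulrA mulrBl mulr_suml.
  rewrite (eq_bigr _ (fun t _ => E t)).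
  by rewrite -mulr_sumr sumrB; congr (_ * (_ - _)); rewrite exchange_big.
rewrite (raddf_sum (@complex.Re R : {additive Rcomplex R -> R}))/=; apply: eq_bigr => u _.
rewrite (raddf_sum (@complex.Re R : {additive Rcomplex R -> R}))/=; apply: eq_bigr => u' _.
have ReM (k : R) (z : C) : complex.Re ((k%:C)%C * z) = k * complex.Re z.
  by case: z => a b /=; rewrite mul0r subr0.
rewrite ReM; congr (_ * _).
have -> : (4^-1 : C) = ((4^-1)%:C)%C by rewrite fmorphV rmorph_nat.
rewrite ReM; congr (_ * _).
rewrite (raddfB (@complex.Re R : {additive Rcomplex R -> R})); congr (_ - _).
rewrite (raddf_sum (@complex.Re R : {additive Rcomplex R -> R}))/=.
by apply: eq_bigr => a _; rewrite ip_sym.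
Qed.

Lemma ip_self_eq0 (v : 'rV[C]_(#|{: basis n}|)) : v != 0 -> 0 < ip (psi_of v) (psi_of v).
Proof.
move=> v0; rewrite lt_neqAle ip_self_ge0 andbT eq_sym; apply: contra v0.
rewrite ip_self psumr_eq0 => [/allP h|s _]; last by rewrite addr_ge0 ?sqr_ge0.
apply/eqP/rowP => i; have := h (enum_val i); rewrite mem_index_enum => /(_ isT)/=.
rewrite paddr_eq0 ?sqr_ge0// !expf_eq0/= ffunE enum_valK mxE => /andP[/eqP h1 /eqP h2].
by apply/eqP; rewrite eq_complex /= h1 h2 !eqxx.
Qed.

Lemma eigenvalue_energy (w : 'I_n -> 'I_n -> R) (lam B : R) :
  (forall psi : W, \sum_(u < n) \sum_(v < n | (u < v)%N)
    w u v * (4^-1 * (ip psi psi - \sum_(a < 3) ip psi (Sop u a (Sop v a psi)))) <= B * ip psi psi) ->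
  eigenvalue (H_G w) (lam%:C)%C -> lam <= B.
Proof.
move=> hB /eigenvalueP[v vH v0].
have := hB (psi_of v); rewrite -energy_psi_of vH -scalemxAl mxE norm_psi_of.
rewrite -rmorphM/= ler_pM2r//; exact: ip_self_eq0.
Qed.

Lemma hQMC_herm p q : hQMC R p q = ((hQMC R q p)^*)%C.
Proof.
case: p => b c; case: q => i j; rewrite !hQMC_pauli rmorphM rmorphB rmorphM rmorph_sum.
rewrite fmorphV !rmorph_nat (eq_sym b) (eq_sym c); congr (_ * (_ - _)).
by apply: eq_bigr => a _; rewrite rmorphM/= -!pauli_herm.
Qed.

Lemma H_G_herm (w : 'I_n -> 'I_n -> R) : H_G w \is hermsymmx.
Proof.
apply/is_hermitianmxP; rewrite expr0 scale1r; apply/matrixP => i j; rewrite !mxE.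
rewrite rmorph_sum; apply: eq_bigr => u _; rewrite rmorph_sum; apply: eq_bigr => v _.
rewrite rmorphM; congr (_ * _); first by apply/esym/conjc_real.
rewrite /h_edge rmorphM hQMC_herm; congr (_ * _).
rewrite rmorph_prod; apply: eq_bigr => x _; rewrite eq_sym.
by case: ifP => _; rewrite ?rmorph0 ?rmorph1.
Qed.

(** The rows of the diagonalising unitary matrix are eigenvectors. In particular the set whose
    supremum is [QMaxCut] is inhabited. *)
Lemma H_G_spectral_eigenvalue (w : 'I_n -> 'I_n -> R) i :
  eigenvalue (H_G w) ((complex.Re (spectral_diag (H_G w) ord0 i))%:C)%C.
Proof.
have Hh := H_G_herm w.
have /orthomx_spectralP HE := hermitian_normalmx Hh.
have spr := hermitian_spectral_diag_real Hh.
set P := spectralmx _ in HE; set d := spectral_diag _ in HE spr *.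
have Pu : P \is unitarymx by exact: spectral_unitarymx.
rewrite invmx_unitary// in HE.
rewrite (RRe_real (mxOverP spr _ _)); apply/eigenvalueP; exists (row i P).
  rewrite HE !mulmxA -row_mul (unitarymxP Pu) row1 -rowE row_diag_mx -scalemxAl -rowE//.
apply/eqP => /rowP r0; have h0 j : P i j = 0 by have := r0 j; rewrite !mxE.
have /matrixP/(_ i i) := unitarymxP Pu; rewrite !mxE eqxx big1 => [/eqP|j _]; last by rewrite h0 mul0r.
by rewrite eq_sym oner_eq0.
Qed.

Lemma rayleigh (w : 'I_n -> 'I_n -> R) (Q : R) (v : 'rV[C]_(#|{: basis n}|)) :
  (forall lam : R, eigenvalue (H_G w) (lam%:C)%C -> lam <= Q) ->
  complex.Re ((v *m H_G w *m v ^t*) ord0 ord0) <= Q * ip (psi_of v) (psi_of v).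
Proof.
move=> hQ; set H := H_G w.
have Hh := H_G_herm w.
have /orthomx_spectralP HE := hermitian_normalmx Hh.
have spr := hermitian_spectral_diag_real Hh.
set P := spectralmx H in HE; set d := spectral_diag H in HE spr.
have Pu : P \is unitarymx by exact: spectral_unitarymx.
rewrite invmx_unitary// in HE.
have PtP : P ^t* *m P = 1%:M.
  by rewrite -invmx_unitary// mulVmx// unitarymx_unit.
pose y := v *m P ^t*.
have yE : y ^t* = P *m v ^t* by rewrite /y trmx_mul map_mxM trmxCK.
have nE : (v *m v ^t*) = y *m y ^t*.
  by rewrite yE /y -mulmxA (mulmxA _ P) PtP mul1mx.
have eE : v *m H *m v ^t* = y *m diag_mx d *m y ^t*.
  by rewrite /H HE yE /y !mulmxA.
have dle i : d ord0 i <= (Q%:C)%C.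
  have := H_G_spectral_eigenvalue w i; rewrite -/H -/d => ed.
  by rewrite -(RRe_real (mxOverP spr _ _)) lecR; exact: hQ.
suff h : (v *m H *m v ^t*) ord0 ord0 <= (Q%:C)%C * (v *m v ^t*) ord0 ord0.
  by move: h; rewrite norm_psi_of -rmorphM lecE => /andP[_]; rewrite /=.
rewrite eE nE mul_mx_diag !mxE mulr_sumr; apply: ler_sum => i _; rewrite !mxE.
rewrite mulrAC mulrC; apply: ler_wpM2r => //.
exact: mul_conjC_ge0.
Qed.

(** Each two-spin expectation is at least [- ip psi psi], because [psi + T] has nonnegative squared
    norm. This bounds the spectrum from above, so that the supremum in [QMaxCut] is a genuine
    one. *)
Lemma spin_bound (w : 'I_n -> 'I_n -> R) (psi : W) u v : 0 <= w u v ->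
  w u v * (4^-1 * (ip psi psi - \sum_(a < 3) ip psi (Sop u a (Sop v a psi)))) <= w u v * ip psi psi.
Proof.
move=> w0; rewrite ler_wpM2l//.
have ipS u' a x y : ip x (Sop u' a y) = ip (Sop u' a x) y.
  by rewrite /ip cip_op//; exact: pauli_herm.
have SS u' a x : Sop u' a (Sop u' a x) = x by rewrite /Sop opM pauli_sq op1.
have h a : - ip psi psi <= ip psi (Sop u a (Sop v a psi)).
  set T := Sop u a _.
  have hT : ip T T = ip psi psi by rewrite /T ipS SS ipS SS.
  have := ip_self_ge0 (psi + T).
  rewrite ip_addl (ip_sym psi) (ip_sym T) !ip_addl hT (ip_sym T psi).
  by lra.
rewrite !big_ord_recl big_ord0; have := h ord0; have := h (lift ord0 ord0).
have := h (lift ord0 (lift ord0 ord0)); lra.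
Qed.

End qubits.

Section QMaxCut_bounds.
Context {R : realType}.

Lemma QMaxCut_has_ubound n (w : 'I_n -> 'I_n -> R) : wgraph w ->
  has_ubound [set lam : R | eigenvalue (H_G w) (lam%:C)%C].
Proof.
move=> [w0 _ _ w1]; exists 1 => lam; apply: eigenvalue_energy => psi.
apply: (@le_trans _ _ ((\sum_(u < n) \sum_(v < n | (u < v)%N) w u v) * ip psi psi)); last by rewrite w1.
rewrite mulr_suml; apply: ler_sum => u _; rewrite mulr_suml; apply: ler_sum => v _.
exact: spin_bound.
Qed.

Lemma QMaxCut_rayleigh n (w : 'I_n -> 'I_n -> R) v : wgraph w ->
  complex.Re ((v *m H_G w *m (v ^t*)%sesqui) ord0 ord0) <= QMaxCut w * ip (psi_of v) (psi_of v).
Proof.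
move=> wg; apply: rayleigh => lam elam; apply: ub_le_sup => //; exact: QMaxCut_has_ubound.
Qed.

Lemma QMaxCut_le n (w : 'I_n -> 'I_n -> R) (B : R) :
  (forall lam : R, eigenvalue (H_G w) (lam%:C)%C -> lam <= B) -> QMaxCut w <= B.
Proof.
move=> hB; apply: ge_sup; last by move=> x; exact: hB.
have c0 : (0 < #|{: Defs.basis n}|)%N by rewrite card_ffun !card_ord expn_gt0.
by exists (complex.Re (spectral_diag (H_G w) ord0 (Ordinal c0))); exact: H_G_spectral_eigenvalue.
Qed.

Theorem QMaxCut_mean_field n (w : 'I_n -> 'I_n -> R) (K c t : R) :
  (0 < n)%N -> wgraph w -> (forall u v, w u v <= K / n%:R ^+ 2) ->
  (forall b : 'I_n -> 'rV[R]_3, (forall u, in_ball (b u)) ->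
    \sum_(u < n) \sum_(v < n | (u < v)%N) w u v * (4^-1 - 4^-1 * dotm (b u) (b v)) <= c) ->
  0 < t -> 3 / n%:R < t ^+ 2 ->
  QMaxCut w <= c + K * t + 6 * K / n%:R / (t ^+ 2 - 3 / n%:R).
Proof.
move=> n0 [w0 _ _ _] wK hc t0 nt; apply: QMaxCut_le => lam; apply: eigenvalue_energy => psi.
have K0 : 0 <= K.
  have := le_trans (w0 (Ordinal n0) (Ordinal n0)) (wK _ _).
  by rewrite pmulr_lge0// invr_gt0 exprn_gt0// ltr0n.
apply: (mean_field_bound (S := fun u a x => Sop u a x) (ip := fun x y => ip x y)) => //.
- exact: ip_addl.
- exact: ip_scalel.
- exact: ip_sym.
- exact: ip_self_ge0.
- by move=> u a x y; exact: opD.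
- by move=> u a k x; exact: opZ.
- by move=> u a x y; rewrite /ip cip_op//; exact: pauli_herm.
- by move=> u a x; rewrite /Sop opM pauli_sq op1.
- by move=> u v a b x uv; exact: op_comm.
- by move=> u a b x ab; rewrite /Sop !opM pauli_anti 1?eq_sym// opN.
Qed.

End QMaxCut_bounds.

(** * Inner products and product states *)

Section dotm_theory.
Context {R : realType} {p q : nat}.
Implicit Types a b c : 'M[R]_(p, q).

Lemma dotmC a b : dotm a b = dotm b a.
Proof. by apply: eq_bigr => i _; apply: eq_bigr => j _; rewrite mulrC. Qed.

Lemma dotmDl a b c : dotm (a + b) c = dotm a c + dotm b c.
Proof.
rewrite /dotm -big_split; apply: eq_bigr => i _; rewrite -big_split; apply: eq_bigr => j _.
by rewrite mxE mulrDl.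
Qed.

Lemma dotmZl k a b : dotm (k *: a) b = k * dotm a b.
Proof.
rewrite /dotm mulr_sumr; apply: eq_bigr => i _; rewrite mulr_sumr; apply: eq_bigr => j _.
by rewrite mxE mulrA.
Qed.

Lemma dotmDr a b c : dotm a (b + c) = dotm a b + dotm a c.
Proof. by rewrite dotmC dotmDl !(dotmC a). Qed.

Lemma dotmZr k a b : dotm a (k *: b) = k * dotm a b.
Proof. by rewrite dotmC dotmZl dotmC. Qed.

Lemma dotmNl a b : dotm (- a) b = - dotm a b.
Proof. by rewrite -scaleN1r dotmZl mulN1r. Qed.

Lemma dotmNr a b : dotm a (- b) = - dotm a b.
Proof. by rewrite dotmC dotmNl dotmC. Qed.

Lemma dotm0l b : dotm 0 b = 0.
Proof. by rewrite -(scale0r 0) dotmZl mul0r. Qed.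

Lemma dotm0r b : dotm b 0 = 0.
Proof. by rewrite dotmC dotm0l. Qed.

Lemma dotm_suml (I : Type) (r : seq I) (P : pred I) (F : I -> 'M[R]_(p, q)) b :
  dotm (\sum_(i <- r | P i) F i) b = \sum_(i <- r | P i) dotm (F i) b.
Proof. exact: (big_morph (fun x => dotm x b) (fun x y => dotmDl x y b) (dotm0l b)). Qed.

Lemma dotm_sumr (I : Type) (r : seq I) (P : pred I) (F : I -> 'M[R]_(p, q)) b :
  dotm b (\sum_(i <- r | P i) F i) = \sum_(i <- r | P i) dotm b (F i).
Proof. by rewrite dotmC dotm_suml; apply: eq_bigr => i _; rewrite dotmC. Qed.

Lemma dotm_ge0 a : 0 <= dotm a a.
Proof. by apply: sumr_ge0 => i _; apply: sumr_ge0 => j _; rewrite -expr2 sqr_ge0. Qed.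

Lemma dotm_eq0 a : (dotm a a == 0) = (a == 0).
Proof.
apply/idP/idP => [|/eqP->]; last by rewrite dotm0l.
rewrite psumr_eq0 => [/allP h|i _]; last by apply: sumr_ge0 => j _; rewrite -expr2 sqr_ge0.
apply/eqP/matrixP => i j; have := h i; rewrite mem_index_enum => /(_ isT)/=.
rewrite psumr_eq0 => [/allP/(_ j)|k _]; last by rewrite -expr2 sqr_ge0.
by rewrite mem_index_enum => /(_ isT)/=; rewrite mulf_eq0 orbb mxE => /eqP.
Qed.

Lemma enorm_ge0 a : 0 <= enorm a.
Proof. exact: sqrtr_ge0. Qed.

Lemma enorm_sqr a : enorm a ^+ 2 = dotm a a.
Proof. by rewrite sqr_sqrtr// dotm_ge0. Qed.

Lemma enorm_eq0 a : (enorm a == 0) = (a == 0).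
Proof. by rewrite -dotm_eq0 -enorm_sqr expf_eq0. Qed.

Lemma dotm_le a b : dotm a b <= enorm a * enorm b.
Proof.
have [a0|a0] := eqVneq (enorm a) 0.
  by rewrite a0 mul0r; move/eqP : a0; rewrite enorm_eq0 => /eqP->; rewrite dotm0l.
have [b0|b0] := eqVneq (enorm b) 0.
  by rewrite b0 mulr0; move/eqP : b0; rewrite enorm_eq0 => /eqP->; rewrite dotm0r.
have ap : 0 < enorm a by rewrite lt_neqAle eq_sym a0 enorm_ge0.
have bp : 0 < enorm b by rewrite lt_neqAle eq_sym b0 enorm_ge0.
have := dotm_ge0 (enorm b *: a - enorm a *: b).
rewrite dotmDl !dotmDr !dotmNl !dotmNr !dotmZl !dotmZr (dotmC b a) -!enorm_sqr => h.
have {h} : 0 <= (enorm a * enorm b) * (enorm a * enorm b - dotm a b) by move: h; lra.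
by rewrite pmulr_rge0 ?mulr_gt0// subr_ge0.
Qed.

Lemma normr_dotm_le a b : `|dotm a b| <= enorm a * enorm b.
Proof.
rewrite ler_norml dotm_le andbT lerNl -dotmNl (le_trans (dotm_le _ _))//.
by rewrite /enorm dotmNl dotmNr opprK.
Qed.

Lemma dotm_normalize a : a != 0 -> dotm (normalize a) (normalize a) = 1.
Proof.
by move=> a0; rewrite /normalize dotmZl dotmZr -enorm_sqr; field; rewrite enorm_eq0.
Qed.

Lemma normalize0 : normalize (0 : 'M[R]_(p, q)) = 0.
Proof. by rewrite /normalize scaler0. Qed.

Lemma enorm_normalize_le a : enorm (normalize a) <= 1.
Proof.
have [->|a0] := eqVneq a 0; first by rewrite normalize0 /enorm dotm0l sqrtr0 ler01.
by rewrite /enorm dotm_normalize// sqrtr1.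
Qed.

Lemma normr_dotm_normalize a b : `|dotm (normalize a) (normalize b)| <= 1.
Proof.
apply: le_trans (normr_dotm_le _ _) _.
by rewrite mulr_ile1 ?enorm_ge0 ?enorm_normalize_le.
Qed.

End dotm_theory.

Lemma sum_lt_sym (R : realType) n (F : 'I_n -> 'I_n -> R) :
  (forall u v, F u v = F v u) -> (forall u, F u u = 0) ->
  \sum_(u < n) \sum_(v < n | (u < v)%N) F u v = 2^-1 * \sum_(u < n) \sum_(v < n) F u v.
Proof.
move=> Fs F0.
have -> : \sum_(u < n) \sum_(v < n) F u v =
    \sum_(u < n) \sum_(v < n | (u < v)%N) F u v + \sum_(u < n) \sum_(v < n | (v < u)%N) F u v.
  rewrite -big_split/=; apply: eq_bigr => u _.
  rewrite (bigID (fun v : 'I_n => (u < v)%N))/=; congr (_ + _).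
  rewrite [LHS]big_mkcond [RHS]big_mkcond/=; apply: eq_bigr => v _.
  by case: (ltngtP u v) => // /val_inj ->; rewrite F0.
have -> : \sum_(u < n) \sum_(v < n | (v < u)%N) F u v = \sum_(u < n) \sum_(v < n | (u < v)%N) F u v.
  rewrite (exchange_big_dep predT)//=; apply: eq_bigr => u _; apply: eq_bigr => v _.
  exact: Fs.
by field.
Qed.

Definition pvalue {R : realType} n (w : 'I_n -> 'I_n -> R) k (b : 'I_n -> 'rV[R]_k) : R :=
  \sum_(u < n) \sum_(v < n | (u < v)%N) w u v * (4^-1 - 4^-1 * dotm (b u) (b v)).

Section product_states.
Context {R : realType} {n : nat}.
Local Notation C := (Defs.C R).
Local Notation basis := Defs.basis.

Definition prodst (phi : 'I_n -> 'I_2 -> C) : {ffun basis n -> Rcomplex R} :=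
  [ffun s : basis n => \prod_x phi x (s x)].

Lemma op_prodst u A phi :
  op u A (prodst phi) = prodst (fun x c => if x == u then \sum_(b < 2) phi u b * A b c else phi x c).
Proof.
apply/ffunP => t; rewrite !ffunE (bigD1 u)//= eqxx mulr_suml; apply: eq_bigr => b _.
rewrite ffunE (bigD1 u)//= upd_eq mulrAC; congr (_ * _ * _).
by apply: eq_bigr => x xu; rewrite upd_neq// (negbTE xu).
Qed.

Lemma cip_prodst phi chi :
  cip (prodst phi) (prodst chi) = \prod_x \sum_(b < 2) phi x b * ((chi x b)^*)%C.
Proof.
rewrite bigA_distr_bigA/=; apply: eq_bigr => s _.
by rewrite !ffunE rmorph_prod -big_split.
Qed.

(** For the direction with angles [theta], [phi] the state is [(cos (theta / 2), exp (- i phi) sin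
    (theta / 2))], with [p = cos (theta / 2)]; the conjugate phase comes from the row-vector
    convention. At the south pole [p] vanishes and the second basis state is taken. *)
Lemma bloch_state (r : 'rV[R]_3) : dotm r r = 1 ->
  exists phi : 'I_2 -> C, \sum_(b < 2) phi b * ((phi b)^*)%C = 1 /\
    forall a, \sum_(c < 2) (\sum_(b < 2) phi b * pauli a b c) * ((phi c)^*)%C = ((r ord0 a)%:C)%C.
Proof.
pose i0 : 'I_3 := ord0; pose i1 : 'I_3 := lift ord0 ord0; pose i2 : 'I_3 := lift ord0 (lift ord0 ord0).
rewrite /dotm big_ord1 !big_ord_recl big_ord0 addr0 -/i0 -/i1 -/i2.
set x := r _ i0; set y := r _ i1; set z := r _ i2 => r1.
have E0 (h : (0 < 3)%N) : r ord0 (Ordinal h) = x by rewrite /x; congr (fun_of_matrix r _ _); exact: val_inj.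
have E1 (h : (1 < 3)%N) : r ord0 (Ordinal h) = y by rewrite /y; congr (fun_of_matrix r _ _); exact: val_inj.
have E2 (h : (2 < 3)%N) : r ord0 (Ordinal h) = z by rewrite /z; congr (fun_of_matrix r _ _); exact: val_inj.
have [z1|z1] := eqVneq z (-1).
  have xy : x * x + y * y = 0 by move: r1; rewrite z1; lra.
  have x0 : x = 0.
    by apply/eqP; move/eqP : xy; rewrite paddr_eq0 -?expr2 ?sqr_ge0// !expf_eq0/= => /andP[].
  have y0 : y = 0.
    by apply/eqP; move/eqP : xy; rewrite paddr_eq0 -?expr2 ?sqr_ge0// !expf_eq0/= => /andP[].
  exists (fun b => if b == 0 :> nat then 0 else 1); split.
    rewrite !big_ord_recl big_ord0/=; apply/eqP; rewrite eq_complex/=; apply/andP; split; apply/eqP; ring.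
  case=> [[|[|[|//]]] a2]; rewrite !big_ord_recl !big_ord0 /pauli/= !mxE/=.
  - rewrite E0 x0.
    by apply/eqP; rewrite eq_complex/=; apply/andP; split; apply/eqP; ring.
  - rewrite E1 y0.
    by apply/eqP; rewrite eq_complex/=; apply/andP; split; apply/eqP; ring.
  - rewrite E2 z1.
    by apply/eqP; rewrite eq_complex/=; apply/andP; split; apply/eqP; ring.
have zgt : 0 < 1 + z.
  rewrite lt_neqAle eq_sym addrC addr_eq0 z1/=.
  have : z ^+ 2 <= 1 by rewrite -r1 expr2 addrA lerDr addr_ge0// -expr2 sqr_ge0.
  by move=> h; rewrite leNgt; apply/negP => hz; nra.
pose p := Num.sqrt ((1 + z) / 2).
have p2 : p ^+ 2 = (1 + z) / 2 by rewrite sqr_sqrtr// divr_ge0// ltW.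
have p0 : p != 0 by rewrite gt_eqF// sqrtr_gt0 divr_gt0.
have h : (x / (2 * p)) ^+ 2 + (y / (2 * p)) ^+ 2 = (1 - z) / 2.
  have -> : (x / (2 * p)) ^+ 2 + (y / (2 * p)) ^+ 2 = (x * x + y * y) / (4 * p ^+ 2) by field.
  rewrite p2 (_ : x * x + y * y = 1 - z * z); last by move: r1; lra.
  by field; rewrite gt_eqF.
exists (fun b => if b == 0 :> nat then (p%:C)%C else ((x / (2 * p)) -i* (y / (2 * p)))%C); split.
  rewrite !big_ord_recl big_ord0/=; apply/eqP; rewrite eq_complex/=; apply/andP; split; apply/eqP.
    by move: p2 h; lra.
  by ring.
have ex : 2 * p * (x / (2 * p)) = x by field.
have ey : 2 * p * (y / (2 * p)) = y by field.
move: ex ey h; set X := x / _; set Y := y / _ => ex ey h.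
case=> [[|[|[|//]]] a2]; rewrite !big_ord_recl !big_ord0 /pauli/= !mxE/=.
- rewrite E0.
  by apply/eqP; rewrite eq_complex/=; apply/andP; split; apply/eqP; move: ex; lra.
- rewrite E1.
  by apply/eqP; rewrite eq_complex/=; apply/andP; split; apply/eqP; move: ey; lra.
- rewrite E2.
  by apply/eqP; rewrite eq_complex/=; apply/andP; split; apply/eqP; move: p2 h; lra.
Qed.

Lemma QMaxCut_ge_sphere (w : 'I_n -> 'I_n -> R) (b : 'I_n -> 'rV[R]_3) :
  wgraph w -> (forall u, dotm (b u) (b u) = 1) -> pvalue w b <= QMaxCut w.
Proof.
move=> wg b1.
have [phi hphi] := choice (fun u => bloch_state (b1 u)).
have phi1 u : \sum_(c < 2) phi u c * ((phi u c)^*)%C = 1 by have [] := hphi u.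
have phiS u a : \sum_(c < 2) (\sum_(d < 2) phi u d * pauli a d c) * ((phi u c)^*)%C = ((b u ord0 a)%:C)%C.
  by have [_] := hphi u.
pose v : 'rV[C]_(#|{: basis n}|) := \row_i prodst phi (enum_val i).
have psiE : psi_of v = prodst phi.
  by apply/ffunP => s; rewrite ffunE mxE enum_rankK.
have := QMaxCut_rayleigh v wg; rewrite energy_psi_of psiE.
have -> : ip (prodst phi) (prodst phi) = 1 by rewrite /ip cip_prodst big1.
rewrite mulr1 => /(le_trans _); apply.
rewrite le_eqVlt; apply/orP; left; apply/eqP; apply: eq_bigr => u _; apply: eq_bigr => u' uu'.
have nuu' : u' != u by apply: contraTneq uu' => ->; rewrite ltnn.
rewrite [in RHS]mulrBr mulr1; congr (_ * (_ - _ * _)).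
rewrite /dotm big_ord1; apply: eq_bigr => a _.
rewrite ip_sym /ip /Sop !op_prodst cip_prodst (bigD1 u)//= (bigD1 u')//= !eqxx (negbTE nuu').
rewrite (eq_sym u u') (negbTE nuu') [\prod_(_ < _ | _) _]big1 => [|x /andP[xu xu']]; last by rewrite (negbTE xu) (negbTE xu').
by rewrite !phiS mulr1 -rmorphM.
Qed.

Lemma pvalue_sym (w : 'I_n -> 'I_n -> R) k (b : 'I_n -> 'rV[R]_k) : wgraph w ->
  pvalue w b = 4^-1 - 8^-1 * \sum_(u < n) \sum_(v < n) w u v * dotm (b u) (b v).
Proof.
move=> [_ ws w0 w1].
have -> : pvalue w b = 4^-1 * (\sum_(u < n) \sum_(v < n | (u < v)%N) w u v) -
    4^-1 * \sum_(u < n) \sum_(v < n | (u < v)%N) w u v * dotm (b u) (b v).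
  rewrite /pvalue -mulrBr -sumrB mulr_sumr; apply: eq_bigr => u _.
  rewrite -sumrB mulr_sumr; apply: eq_bigr => v _; ring.
rewrite w1 (sum_lt_sym (F := fun u v => w u v * dotm (b u) (b v))).
- by field.
- by move=> u v; rewrite ws dotmC.
- by move=> u; rewrite w0 mul0r.
Qed.

(** Without self-loops [pvalue] is affine in each [b u] separately, so the vectors can be moved to
    the sphere one at a time without loss. This lets the rounding use [normalize] pointwise,
    including the samples where it returns 0. *)
Lemma ball_to_sphere (w : 'I_n -> 'I_n -> R) (b : 'I_n -> 'rV[R]_3) :
  wgraph w -> (forall u, in_ball (b u)) ->
  exists b' : 'I_n -> 'rV[R]_3, (forall u, dotm (b' u) (b' u) = 1) /\ pvalue w b <= pvalue w b'.
Proof.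
move=> wg; have [k] := ubnP #|[pred u | dotm (b u) (b u) != 1]|.
elim: k b => // k IH b kb bb.
have [[u bu]|h] := pselect (exists u, dotm (b u) (b u) != 1); last first.
  by exists b; split => // u; apply/eqP/negP => hu; apply: h; exists u; apply/negP.
pose s := \sum_(v < n) w u v *: b v.
(* The minimiser over the ball of the inner product with the weighted sum [s] of the neighbours; any
   unit vector serves if [s = 0]. *)
pose e : 'rV[R]_3 := if s == 0 then delta_mx ord0 ord0 else normalize (- s).
have e1 : dotm e e = 1.
  rewrite /e; case: eqVneq => s0; last by rewrite dotm_normalize// oppr_eq0.
  rewrite /dotm big_ord1 (bigD1 ord0)//= !mxE !eqxx mulr1 big1 ?addr0// => j j0.
  by rewrite !mxE (negbTE j0) andbF mul0r.
have es : dotm e s <= dotm (b u) s.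
  rewrite /e; case: eqVneq => [->|s0]; first by rewrite !dotm0r.
  have -> : dotm (normalize (- s)) s = - enorm s.
    rewrite /normalize dotmZl dotmNl -enorm_sqr.
    have -> : enorm (- s) = enorm s by rewrite /enorm dotmNl dotmNr opprK.
    by field; rewrite enorm_eq0.
  rewrite lerNl -dotmNl (le_trans (dotm_le _ _))// ler_piMl ?enorm_ge0//.
  by rewrite /enorm dotmNl dotmNr opprK; exact: bb.
pose b2 v := if v == u then e else b v.
have b2b v : in_ball (b2 v).
  by rewrite /b2; case: eqP => // _; rewrite /in_ball /enorm e1 sqrtr1.
have k2 : (#|[pred v | (dotm (b2 v) (b2 v) != 1)%R]| < k)%N.
  rewrite -ltnS (leq_trans _ kb)// ltnS; apply: proper_card; apply/properP; split.
    apply/fintype.subsetP => v; rewrite !inE /b2; case: (eqVneq v u) => [->|//]; by rewrite e1 eqxx.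
  by exists u; rewrite !inE// /b2 eqxx e1 eqxx.
have [b' [b'1 b'2]] := IH b2 k2 b2b.
exists b'; split => //; apply: le_trans b'2.
rewrite !pvalue_sym// lerD2l lerN2 ler_pM2l ?invr_gt0//.
have [_ ws w0 _] := wg.
have exp (f : 'I_n -> 'rV[R]_3) : \sum_(x < n) \sum_(y < n) w x y * dotm (f x) (f y) =
   2 * dotm (f u) (\sum_(v < n | v != u) w u v *: f v) + 
   \sum_(x < n | x != u) \sum_(y < n | y != u) w x y * dotm (f x) (f y).
  rewrite (bigD1 u)//= (bigD1 u)//= w0 mul0r add0r.
  have -> : \sum_(x < n | x != u) \sum_(y < n) w x y * dotm (f x) (f y) =
    \sum_(x < n | x != u) w u x * dotm (f u) (f x) +
    \sum_(x < n | x != u) \sum_(y < n | y != u) w x y * dotm (f x) (f y).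
    rewrite -big_split/=; apply: eq_bigr => x xu; rewrite (bigD1 u)//=; congr (_ + _).
    by rewrite ws dotmC.
  have -> : dotm (f u) (\sum_(v < n | v != u) w u v *: f v) = \sum_(v < n | v != u) w u v * dotm (f u) (f v).
    by rewrite dotm_sumr; apply: eq_bigr => v _; rewrite dotmZr.
  by ring.
rewrite !exp; apply: lerD.
  rewrite ler_pM2l// /b2 eqxx.
  have sE : s = \sum_(v < n | v != u) w u v *: b v.
    by rewrite /s (bigD1 u)//= w0 scale0r add0r.
  rewrite (eq_bigr (fun v => w u v *: b v)) -?sE// => v vu; by rewrite (negbTE vu).
rewrite le_eqVlt; apply/orP; left; apply/eqP; apply: eq_bigr => x xu; apply: eq_bigr => y yu.
by rewrite /b2 (negbTE xu) (negbTE yu).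
Qed.

Lemma QMaxCut_ge_ball (w : 'I_n -> 'I_n -> R) (b : 'I_n -> 'rV[R]_3) :
  wgraph w -> (forall u, in_ball (b u)) -> pvalue w b <= QMaxCut w.
Proof.
move=> wg bb; have [b' [b'1 h]] := ball_to_sphere wg bb.
exact: le_trans h (QMaxCut_ge_sphere wg b'1).
Qed.

End product_states.

(** * The function F*(3, rho) and Gaussian rounding *)

Section Fstar.
Context {R : realType}.

Let trB p q (X Y : 'M[R]_(p, q)) : (X - Y)^T = X^T - Y^T.
Proof. exact: linearB. Qed.

Let trZ p q (k : R) (X : 'M[R]_(p, q)) : (k *: X)^T = k *: X^T.
Proof. exact: linearZ. Qed.

Definition ndot p q (a b : 'M[R]_(p, q)) : R := dotm (normalize a) (normalize b).

(** Writing the inverse norms as powers reduces the measurability of [ndot] to that of [powR]. *)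
Lemma ndotE p q (a b : 'M[R]_(p, q)) :
  ndot a b = dotm a a `^ (- 2^-1) * (dotm b b `^ (- 2^-1) * dotm a b).
Proof.
rewrite /ndot /normalize dotmZl dotmZr; congr (_ * (_ * _));
by rewrite powRN powR12_sqrt// dotm_ge0.
Qed.

Lemma dotm_tr p q (a b : 'M[R]_(p, q)) : dotm a^T b^T = dotm a b.
Proof.
rewrite /dotm exchange_big/=; apply: eq_bigr => i _; apply: eq_bigr => j _.
by rewrite !mxE.
Qed.

Lemma ndot_tr p q (a b : 'M[R]_(p, q)) : ndot a^T b^T = ndot a b.
Proof. by rewrite !ndotE !dotm_tr. Qed.

Lemma normalizeN p q (a : 'M[R]_(p, q)) : normalize (- a) = - normalize a.
Proof. by rewrite /normalize /enorm dotmNl dotmNr opprK scalerN. Qed.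

Lemma ndotNr p q (a b : 'M[R]_(p, q)) : ndot a (- b) = - ndot a b.
Proof. by rewrite /ndot normalizeN dotmNr. Qed.

Lemma measurable_dotm_rV d (T : measurableType d) n (f g : T -> 'rV[R]_n) :
  measurable_fun setT f -> measurable_fun setT g -> measurable_fun setT (fun x => dotm (f x) (g x)).
Proof.
move=> mf mg; under eq_fun do rewrite /dotm big_ord1.
apply: measurable_sum => i; apply: measurable_funM.
  exact: (measurableT_comp (@measurable_coor R n i) mf).
exact: (measurableT_comp (@measurable_coor R n i) mg).
Qed.

Lemma measurable_ndot d (T : measurableType d) n (f g : T -> 'rV[R]_n) :
  measurable_fun setT f -> measurable_fun setT g -> measurable_fun setT (fun x => ndot (f x) (g x)).
Proof.
move=> mf mg; under eq_fun do rewrite ndotE.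
apply: measurable_funM; first exact: (measurableT_comp (measurable_powR _) (measurable_dotm_rV mf mf)).
apply: measurable_funM; first exact: (measurableT_comp (measurable_powR _) (measurable_dotm_rV mg mg)).
exact: measurable_dotm_rV.
Qed.

Lemma normr_ndot_le1 p q (a b : 'M[R]_(p, q)) : `|ndot a b| <= 1.
Proof. exact: normr_dotm_normalize. Qed.

Lemma integrable_ndot n m (A B : 'M[R]_(n, m)) :
  (gaussP n).-integrable setT (fun x => (ndot (x *m A) (x *m B))%:E).
Proof.
apply: (@bounded_integrable_probability _ _ _ (gaussP n) (fun x => ndot (x *m A) (x *m B)) 1).
  by apply: measurable_ndot; exact: measurable_mulmx.
by move=> x; exact: normr_ndot_le1.
Qed.

Local Notation s_ rho := (Num.sqrt (1 - rho ^+ 2)).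

(** The reference pair, on [R^6]: two standard Gaussian vectors of [R^3] with correlation [rho]. *)
Definition Fcan (rho : R) : R :=
  \int[gaussP (3 + 3)]_w ndot (w *m col_mx 1%:M 0) (w *m col_mx (rho%:M) ((s_ rho)%:M)).

(** [A] and the rescaled remainder [B - rho *: A] together form an isometry, which carries the pair
    to the reference one. If [rho ^+ 2 = 1] the remainder vanishes, and [A] alone is the
    isometry. *)
Lemma pair_law n (rho : R) (A B : 'M[R]_(n, 3)) : -1 <= rho <= 1 ->
  A^T *m A = 1%:M -> B^T *m B = 1%:M -> A^T *m B = rho%:M ->
  \int[gaussP n]_x ndot (x *m A) (x *m B) = Fcan rho.
Proof.
move=> rho1 AA BB AB.
have BA : B^T *m A = rho%:M by rewrite -[LHS]trmxK trmx_mul trmxK AB tr_scalar_mx.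
have rho2 : 0 <= 1 - rho ^+ 2.
  by rewrite subr_ge0 -[leRHS](expr1n _ 2) -(normr1 R) -real_normK ?num_real//;
    case/andP: rho1 => *; rewrite lerXn2r ?nnegrE// ler_norml normr1; apply/andP.
have s2 : s_ rho ^+ 2 = 1 - rho ^+ 2 by rewrite sqr_sqrtr.
have m6 (C D : 'M[R]_(3 + 3, 3)) : measurable_fun setT (fun w => ndot (w *m C) (w *m D)).
  by apply: measurable_ndot; exact: measurable_mulmx.
have XX : (B - rho *: A)^T *m (B - rho *: A) = (1 - rho ^+ 2)%:M.
  rewrite trB trZ mulmxBl !mulmxBr -!scalemxAl -!scalemxAr AA BB AB BA.
  by rewrite !scale_scalar_mx mulr1 subrr subr0 -raddfB/= expr2.
have [s0|s0] := eqVneq (s_ rho) 0.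
  have BE : B = rho *: A.
    apply/eqP; rewrite -subr_eq0; apply/eqP/matrixP => i j.
    move: XX; rewrite -s2 s0 expr0n raddf0/=.
    move=> /matrixP/(_ j j); rewrite !mxE => /eqP.
    rewrite psumr_eq0 => [/allP/(_ i)|k _]; last by rewrite mxE -expr2 sqr_ge0.
    by rewrite mem_index_enum => /(_ isT)/=; rewrite mxE mulf_eq0 orbb !mxE => /eqP.
  pose g (y : 'rV[R]_3) := ndot y (rho *: y).
  have mg : measurable_fun setT g.
    rewrite /g; under eq_fun do rewrite -[X in ndot X _]mulmx1 -mul_mx_scalar.
    by apply: measurable_ndot; exact: measurable_mulmx.
  transitivity (\int[gaussP n]_x g (x *m A)).
    by apply: eq_Rintegral => x _; rewrite /g BE -scalemxAr.
  rewrite Rintegral_gauss_isometry//.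
  rewrite -(Rintegral_gauss_isometry (T := col_mx 1%:M 0 : 'M[R]_(3 + 3, 3)) _ mg); last first.
    by rewrite tr_col_mx mul_row_col trmx1 trmx0 mulmx1 mulmx0 addr0.
  apply: eq_Rintegral => w _; rewrite /g s0 raddf0; congr ndot.
  by rewrite scalemxAr scale_col_mx scaler0 scalemx1.
pose T : 'M[R]_(n, 3 + 3) := row_mx A ((s_ rho)^-1 *: (B - rho *: A)).
have TT : T^T *m T = 1%:M.
  have h : A^T *m ((s_ rho)^-1 *: (B - rho *: A)) = 0.
    by rewrite -scalemxAr mulmxBr -scalemxAr AA AB scalemx1 subrr scaler0.
  rewrite /T tr_row_mx mul_col_row AA h.
  have -> : ((s_ rho)^-1 *: (B - rho *: A))^T *m A = 0.
    by rewrite -[LHS]trmxK trmx_mul trmxK h trmx0.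
  rewrite trZ -scalemxAl -scalemxAr XX !scale_scalar_mx.
  have -> : (s_ rho)^-1 * ((s_ rho)^-1 * (1 - rho ^+ 2)) = 1.
    by set s := s_ rho in s0 s2 *; rewrite -s2; field.
  by rewrite -scalar_mx_block.
rewrite /Fcan -(Rintegral_gauss_isometry TT (m6 _ _)).
apply: eq_Rintegral => x _; congr ndot.
  by rewrite -mulmxA /T mul_row_col mulmx1 mulmx0 addr0.
rewrite -mulmxA /T mul_row_col !mul_mx_scalar scalerA divff// scale1r addrC subrK//.
Qed.

(** The matrix of the linear map [w |-> (Z u)^T], where [w] lists the entries of [Z]. Its Gram
    matrices are scalar, as [pair_law] requires. *)
Definition coding m (u : 'cV[R]_m) : 'M[R]_(3 * m, 3) :=
  \matrix_(k, i) (vec_mx (delta_mx ord0 k) *m u) i ord0.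

Lemma mul_coding m (u : 'cV[R]_m) (w : 'rV[R]_(3 * m)) : w *m coding u = (vec_mx w *m u)^T.
Proof.
apply/rowP => i; rewrite !mxE.
rewrite (reindex (uncurry (@mxvec_index 3 m)))/=; last exact: curry_mxvec_bij.
transitivity (\sum_(p : 'I_3 * 'I_m) w ord0 (mxvec_index p.1 p.2) * (delta_mx p.1 p.2 *m u) i ord0).
  by apply: eq_bigr => -[j k] _ /=; rewrite [in LHS]mxE vec_mx_delta.
rewrite -(pair_bigA _ (fun j k => w ord0 (mxvec_index j k) * (delta_mx j k *m u) i ord0))/=.
rewrite (bigD1 i)//= [X in _ + X]big1 ?addr0.
  apply: eq_bigr => k _; rewrite !mxE (bigD1 k)//= big1 ?addr0.
    by rewrite mxE !eqxx mul1r.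
  by move=> l lk; rewrite mxE (negbTE lk) andbF mul0r.
move=> j ji; rewrite big1// => k _; rewrite mxE big1 ?mulr0// => l _.
by rewrite mxE eq_sym (negbTE ji) mul0r.
Qed.

Lemma coding_gram m (u v : 'cV[R]_m) : (coding u)^T *m coding v = (dotm u v)%:M.
Proof.
apply/matrixP => i j.
have -> : ((coding u)^T *m coding v) i j = (row i (coding u)^T *m coding v) ord0 j.
  by rewrite -row_mul [RHS]mxE.
rewrite mul_coding !mxE.
under eq_bigr => k _ do rewrite !mxE.
under eq_bigr => k _ do under eq_bigr => l _ do rewrite vec_mx_delta.
have [->|ij] := eqVneq i j.
  rewrite mulr1n /dotm; apply: eq_bigr => k _; rewrite big_ord1; congr (_ * _).
  rewrite (bigD1 k)//= big1 ?addr0; first by rewrite mxE !eqxx mul1r.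
  by move=> l lk; rewrite mxE (negbTE lk) andbF mul0r.
rewrite mulr0n big1// => k _; rewrite big1 ?mul0r// => l _.
by rewrite mxE (negbTE ij) mul0r.
Qed.

Lemma Fstar3_can (rho : R) : -1 <= rho <= 1 -> Fstar3 rho = Fcan rho.
Proof.
move=> rho1.
have rho2 : 0 <= 1 - rho ^+ 2 by case/andP: rho1 => *; nra.
rewrite -(pair_law (A := coding (ustar R)) (B := coding (vstar rho)))//; first last.
- rewrite coding_gram /dotm; congr scalar_mx.
  by rewrite !big_ord_recl !big_ord0 !mxE/= mul1r mul0r !addr0.
- rewrite coding_gram /dotm; congr scalar_mx.
  by rewrite !big_ord_recl !big_ord0 !mxE/= !addr0 -!expr2 sqr_sqrtr// addrC subrK.
- rewrite coding_gram /dotm; congr scalar_mx.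
  by rewrite !big_ord_recl !big_ord0 !mxE/= mul1r mul0r !addr0.
rewrite /Fstar3 (@gaussE_integral _ _ _ 1).
- by apply: eq_Rintegral => w _; rewrite !mul_coding ndot_tr.
- have -> : (fun w : 'rV[R]_(3 * 2) => let Z := vec_mx w in dotm (normalize (Z *m ustar R)) (normalize (Z *m vstar rho))) =
      (fun w : 'rV[R]_(3 * 2) => ndot (w *m coding (ustar R)) (w *m coding (vstar rho))).
    by apply/funext => w; rewrite !mul_coding ndot_tr.
  by apply: measurable_ndot; exact: measurable_mulmx.
- by move=> w; exact: normr_ndot_le1.
Qed.

Lemma Stab_fopt3 n (rho : R) : (3 <= n)%N -> -1 <= rho <= 1 ->
  Stab rho (@fopt3 R n) = Fstar3 rho.
Proof.
move=> n3 rho1; rewrite Fstar3_can//.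
have rho2 : 0 <= 1 - rho ^+ 2 by case/andP: rho1 => *; nra.
pose P : 'M[R]_(n, 3) := \matrix_(k, i) (val k == val i)%:R.
have PP : P^T *m P = 1%:M.
  apply/matrixP => i j; rewrite !mxE.
  have ilt : (i < n)%N by exact: leq_trans (ltn_ord i) n3.
  rewrite (bigD1 (Ordinal ilt))//= big1 ?addr0; first by rewrite !mxE/= eqxx mul1r.
  by move=> k; rewrite -val_eqE/= => ki; rewrite !mxE (negbTE ki) mul0r.
have proj (x : 'rV[R]_n) : proj3 x = x *m P.
  apply/rowP => i; rewrite !mxE.
  have ilt : (i < n)%N by exact: leq_trans (ltn_ord i) n3.
  rewrite insubT (bigD1 (Ordinal ilt))//= big1 ?addr0; first by rewrite !mxE/= eqxx mulr1.
  by move=> k; rewrite -val_eqE/= => ki; rewrite !mxE (negbTE ki) mulr0.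
rewrite -(pair_law (A := col_mx P 0 : 'M[R]_(n + n, 3)) (B := col_mx (rho *: P) ((s_ rho) *: P)))//; first last.
- by rewrite tr_col_mx mul_row_col trmx0 mul0mx addr0 -scalemxAr PP scalemx1.
- rewrite tr_col_mx mul_row_col !trZ -!scalemxAl -!scalemxAr PP !scalerA -scalerDl.
  by rewrite -!expr2 sqr_sqrtr// addrC subrK scale1r.
- by rewrite tr_col_mx mul_row_col trmx0 mul0mx addr0.
have E (w : 'rV[R]_(n + n)) : dotm (fopt3 (lsubmx w)) (fopt3 (rho *: lsubmx w + s_ rho *: rsubmx w)) =
    ndot (w *m col_mx P 0) (w *m col_mx (rho *: P) ((s_ rho) *: P)).
  rewrite /fopt3 !proj -[w in RHS]hsubmxK !mul_row_col mulmx0 addr0 -!scalemxAr.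
  by rewrite /ndot mulmxDl -!scalemxAl.
rewrite /Stab (@gaussE_integral _ _ _ 1).
- by apply: eq_Rintegral => w _; rewrite E.
- rewrite (_ : (fun _ => _) = fun w => ndot (w *m col_mx P 0) (w *m col_mx (rho *: P) ((s_ rho) *: P))).
    by apply: measurable_ndot; exact: measurable_mulmx.
  by apply/funext => w; rewrite E.
- by move=> w; rewrite E; exact: normr_ndot_le1.
Qed.

(** * An upper bound on [F*(3, rho)] for small nonnegative [rho] *)

Lemma enormZ p q (k : R) (a : 'M[R]_(p, q)) : enorm (k *: a) = `|k| * enorm a.
Proof. by rewrite /enorm dotmZl dotmZr mulrA -expr2 sqrtrM ?sqr_ge0// sqrtr_sqr. Qed.

Lemma enormD p q (a b : 'M[R]_(p, q)) : enorm (a + b) <= enorm a + enorm b.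
Proof.
rewrite -(@ler_pXn2r _ 2)// ?nnegrE ?addr_ge0 ?enorm_ge0//.
rewrite sqrrD !enorm_sqr dotmDl !dotmDr (dotmC b a).
by have := dotm_le a b; lra.
Qed.

(* The constant 2 (instead of 4 in a general normed space) is special to inner product norms. *)
Lemma dunkl_williams p q (u v : 'M[R]_(p, q)) :
  (enorm u + enorm v) * enorm (normalize u - normalize v) <= 2 * enorm (u - v).
Proof.
rewrite -(@ler_pXn2r _ 2)// ?nnegrE ?mulr_ge0 ?addr_ge0 ?enorm_ge0//.
rewrite !exprMn !enorm_sqr.
have [->|u0] := eqVneq u 0.
  rewrite normalize0 !sub0r !dotmNl !dotmNr !opprK /enorm dotm0l sqrtr0 add0r -/(enorm v).
  rewrite enorm_sqr; have [->|v0] := eqVneq v 0; first by rewrite !dotm0l mul0r mulr0.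
  by rewrite dotm_normalize// mulr1; have := dotm_ge0 v; lra.
have [->|v0] := eqVneq v 0.
  rewrite normalize0 !subr0 /enorm dotm0l sqrtr0 addr0 -/(enorm u).
  by rewrite enorm_sqr dotm_normalize// mulr1; have := dotm_ge0 u; lra.
have up : 0 < enorm u by rewrite lt_neqAle eq_sym enorm_eq0 u0 enorm_ge0.
have vp : 0 < enorm v by rewrite lt_neqAle eq_sym enorm_eq0 v0 enorm_ge0.
rewrite !dotmDl !dotmDr !dotmNl !dotmNr !dotm_normalize// (dotmC (normalize v)) (dotmC v u).
have -> : dotm (normalize u) (normalize v) = dotm u v / (enorm u * enorm v).
  by rewrite /normalize dotmZl dotmZr; field; rewrite !gt_eqF.
rewrite -!enorm_sqr -subr_ge0.
have d1 : -1 <= dotm u v / (enorm u * enorm v).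
  rewrite ler_pdivlMr ?mulr_gt0// mulN1r.
  by have := normr_dotm_le u v; rewrite ler_norml => /andP[].
have -> : 2 ^+ 2 * (enorm u ^+ 2 - dotm u v + (- dotm u v - - enorm v ^+ 2)) -
    (enorm u + enorm v) ^+ 2 * (1 - dotm u v / (enorm u * enorm v) + (- (dotm u v / (enorm u * enorm v)) - -1)) =
    2 * (1 + dotm u v / (enorm u * enorm v)) * (enorm u - enorm v) ^+ 2.
  by field; rewrite !gt_eqF.
by apply: mulr_ge0; [apply: mulr_ge0 => //; lra|exact: sqr_ge0].
Qed.

(** With [u = s z + r x] and [v = s z - r x], the left-hand side is the inner product of
    [normalize x] with [normalize u - normalize v]. The Dunkl-Williams inequality applies, as
    [u - v = 2 r x] and the norms of [u] and [v] add up to at least [2 s] times that of [z]. *)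
Lemma ndot_pair_le p q (x z : 'M[R]_(p, q)) (r s : R) : 0 <= r -> 0 < s -> enorm x <= enorm z ->
  ndot x (r *: x + s *: z) + ndot x (r *: x - s *: z) <= 2 * (r / s).
Proof.
move=> r0 s0 xz.
have rs0 : 0 <= r / s by rewrite divr_ge0// ltW.
have [z0|z0] := eqVneq z 0.
  have -> : x = 0 by apply/eqP; rewrite -enorm_eq0 eq_le enorm_ge0 andbT (le_trans xz)// z0 /enorm dotm0l sqrtr0.
  by rewrite /ndot normalize0 !dotm0l; lra.
have zp : 0 < enorm z by rewrite lt_neqAle eq_sym enorm_eq0 z0 enorm_ge0.
pose u := s *: z + r *: x; pose v := s *: z - r *: x.
have -> : r *: x + s *: z = u by rewrite /u addrC.
have -> : r *: x - s *: z = - v by rewrite /v opprB.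
rewrite ndotNr -dotmNr -dotmDr.
have h1 : dotm (normalize x) (normalize u - normalize v) <= enorm (normalize u - normalize v).
  apply: le_trans (dotm_le _ _) _; rewrite ler_piMl ?enorm_ge0//; exact: enorm_normalize_le.
apply: le_trans h1 _.
have h2 : 2 * s * enorm z <= enorm u + enorm v.
  apply: le_trans (enormD u v).
  have -> : u + v = (2 * s) *: z by rewrite /u /v addrACA subrr addr0 -scalerDl; congr (_ *: _); ring.
  by rewrite enormZ ger0_norm// mulr_ge0// ltW.
have h3 : enorm (u - v) = 2 * r * enorm x.
  have -> : u - v = (2 * r) *: x.
    by rewrite /u /v opprB addrC addrA subrK -scalerDl; congr (_ *: _); ring.
  by rewrite enormZ ger0_norm ?mulr_ge0.
have h4 := dunkl_williams u v; rewrite h3 in h4.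
have sz : 0 < 2 * s * enorm z by rewrite !mulr_gt0.
rewrite -(ler_pM2l sz); apply: (@le_trans _ _ ((enorm u + enorm v) * enorm (normalize u - normalize v))).
  by rewrite ler_wpM2r ?enorm_ge0.
apply: le_trans h4 _.
have -> : 2 * s * enorm z * (2 * (r / s)) = 2 * (2 * r * enorm z) by field; rewrite gt_eqF.
by rewrite ler_pM2l// ler_wpM2l// mulr_ge0.
Qed.

(** The pair centred at the shorter of the two vectors obeys the good bound, and the other pair is
    at most 2. *)
Lemma ndot_four_le p q (x z : 'M[R]_(p, q)) (r s : R) : 0 <= r -> 0 < s ->
  ndot x (r *: x + s *: z) + ndot x (r *: x - s *: z) +
  (ndot z (r *: z + s *: x) + ndot z (r *: z - s *: x)) <= 2 + 2 * (r / s).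
Proof.
move=> r0 s0.
have triv (a b : 'M[R]_(p, q)) : ndot a b <= 1.
  by have := normr_ndot_le1 a b; rewrite ler_norml => /andP[].
have [xz|/ltW zx] := leP (enorm x) (enorm z).
  have := ndot_pair_le r0 s0 xz.
  have := triv z (r *: z + s *: x); have := triv z (r *: z - s *: x); lra.
have := ndot_pair_le r0 s0 zx.
have := triv x (r *: x + s *: z); have := triv x (r *: x - s *: z); lra.
Qed.

Lemma gram_col_scalar (a b c d : R) :
  (col_mx a%:M b%:M : 'M[R]_(3 + 3, 3))^T *m (col_mx c%:M d%:M : 'M[R]_(3 + 3, 3)) = (a * c + b * d)%:M.
Proof. by rewrite tr_col_mx mul_row_col !tr_scalar_mx -!scalar_mxM -raddfD. Qed.

Lemma Rintegral_probability_cst d (T : measurableType d) (P : probability T R) (k : R) :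
  \int[P]_x k = k.
Proof. by rewrite (Rintegral_cst P measurableT)//= probability_setT mulr1. Qed.

Lemma Rintegral_le_cst d (T : measurableType d) (P : probability T R) (g : T -> R) (k : R) :
  P.-integrable setT (EFin \o g) -> (forall x, g x <= k) -> \int[P]_x g x <= k.
Proof.
move=> ig gk; rewrite -[leRHS](Rintegral_probability_cst P k); apply: le_Rintegral => //.
by apply: (@bounded_integrable_probability _ _ _ P (cst k) `|k|).
Qed.

(** All four pairs in [ndot_four_le] have correlation [rho], so averaging gives
    [4 F <= 2 + 2 rho / s], and the crude bound [s >= 1/3] finishes. The right-hand side is chosen
    to make the ratio exactly 1/2. *)
Lemma Fstar3_le (rho : R) : 0 <= rho -> rho < 3^-1 -> Fstar3 rho <= 2^-1 + 3 / 2 * rho.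
Proof.
move=> r0 r3.
have rho1 : -1 <= rho <= 1 by apply/andP; split; lra.
have rho2 : 0 <= 1 - rho ^+ 2 by case/andP: rho1 => *; nra.
have s2 : s_ rho ^+ 2 = 1 - rho ^+ 2 by rewrite sqr_sqrtr.
set s := s_ rho in s2 *.
have s3 : 3^-1 <= s.
  by rewrite -(@ler_pXn2r _ 2)// ?nnegrE ?sqrtr_ge0 ?invr_ge0// s2; nra.
have s0 : 0 < s by lra.
have rs3 : rho / s <= 3 * rho by rewrite ler_pdivrMr//; nra.
rewrite Fstar3_can//.
pose E a b c d (w : 'rV[R]_(3 + 3)) : R := ndot (w *m col_mx a%:M b%:M) (w *m col_mx c%:M d%:M).
have EE a b c d w : E a b c d w = ndot (a *: lsubmx w + b *: rsubmx w) (c *: lsubmx w + d *: rsubmx w).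
  by rewrite /E -[w in LHS]hsubmxK !mul_row_col !mul_mx_scalar.
have ee a b c d : a * a + b * b = 1 -> c * c + d * d = 1 -> a * c + b * d = rho ->
    \int[gaussP (3 + 3)]_w E a b c d w = Fcan rho.
  by move=> h1 h2 h3; apply: pair_law => //; rewrite gram_col_scalar ?h1 ?h2 ?h3.
have ii a b c d : (gaussP (3 + 3)).-integrable setT (EFin \o E a b c d) by exact: integrable_ndot.
have ii2 a b c d a' b' c' d' : (gaussP (3 + 3)).-integrable setT (EFin \o (fun w => E a b c d w + E a' b' c' d' w)).
  exact: (integrableD measurableT (ii _ _ _ _) (ii _ _ _ _)).
pose g w := E 1 0 rho s w + E 1 0 rho (- s) w + (E 0 1 s rho w + E 0 1 (- s) rho w).
have ig : (gaussP (3 + 3)).-integrable setT (EFin \o g).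
  exact: (integrableD measurableT (ii2 _ _ _ _ _ _ _ _) (ii2 _ _ _ _ _ _ _ _)).
have tot : \int[gaussP (3 + 3)]_w g w = 4 * Fcan rho.
  rewrite (RintegralD measurableT (ii2 _ _ _ _ _ _ _ _) (ii2 _ _ _ _ _ _ _ _)).
  rewrite !(RintegralD measurableT (ii _ _ _ _) (ii _ _ _ _)).
  have rs : rho * rho + s * s = 1 by rewrite -!expr2 s2; ring.
  by rewrite !ee ?mulrNN ?mul1r ?mul0r ?mulr0 ?mulr1 ?addr0 ?add0r// ?(addrC (s * s))//; ring.
suff : 4 * Fcan rho <= 2 + 2 * (rho / s) by lra.
rewrite -tot; apply: Rintegral_le_cst => // w; rewrite /g !EE !scale1r !scale0r !addr0 !add0r !scaleNr.
rewrite (addrC (s *: _)) (addrC (- (s *: _)) (rho *: _)).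
exact: ndot_four_le.
Qed.

Lemma Fstar3_norm_le1 (rho : R) : -1 <= rho <= 1 -> `|Fstar3 rho| <= 1.
Proof.
move=> rho1; rewrite Fstar3_can// /Fcan.
apply: le_trans (le_normr_Rintegral measurableT (integrable_ndot _ _)) _.
apply: Rintegral_le_cst; last by move=> x; exact: normr_ndot_le1.
by have := integrable_abse (integrable_ndot (col_mx 1%:M 0 : 'M[R]_(3 + 3, 3)) (col_mx rho%:M (s_ rho)%:M)).
Qed.

Lemma Rintegral_sum d (T : measurableType d) (P : probability T R) (I : Type) (r : seq I) (Q : pred I) (F : I -> T -> R) :
  (forall i, Q i -> P.-integrable setT (EFin \o F i)) ->
  \int[P]_x (\sum_(i <- r | Q i) F i x) = \sum_(i <- r | Q i) \int[P]_x F i x.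
Proof.
move=> iF.
suff : P.-integrable setT (EFin \o (fun x => \sum_(i <- r | Q i) F i x)) /\
   \int[P]_x (\sum_(i <- r | Q i) F i x) = \sum_(i <- r | Q i) \int[P]_x F i x by case.
elim: r => [|i r [IH1 IH2]].
  split; last by rewrite big_nil -[RHS](Rintegral_probability_cst P 0); apply: eq_Rintegral => x _; rewrite big_nil.
  rewrite (_ : (fun x => _) = cst 0); last by apply/funext => x; rewrite big_nil.
  by apply: (@bounded_integrable_probability _ _ _ P _ 0) => // x; rewrite normr0.
have E : (fun x => \sum_(j <- i :: r | Q j) F j x) =
    (fun x => (if Q i then F i x else 0) + \sum_(j <- r | Q j) F j x).
  by apply/funext => x; rewrite big_cons; case: ifP => // _; rewrite add0r.
have iFi : P.-integrable setT (EFin \o (fun x => if Q i then F i x else 0)).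
  case Qi : (Q i); first exact: iF.
  by apply: (@bounded_integrable_probability _ _ _ P _ 0) => // x; rewrite normr0.
rewrite E; split; first exact: (integrableD measurableT iFi IH1).
rewrite (RintegralD measurableT iFi IH1) IH2 big_cons; case: ifP => // _.
by rewrite Rintegral_probability_cst add0r.
Qed.

Lemma integrable_Rsum d (T : measurableType d) (P : probability T R) (I : Type) (r : seq I) (Q : pred I) (F : I -> T -> R) :
  (forall i, Q i -> P.-integrable setT (EFin \o F i)) ->
  P.-integrable setT (EFin \o (fun x => \sum_(i <- r | Q i) F i x)).
Proof.
move=> iF; rewrite (_ : EFin \o _ = fun x => \sum_(i <- r | Q i) (EFin \o F i) x)%E.
  exact: integrable_sum.
by apply/funext => x /=; rewrite sumEFin.
Qed.

Lemma rounding n (w : 'I_n -> 'I_n -> R) (f : 'I_n -> 'rV[R]_n) : wgraph w ->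
  (forall u, dotm (f u) (f u) = 1) ->
  \sum_(u < n) \sum_(v < n | (u < v)%N) w u v * (4^-1 - 4^-1 * Fstar3 (dotm (f u) (f v))) <= QMaxCut w.
Proof.
move=> wg f1.
pose A u := coding (f u)^T.
have fuv u v : -1 <= dotm (f u) (f v) <= 1.
  by rewrite -ler_norml (le_trans (normr_dotm_le _ _))// /enorm !f1 sqrtr1 mulr1.
have Fe u v : Fstar3 (dotm (f u) (f v)) = \int[gaussP (3 * n)]_x ndot (x *m A u) (x *m A v).
  by rewrite Fstar3_can// (pair_law (rho := dotm (f u) (f v)))// coding_gram dotm_tr ?f1.
have i1 u v : (gaussP (3 * n)).-integrable setT (EFin \o (fun x => w u v * (4^-1 - 4^-1 * ndot (x *m A u) (x *m A v)))).
  apply: (@bounded_integrable_probability _ _ _ _ _ (`|w u v| * (4^-1 + 4^-1))).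
    apply: measurable_funM => //; apply: measurable_funB => //; apply: measurable_funM => //.
    by apply: measurable_ndot; exact: measurable_mulmx.
  move=> x; rewrite normrM ler_wpM2l// (le_trans (ler_normB _ _))//.
  rewrite ger0_norm ?invr_ge0// lerD2l normrM ger0_norm ?invr_ge0// ler_piMr ?invr_ge0//.
  exact: normr_ndot_le1.
have i2 (u : 'I_n) : (gaussP (3 * n)).-integrable setT
    (EFin \o (fun x => \sum_(v < n | (u < v)%N) w u v * (4^-1 - 4^-1 * ndot (x *m A u) (x *m A v)))).
  exact: integrable_Rsum.
have -> : \sum_(u < n) \sum_(v < n | (u < v)%N) w u v * (4^-1 - 4^-1 * Fstar3 (dotm (f u) (f v))) =
    \int[gaussP (3 * n)]_x pvalue w (fun u => normalize (x *m A u)).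
  rewrite /pvalue Rintegral_sum//; apply: eq_bigr => u _; rewrite Rintegral_sum//; apply: eq_bigr => v _.
  have in1 : (gaussP (3 * n)).-integrable setT (EFin \o (fun x => ndot (x *m A u) (x *m A v))) by exact: integrable_ndot.
  have in2 : (gaussP (3 * n)).-integrable setT (EFin \o (fun x => 4^-1 * ndot (x *m A u) (x *m A v)))
    by exact: (integrableZl measurableT _ in1).
  have ic : (gaussP (3 * n)).-integrable setT (EFin \o (fun=> (4^-1 : R))).
    by apply: (@bounded_integrable_probability _ _ _ _ _ `|4^-1|).
  rewrite [RHS](RintegralZl (w u v) measurableT); last exact: (integrableB measurableT ic in2).
  rewrite (RintegralB measurableT ic in2) (RintegralZl _ measurableT in1).
  by rewrite Rintegral_probability_cst Fe.
apply: Rintegral_le_cst; first exact: integrable_Rsum.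
by move=> x; apply: QMaxCut_ge_ball => // u; exact: enorm_normalize_le.
Qed.

End Fstar.

(** * Blow-up of a finite correlated pair *)

Lemma SDP_QMC_ge (R : realType) n (w : 'I_n -> 'I_n -> R) (f : 'I_n -> 'rV[R]_n) :
  wgraph w -> (forall u, dotm (f u) (f u) = 1) ->
  \sum_(u < n) \sum_(v < n | (u < v)%N) w u v * (4^-1 - 3 / 4 * dotm (f u) (f v)) <= SDP_QMC w.
Proof.
move=> [w0 _ _ w1] f1; apply: ub_le_sup; last by exists f.
exists 1 => _ [g /= g1 <-].
apply: (@le_trans _ _ (\sum_(u < n) \sum_(v < n | (u < v)%N) w u v)); last by rewrite w1.
apply: ler_sum => u _; apply: ler_sum => v _; rewrite ler_piMr//.
have := normr_dotm_le (g u) (g v); rewrite /enorm !g1 sqrtr1 mulr1 ler_norml => /andP[? _].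
by lra.
Qed.

(** Here and in [renorm_ge], [A] is a mean over all ordered pairs, [B] its diagonal part and [e] the
    mass of the diagonal. Dividing [A - B] by [1 - e] conditions on having no loop, which shifts the
    bound [a] by at most [x]. *)
Lemma renorm_le (R : realFieldType) (A B a x e : R) :
  A <= a -> 0 <= B -> e <= x -> 0 <= e -> x <= 2^-1 -> a <= 2^-1 -> A - B <= (a + x) * (1 - e).
Proof. by move=> *; nra. Qed.

Lemma renorm_ge (R : realFieldType) (A B a x e : R) :
  a <= A -> B <= 4^-1 * e -> e <= x -> 0 <= e -> x <= 2^-1 -> 0 <= a -> (a - x) * (1 - e) <= A - B.
Proof. by move=> *; nra. Qed.

Lemma enorm_sum (R : realType) k l (I : Type) (s : seq I) (f : I -> 'M[R]_(k, l)) :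
  enorm (\sum_(i <- s) f i) <= \sum_(i <- s) enorm (f i).
Proof.
elim: s => [|i s ih]; first by rewrite !big_nil /enorm dotm0l sqrtr0.
by rewrite !big_cons; apply: le_trans (enormD _ _) _; rewrite lerD2l.
Qed.

Section blowup.
Context {R : realType} {V : finType} {m : nat}.
Variables (p : V -> V -> R) (g : V -> 'rV[R]_m) (F r : R).
Hypothesis p_ge0 : forall a c, 0 <= p a c.
Hypothesis p_sum : \sum_a \sum_c p a c = 1.
Hypothesis F_ge : -1 <= F.
Hypothesis F_le : forall b : V -> 'rV[R]_3, (forall a, in_ball (b a)) ->
  F <= \sum_a \sum_c p a c * dotm (b a) (b c).
Hypothesis g_le : forall a, dotm (g a) (g a) <= 1.
Hypothesis r_le : r <= 3^-1.
Hypothesis g_sum : \sum_a \sum_c p a c * dotm (g a) (g c) <= r.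

Let p_le1 a c : p a c <= 1.
Proof.
rewrite -p_sum (bigD1 a)//= (bigD1 c)//= -addrA lerDl addr_ge0//.
  by apply: sumr_ge0.
by apply: sumr_ge0 => ? _; apply: sumr_ge0.
Qed.

Section copies.
Variable N : nat.
Hypothesis N2 : (2 <= N)%N.

Let Nr2 : 2 <= N%:R :> R. Proof. by rewrite ler_nat. Qed.
Let Nr0 : 0 < N%:R :> R. Proof. by move: Nr2; lra. Qed.

(* The ['I_m] vertices are isolated: they only provide coordinates for the vectors of the SDP solution. *)
Let Qt := (V * 'I_N + 'I_m)%type.
Let n := #|{: Qt}|.

(** The law of an ordered pair of vertices: cells drawn from [p], copies uniform and independent. *)
Let P0 (x y : Qt) : R :=
  match x, y with inl a, inl c => p a.1 c.1 / N%:R ^+ 2 | _, _ => 0 end.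
Let P (u v : 'I_n) : R := P0 (enum_val u) (enum_val v).

Let P_ge0 u v : 0 <= P u v.
Proof.
by rewrite /P /P0; case: (enum_val u) => // a; case: (enum_val v) => // c; rewrite divr_ge0 ?exprn_ge0.
Qed.

Let sum_enum (G : Qt -> R) : \sum_(u < n) G (enum_val u) = \sum_x G x.
Proof. by rewrite [RHS](reindex (@enum_val Qt predT))//; exact/onW_bij/enum_val_bij. Qed.

Let sum_Qt (G : Qt -> R) : \sum_x G x = \sum_a \sum_(i < N) G (inl (a, i)) + \sum_(j < m) G (inr j).
Proof.
by rewrite big_sumType/=; congr (_ + _); rewrite pair_big/=; apply: eq_bigr => -[a i] _.
Qed.

Let sum_P (G : 'I_n -> 'I_n -> R) :
  \sum_(u < n) \sum_(v < n) P u v * G u v =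
  \sum_a \sum_c p a c * (N%:R ^- 2 * \sum_(i < N) \sum_(j < N)
    G (enum_rank (inl (a, i) : Qt)) (enum_rank (inl (c, j) : Qt))).
Proof.
pose G' (x y : Qt) := P0 x y * G (enum_rank x) (enum_rank y).
transitivity (\sum_x \sum_y G' x y).
  rewrite -(sum_enum (fun x => \sum_y G' x y)); apply: eq_bigr => u _.
  rewrite -(sum_enum (fun y => G' (enum_val u) y)); apply: eq_bigr => v _.
  by rewrite /G' !enum_valK.
rewrite sum_Qt [X in _ + X]big1 ?addr0 => [|j _]; last first.
  by rewrite big1// => y _; rewrite /G' mul0r.
apply: eq_bigr => a _.
have E (i : 'I_N) : \sum_y G' (inl (a, i)) y = \sum_c \sum_(j < N) G' (inl (a, i)) (inl (c, j)).
  by rewrite sum_Qt [X in _ + X]big1 ?addr0// => j _; rewrite /G' mul0r.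
rewrite (eq_bigr _ (fun i _ => E i)) exchange_big/=; apply: eq_bigr => c _.
rewrite mulrA mulr_sumr; apply: eq_bigr => i _; rewrite mulr_sumr; apply: eq_bigr => j _.
by rewrite /G'.
Qed.

Let cst_sum (x : R) : N%:R ^- 2 * (\sum_(i < N) \sum_(j < N) x) = x.
Proof.
rewrite !sumr_const !card_ord -mulrnA -[x *+ _]mulr_natl natrM -expr2 mulrA mulVf ?mul1r//.
by rewrite expf_neq0// gt_eqF.
Qed.

Let P_sum : \sum_(u < n) \sum_(v < n) P u v = 1.
Proof.
transitivity (\sum_(u < n) \sum_(v < n) P u v * 1).
  by apply: eq_bigr => u _; apply: eq_bigr => v _; rewrite mulr1.
by rewrite sum_P -[RHS]p_sum; apply: eq_bigr => a _; apply: eq_bigr => c _; rewrite cst_sum mulr1.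
Qed.

Let d := \sum_(u < n) P u u.

Let d_ge0 : 0 <= d. Proof. exact: sumr_ge0. Qed.

Let d_le : d <= N%:R^-1.
Proof.
rewrite /d (sum_enum (fun x => P0 x x)) sum_Qt [X in _ + X]big1// addr0 /=.
under eq_bigr do rewrite sumr_const card_ord.
apply: (@le_trans _ _ (N%:R^-1 * \sum_a \sum_c p a c)); last by rewrite p_sum mulr1.
rewrite mulr_sumr; apply: ler_sum => a _; rewrite (bigD1 a)//= mulrDr.
have -> : p a a / N%:R ^+ 2 *+ N = N%:R^-1 * p a a.
  by rewrite -(mulr_natr _ N); field; rewrite gt_eqF.
by rewrite lerDl; apply: mulr_ge0; [rewrite invr_ge0 ltW|exact: sumr_ge0].
Qed.

Let Ninv_le : N%:R^-1 <= 2^-1 :> R.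
Proof. by rewrite lef_pV2 ?posrE. Qed.

Let d1 : 2^-1 <= 1 - d.
Proof. by move: d_le Ninv_le; lra. Qed.

Let d1N0 : 1 - d != 0. Proof. by rewrite gt_eqF//; move: d1; lra. Qed.

(** An unordered edge collects the mass of both orders, and division by [1 - d] restores total
    weight 1 after the loops, of mass [d <= 1 / N], are dropped. *)
Definition blowup_weight (u v : 'I_n) : R := if u == v then 0 else (P u v + P v u) / (1 - d).
Let w := blowup_weight.

Let sum_w (G : 'I_n -> 'I_n -> R) : (forall u v, G u v = G v u) ->
  \sum_(u < n) \sum_(v < n | (u < v)%N) w u v * G u v =
  (1 - d)^-1 * (\sum_(u < n) \sum_(v < n) P u v * G u v - \sum_(u < n) P u u * G u u).
Proof.
move=> Gs; rewrite (sum_lt_sym (F := fun u v => w u v * G u v)); first last.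
- by move=> u; rewrite /w /blowup_weight eqxx mul0r.
- by move=> u v; rewrite Gs /w /blowup_weight eq_sym (addrC (P u v)).
have -> : \sum_(u < n) \sum_(v < n) w u v * G u v =
   (1 - d)^-1 * (\sum_(u < n) \sum_(v < n) (P u v + P v u) * G u v - 2 * \sum_(u < n) P u u * G u u).
  rewrite mulr_sumr -sumrB mulr_sumr; apply: eq_bigr => u _.
  rewrite (bigD1 u)//= [in RHS](bigD1 u)//= /w /blowup_weight eqxx mul0r add0r.
  have -> : (P u u + P u u) * G u u + \sum_(i < n | i != u) (P u i + P i u) * G u i - 2 * (P u u * G u u) =
     \sum_(i < n | i != u) (P u i + P i u) * G u i by ring.
  rewrite mulr_sumr; apply: eq_bigr => v vu; rewrite eq_sym (negbTE vu).
  by rewrite mulrAC mulrC.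
have -> : \sum_(u < n) \sum_(v < n) (P u v + P v u) * G u v = 2 * \sum_(u < n) \sum_(v < n) P u v * G u v.
  have -> : \sum_(u < n) \sum_(v < n) (P u v + P v u) * G u v =
    \sum_(u < n) \sum_(v < n) P u v * G u v + \sum_(u < n) \sum_(v < n) P v u * G u v.
    by rewrite -big_split; apply: eq_bigr => u _; rewrite -big_split; apply: eq_bigr => v _; rewrite mulrDl.
  have -> : \sum_(u < n) \sum_(v < n) P v u * G u v = \sum_(u < n) \sum_(v < n) P u v * G u v.
    by rewrite exchange_big; apply: eq_bigr => u _; apply: eq_bigr => v _; rewrite Gs.
  by ring.
by field.
Qed.

Let w_graph : wgraph w.
Proof.
split.
- by move=> u v; rewrite /w /blowup_weight; case: ifP => // _; apply: divr_ge0; [exact: addr_ge0|move: d1; lra].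
- by move=> u v; rewrite /w /blowup_weight eq_sym addrC.
- by move=> u; rewrite /w /blowup_weight eqxx.
- transitivity (\sum_(u < n) \sum_(v < n | (u < v)%N) w u v * 1).
    by apply: eq_bigr => u _; apply: eq_bigr => v _; rewrite mulr1.
  rewrite sum_w//.
  under eq_bigr do under eq_bigr do rewrite mulr1.
  by rewrite (eq_bigr _ (fun u _ => mulr1 (P u u))) P_sum -/d mulVf.
Qed.

Let cardQ : n = (#|V| * N + m)%N.
Proof. by rewrite /n card_sum card_prod !card_ord. Qed.

Let V_gt0 : (0 < #|V|)%N.
Proof.
rewrite lt0n; apply/eqP => /card0_eq V0; move: p_sum; rewrite big1 => [/eqP|a _].
  by rewrite eq_sym oner_eq0.
by have := V0 a; rewrite inE.
Qed.

Let n_ge : (N <= n)%N.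
Proof. by rewrite cardQ (leq_trans _ (leq_addr _ _))// leq_pmull. Qed.

Let n_gt0 : 0 < n%:R :> R.
Proof. by rewrite ltr0n (leq_trans _ n_ge)// ltnW. Qed.

Let P_le u v : P u v <= N%:R ^- 2.
Proof.
rewrite /P /P0; case: (enum_val u) => [a|_]; last by rewrite invr_ge0 exprn_ge0// ltW.
case: (enum_val v) => [c|_]; last by rewrite invr_ge0 exprn_ge0// ltW.
by rewrite ler_piMl// invr_ge0 exprn_ge0// ltW.
Qed.

(** One factor 2 comes from the two orders, the other from [1 - d >= 1/2], and
    [n = #|V| * N + m <= (#|V| + m) * N]. The constant is independent of [N]: this is the density
    that the mean-field bound asks for. *)
Let w_le u v : w u v <= 4 * (#|V| + m)%:R ^+ 2 / n%:R ^+ 2.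
Proof.
have h : N%:R ^- 2 <= (#|V| + m)%:R ^+ 2 / n%:R ^+ 2 :> R.
  rewrite ler_pdivlMr ?exprn_gt0// mulrC ler_pdivrMr ?exprn_gt0// -exprMn ler_pXn2r ?nnegrE ?mulr_ge0//.
  by rewrite -natrM ler_nat cardQ mulnDl leq_add2l leq_pmulr// ltnW.
apply: (@le_trans _ _ (4 * N%:R ^- 2)); last by rewrite -mulrA ler_pM2l.
rewrite /w /blowup_weight; case: ifP => _.
  by apply: mulr_ge0 => //; rewrite invr_ge0 exprn_ge0// ltW.
have := P_le u v; have := P_le v u; move: d1 (le_trans (P_ge0 u v) (P_le u v)); move: (P u v) (P v u) (N%:R ^- 2) => x y z hd z0 hx hy.
rewrite ler_pdivrMr; last by move: hd; lra.
apply: (@le_trans _ _ (2 * z)); first by move: hx hy; lra.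
by nra.
Qed.

Let product_le (b : 'I_n -> 'rV[R]_3) : (forall u, in_ball (b u)) ->
  \sum_(u < n) \sum_(v < n | (u < v)%N) w u v * (4^-1 - 4^-1 * dotm (b u) (b v)) <=
  4^-1 - 4^-1 * F + N%:R^-1.
Proof.
move=> b1; rewrite (sum_w (G := fun u v => 4^-1 - 4^-1 * dotm (b u) (b v))); last first.
  by move=> u v; rewrite dotmC.
(* By bilinearity, averaging over copies turns the correlations of [b] into those of the cell
   averages [bb], which stay in the ball by convexity. *)
pose bb a := N%:R^-1 *: \sum_(i < N) b (enum_rank (inl (a, i) : Qt)).
have bb1 a : in_ball (bb a).
  rewrite /in_ball enormZ ger0_norm ?invr_ge0 ?ler0n// ler_pdivrMl// mulr1.
  apply: le_trans (enorm_sum _ _) _.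
  apply: (@le_trans _ _ (\sum_(i < N) 1)); first by apply: ler_sum => i _; exact: b1.
  by rewrite sumr_const card_ord.
have h1 : \sum_(u < n) \sum_(v < n) P u v * (4^-1 - 4^-1 * dotm (b u) (b v)) <= 4^-1 - 4^-1 * F.
  have -> : \sum_(u < n) \sum_(v < n) P u v * (4^-1 - 4^-1 * dotm (b u) (b v)) =
     4^-1 * (\sum_(u < n) \sum_(v < n) P u v) - 4^-1 * \sum_(u < n) \sum_(v < n) P u v * dotm (b u) (b v).
    rewrite !mulr_sumr -sumrB; apply: eq_bigr => u _; rewrite !mulr_sumr -sumrB.
    by apply: eq_bigr => v _; ring.
  rewrite P_sum mulr1 lerD2l lerN2 ler_pM2l ?invr_gt0// sum_P; apply: le_trans (F_le bb1) _.
  rewrite le_eqVlt; apply/orP; left; apply/eqP; apply: eq_bigr => a _; apply: eq_bigr => c _; congr (_ * _).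
  rewrite /bb dotmZl dotmZr dotm_suml mulrA -invfM -expr2; congr (_ * _); apply: eq_bigr => i _.
  by rewrite dotm_sumr.
have h2 : 0 <= \sum_(u < n) P u u * (4^-1 - 4^-1 * dotm (b u) (b u)).
  apply: sumr_ge0 => u _; apply: mulr_ge0 => //; have := b1 u; rewrite /in_ball => h.
  have : enorm (b u) ^+ 2 <= 1 by rewrite exprn_ile1// enorm_ge0.
  by rewrite enorm_sqr; lra.
rewrite mulrC ler_pdivrMr; last by move: d1; lra.
by apply: renorm_le => //; move: F_ge; lra.
Qed.

(** A copy carries [g] of its cell in the [m] common coordinates and, on a private coordinate, the
    length that makes it a unit vector. Distinct copies then have inner product exactly that of
    their [g], even within one cell. *)
Let fv (x z : Qt) : R :=
  match x, z with
  | inl a, inl z => (z == a)%:R * Num.sqrt (1 - dotm (g a.1) (g a.1))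
  | inl a, inr j => g a.1 ord0 j
  | inr i, inr j => (i == j)%:R
  | inr _, inl _ => 0
  end.

Let f (u : 'I_n) : 'rV[R]_n := \row_k fv (enum_val u) (enum_val k).

Let dotm_f u v : dotm (f u) (f v) = \sum_z fv (enum_val u) z * fv (enum_val v) z.
Proof.
rewrite /dotm big_ord1 -(sum_enum (fun z => fv (enum_val u) z * fv (enum_val v) z)).
by apply: eq_bigr => k _; rewrite !mxE.
Qed.

Let dotm_fv a c : \sum_z fv (inl a) z * fv (inl c) z =
  (a == c)%:R * (1 - dotm (g a.1) (g a.1)) + dotm (g a.1) (g c.1).
Proof.
rewrite big_sumType/=; congr (_ + _); last by rewrite /dotm big_ord1.
rewrite (bigD1 a)//= eqxx mul1r big1 ?addr0 => [|z /negbTE->]; last by rewrite !mul0r.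
case: eqP => [->|_]; last by rewrite !mul0r mulr0.
by rewrite !mul1r -expr2 sqr_sqrtr// subr_ge0.
Qed.

Let f_unit u : dotm (f u) (f u) = 1.
Proof.
rewrite dotm_f; case: (enum_val u) => [a|j].
  by rewrite dotm_fv eqxx mul1r subrK.
rewrite big_sumType/= big1 ?add0r => [|z _]; last by rewrite mul0r.
rewrite (bigD1 j)//= eqxx mulr1 big1 ?addr0// => z.
by rewrite eq_sym => /negbTE->; rewrite mul0r.
Qed.

Let K0 (x y : Qt) : R :=
  match x, y with inl a, inl c => dotm (g a.1) (g c.1) | _, _ => 0 end.

Let SDP_ge : 4^-1 - 3 / 4 * r - N%:R^-1 <= SDP_QMC w.
Proof.
apply: le_trans (SDP_QMC_ge w_graph f_unit).
(* [K] omits the private coordinates; it differs from the true inner product only where [w]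
   vanishes. *)
pose K (u v : 'I_n) := K0 (enum_val u) (enum_val v).
have -> : \sum_(u < n) \sum_(v < n | (u < v)%N) w u v * (4^-1 - 3 / 4 * dotm (f u) (f v)) =
          \sum_(u < n) \sum_(v < n | (u < v)%N) w u v * (4^-1 - 3 / 4 * K u v).
  apply: eq_bigr => u _; apply: eq_bigr => v uv; rewrite dotm_f /K /w /blowup_weight /P.
  case: ifPn => [_|uv']; first by rewrite !mul0r.
  have : enum_val u != enum_val v by rewrite (inj_eq enum_val_inj).
  case: (enum_val u) => [a|i]; case: (enum_val v) => [c|j] /=; rewrite ?addr0 ?add0r ?mul0r//.
  rewrite dotm_fv => ac; suff -> : (a == c) = false by rewrite mul0r add0r.
  by apply: contra_neqF ac => /eqP ->.
rewrite (sum_w (G := fun u v => 4^-1 - 3 / 4 * K u v)); last first.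
  by move=> u v; rewrite /K /K0; case: (enum_val u) => [a|i]; case: (enum_val v) => [c|j]//; rewrite dotmC.
have h1 : 4^-1 - 3 / 4 * r <= \sum_(u < n) \sum_(v < n) P u v * (4^-1 - 3 / 4 * K u v).
  have -> : \sum_(u < n) \sum_(v < n) P u v * (4^-1 - 3 / 4 * K u v) =
     4^-1 * (\sum_(u < n) \sum_(v < n) P u v) - 3 / 4 * \sum_(u < n) \sum_(v < n) P u v * K u v.
    rewrite !mulr_sumr -sumrB; apply: eq_bigr => u _; rewrite !mulr_sumr -sumrB.
    by apply: eq_bigr => v _; ring.
  rewrite P_sum mulr1 lerD2l lerN2 ler_pM2l ?divr_gt0// sum_P; apply: le_trans g_sum.
  rewrite le_eqVlt; apply/orP; left; apply/eqP; apply: eq_bigr => a _; apply: eq_bigr => c _; congr (_ * _).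
  rewrite -[RHS]cst_sum; congr (_ * _); apply: eq_bigr => i _; apply: eq_bigr => j _.
  by rewrite /K !enum_rankK.
have h2 : \sum_(u < n) P u u * (4^-1 - 3 / 4 * K u u) <= 4^-1 * d.
  rewrite mulr_sumr; apply: ler_sum => u _; rewrite mulrC ler_wpM2r//.
  have : 0 <= K u u by rewrite /K /K0; case: (enum_val u) => // a; exact: dotm_ge0.
  by lra.
rewrite [leRHS]mulrC ler_pdivlMr; last by move: d1; lra.
by apply: renorm_ge => //; move: r_le; lra.
Qed.

Lemma blowup_copies : exists (k : nat) (wt : 'I_k -> 'I_k -> R),
  [/\ (N <= k)%N, wgraph wt, 4^-1 - 3 / 4 * r - N%:R^-1 <= SDP_QMC wt &
   forall t : R, 0 < t -> 3 / k%:R < t ^+ 2 ->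
     QMaxCut wt <= 4^-1 - 4^-1 * F + N%:R^-1 + 4 * (#|V| + m)%:R ^+ 2 * t +
       6 * (4 * (#|V| + m)%:R ^+ 2) / k%:R / (t ^+ 2 - 3 / k%:R)].
Proof.
exists n, w; split => // t t0 nt.
apply: (QMaxCut_mean_field _ w_graph w_le product_le t0 nt).
by move: n_gt0; rewrite ltr0n.
Qed.

End copies.

Lemma blowup (e : R) : 0 < e -> exists (k : nat) (wt : 'I_k -> 'I_k -> R),
  [/\ wgraph wt, QMaxCut wt <= 4^-1 - 4^-1 * F + e & 4^-1 - 3 / 4 * r - e <= SDP_QMC wt].
Proof.
move=> e0; pose K : R := 4 * (#|V| + m)%:R ^+ 2.
have K0 : 0 <= K by rewrite mulr_ge0// exprn_ge0.
(* [t] makes the mean-field error [K * t] at most [e / 3]; it is fixed before the number of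
   copies. *)
pose t : R := e / 3 / (K + 1).
have t0 : 0 < t by rewrite divr_gt0 ?divr_gt0// ltr_wpDl.
have Kt : K * t <= e / 3.
  rewrite /t mulrCA ger_pMr ?divr_gt0// ler_pdivrMr ?mul1r ?ltr_wpDl// lerDl//.
(* A bound for the inverses of the numbers of copies and of vertices: the second entry gives
   [t ^+ 2 - 3 / k >= t ^+ 2 / 2], and the third then makes the last mean-field term at most
   [e / 3]. *)
pose dl := Num.min (e / 3) (Num.min (t ^+ 2 / 6) (e * t ^+ 2 / 36 / (K + 1))).
have t20 : 0 < t ^+ 2 by rewrite exprn_gt0.
have K1 : 0 < K + 1 by rewrite ltr_wpDl.
have dl0 : 0 < dl by rewrite !lt_min !divr_gt0//= mulr_gt0.
have [N hN] : exists N : nat, dl^-1 < N%:R by exists (Num.bound dl^-1); apply: archi_boundP; rewrite invr_ge0 ltW.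
have N2 : (2 <= maxn 2 N)%N by rewrite leq_maxl.
have [k [wt [Nk wg sdp qmc]]] := blowup_copies N2.
have NR x : (N <= x)%N -> x%:R^-1 <= dl.
  move=> Nx; have x0 : 0 < x%:R :> R.
    by apply: lt_le_trans (_ : N%:R <= _); rewrite ?ler_nat// (lt_trans _ hN)// invr_gt0.
  by rewrite invf_ple ?posrE// (le_trans (ltW hN))// ler_nat.
have le1 : (maxn 2 N)%:R^-1 <= dl by apply: NR; rewrite leq_maxr.
have le2 : k%:R^-1 <= dl by apply: NR; rewrite (leq_trans _ Nk)// leq_maxr.
have dle : dl <= e / 3 by rewrite /dl ge_min lexx.
have dlt : dl <= t ^+ 2 / 6 by rewrite /dl !ge_min lexx orbT.
have dlK : dl <= e * t ^+ 2 / 36 / (K + 1) by rewrite /dl !ge_min lexx !orbT.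
exists k, wt; split => //; last by move: sdp le1 dle; lra.
apply: le_trans (qmc t t0 _) _; first by move: le2 dlt; lra.
rewrite -/K.
suff : 6 * K / k%:R / (t ^+ 2 - 3 / k%:R) <= e / 3 by move: Kt le1 dle; lra.
have kK : k%:R^-1 * (K + 1) <= e * t ^+ 2 / 36 by rewrite -ler_pdivlMr// (le_trans le2).
have k0 : 0 <= k%:R^-1 :> R by rewrite invr_ge0.
rewrite ler_pdivrMr; last by move: le2 dlt; lra.
apply: (@le_trans _ _ (e / 3 * (t ^+ 2 / 2))); last by rewrite ler_pM2l ?divr_gt0//; move: le2 dlt; lra.
by move: kK k0; lra.
Qed.

End blowup.

(** * Concentration of the Gaussian norm *)

Section laplace.
Context {R : realType}.

(** The integrand times the standard density is [s] times the normal density of standard deviation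
    [s]. *)
Lemma laplace_normal (a : R) : 0 <= a ->
  (\int[normal_prob (0 : R) 1]_x (expR (- (a * x ^+ 2)))%:E = ((Num.sqrt (1 + 2 * a))^-1)%:E)%E.
Proof.
move=> a0; have a1 : 0 < 1 + 2 * a by lra.
set s := (Num.sqrt (1 + 2 * a))^-1.
have s0 : 0 < s by rewrite invr_gt0 sqrtr_gt0.
have s2 : s ^+ 2 = (1 + 2 * a)^-1 by rewrite exprVn sqr_sqrtr// ltW.
have pk : s * normal_peak s = normal_peak (1 : R).
  rewrite /normal_peak expr1n mul1r -mulrnAr sqrtrM ?sqr_ge0// sqrtr_sqr gtr0_norm//.
  by rewrite invfM mulrA mulfV ?gt_eqF// mul1r.
rewrite ge0_integral_normal_prob//; last first.
  apply/measurable_EFinP; apply: measurableT_comp => //; apply: measurableT_comp => //.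
  by apply: measurable_funM => //; exact: measurable_funX.
transitivity (\int[@lebesgue_measure R]_x (s%:E * (normal_pdf 0 s x)%:E))%E.
  apply: eq_integral => x _; rewrite -!EFinM normal_pdf01 normal_pdfE ?gt_eqF// /normal_fun subr0.
  congr EFin; rewrite mulrCA -pk -!mulrA; congr (_ * (_ * _)); rewrite -expRD; congr expR.
  by rewrite -mulr_natr s2; field; rewrite gt_eqF.
rewrite ge0_integralZl//.
- by rewrite integral_normal_pdf ?mule1// gt_eqF.
- by apply/measurable_EFinP; exact: measurable_normal_pdf.
- by move=> x _; rewrite lee_fin normal_pdf_ge0.
- by rewrite lee_fin ltW.
Qed.

Lemma dotm_rV_cons k (t : R) (x : 'rV[R]_k) :
  dotm (rV_cons (t, x)) (rV_cons (t, x)) = t ^+ 2 + dotm x x.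
Proof.
rewrite /dotm !big_ord1 (@big_split_ord _ _ _ 1 k)/= big_ord1; congr (_ + _).
  by rewrite /rV_cons (@row_mxEl _ 1 1 k) !mxE eqxx mulr1n -expr2.
by apply: eq_bigr => i _; rewrite /rV_cons (@row_mxEr _ 1 1 k).
Qed.

Lemma measurable_dotm_self n : measurable_fun setT (fun x : 'rV[R]_n => dotm x x).
Proof. exact: measurable_dotm_rV. Qed.

Lemma measurable_expR_dotm n (a : R) :
  measurable_fun setT (fun x : 'rV[R]_n => expR (- (a * dotm x x))).
Proof.
apply: measurableT_comp => //; apply: measurableT_comp => //.
by apply: measurable_funM => //; exact: measurable_dotm_self.
Qed.

Lemma ge0_laplace_gauss n (a : R) : 0 <= a ->
  (\int[gaussP n]_x (expR (- (a * dotm x x)))%:E = ((Num.sqrt (1 + 2 * a))^-1 ^+ n)%:E)%E.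
Proof.
move=> a0; have mE k := @measurable_expR_dotm k a.
elim: n => [|k IH].
  rewrite integral_dirac//; last by apply/measurable_EFinP; exact: mE.
  by rewrite diracT mul1e dotm0l mulr0 oppr0 expR0 expr0.
rewrite ge0_integral_gaussPS_iter//; last by apply/measurable_EFinP; exact: mE.
transitivity (\int[normal_prob (0 : R) 1]_t
    ((((Num.sqrt (1 + 2 * a))^-1) ^+ k)%:E * (expR (- (a * t ^+ 2)))%:E))%E.
  apply: eq_integral => t _.
  under eq_integral do rewrite dotm_rV_cons mulrDr opprD expRD EFinM.
  by rewrite ge0_integralZl ?IH 1?muleC//; apply/measurable_EFinP; exact: mE.
rewrite ge0_integralZl//.
- by rewrite laplace_normal// -EFinM exprSr.
- apply/measurable_EFinP; apply: measurableT_comp => //; apply: measurableT_comp => //.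
  by apply: measurable_funM => //; exact: measurable_funX.
Qed.

Lemma laplace_gauss n (a : R) : 0 <= a ->
  \int[gaussP n]_x expR (- (a * dotm x x)) = (Num.sqrt (1 + 2 * a))^-1 ^+ n.
Proof. by move=> a0; rewrite /Rintegral ge0_laplace_gauss. Qed.

Lemma sqrtr_le_expR (u x : R) : 0 <= u -> u <= expR (2 * x) -> Num.sqrt u <= expR x.
Proof.
move=> u0 h; rewrite -(@ler_pXn2r _ 2) ?nnegrE ?sqrtr_ge0 ?expR_ge0//.
by rewrite sqr_sqrtr// -expRM_natl.
Qed.

(** A bounded measure of how far [dotm x x] is from [n]. *)
Definition norm_gap n (x : 'rV[R]_n) : R := (expR (- (n%:R^-1 * dotm x x)) - expR (- 1)) ^+ 2.

Lemma norm_gap_ge0 n (x : 'rV[R]_n) : 0 <= norm_gap x.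
Proof. exact: sqr_ge0. Qed.

Lemma measurable_norm_gap n : measurable_fun setT (@norm_gap n).
Proof.
apply: (@measurable_funX _ _ _ _ (fun x : 'rV[R]_n => expR (- (n%:R^-1 * dotm x x)) - expR (- 1)) 2).
by apply: measurable_funB => //; exact: measurable_expR_dotm.
Qed.

Lemma expRN_unit (x : R) : 0 <= x -> 0 <= expR (- x) <= 1.
Proof. by move=> x0; rewrite expR_ge0/= -expR0 ler_expR oppr_le0. Qed.

Lemma norm_gap_le1 n (x : 'rV[R]_n) : norm_gap x <= 1.
Proof.
have /andP[h1 h2] : 0 <= expR (- (n%:R^-1 * dotm x x)) <= 1.
  by apply: expRN_unit; rewrite mulr_ge0 ?invr_ge0// dotm_ge0.
have /andP[h3 h4] : 0 <= expR (- 1 : R) <= 1 by exact: expRN_unit.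
rewrite /norm_gap; nra.
Qed.

(* The first two moments of [expR (- |x|^2 / n)] are explicit Laplace transforms, so the concentration of
   [|x|^2] needs no tail estimate. *)
Lemma norm_gap_mean n : (0 < n)%N -> \int[gaussP n]_x norm_gap x <= 8 / n%:R.
Proof.
move=> n0; have N0 : 0 < n%:R :> R by rewrite ltr0n.
have bE (a : R) : 0 <= a -> (gaussP n).-integrable setT (EFin \o (fun x : 'rV[R]_n => expR (- (a * dotm x x)))).
  move=> a0; apply: (@bounded_integrable_probability _ _ _ _ _ 1); first exact: measurable_expR_dotm.
  move=> x; have /andP[h1 h2] : 0 <= expR (- (a * dotm x x)) <= 1.
    by apply: expRN_unit; rewrite mulr_ge0// dotm_ge0.
  by rewrite ger0_norm.
pose E1 (x : 'rV[R]_n) := expR (- (n%:R^-1 * dotm x x)).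
pose E2 (x : 'rV[R]_n) := expR (- (2 / n%:R * dotm x x)).
have i1 : (gaussP n).-integrable setT (EFin \o E1) by apply: bE; rewrite invr_ge0 ltW.
have i2 : (gaussP n).-integrable setT (EFin \o E2) by apply: bE; rewrite divr_ge0// ltW.
have i1' : (gaussP n).-integrable setT (EFin \o (fun x => 2 * expR (- 1) * E1 x)) by exact: (integrableZl measurableT _ i1).
have ic : (gaussP n).-integrable setT (EFin \o (fun=> expR (- 1 : R) ^+ 2)).
  by apply: (@bounded_integrable_probability _ _ _ _ _ `|expR (- 1 : R) ^+ 2|).
have -> : \int[gaussP n]_x norm_gap x = \int[gaussP n]_x (E2 x - 2 * expR (- 1) * E1 x + expR (- 1) ^+ 2).
  apply: eq_Rintegral => x _; rewrite /norm_gap -/(E1 x).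
  have -> : E2 x = E1 x ^+ 2 by rewrite /E1 -expRM_natl /E2; congr expR; ring.
  by ring.
rewrite (RintegralD measurableT (integrableB measurableT i2 i1') ic) (RintegralB measurableT i2 i1').
rewrite (RintegralZl _ measurableT i1) Rintegral_probability_cst.
rewrite /E1 /E2 !laplace_gauss ?invr_ge0 ?divr_ge0 ?(ltW N0)//.
set c1 := _ ^-1 ^+ n; set c2 := _ ^-1 ^+ n.
(* Equivalent to [(1 + 2 / n) ^ (n / 2) <= e]. The opposite estimate [h2] comes from [n / (n + 4) =
   1 - 4 / (n + 4) <= exp (- 4 / (n + 4))]. *)
have h1 : expR (- 1) <= c2.
  rewrite /c2 exprVn expRN lef_pV2 ?posrE ?expR_gt0 ?exprn_gt0 ?sqrtr_gt0//.
  have -> : expR 1 = expR (n%:R^-1) ^+ n :> R by rewrite -expRM_natl divff// gt_eqF.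
  rewrite ler_pXn2r ?nnegrE ?sqrtr_ge0 ?expR_ge0//; apply: sqrtr_le_expR; last exact: expR_ge1Dx.
  by rewrite addr_ge0// mulr_ge0// invr_ge0 ltW.
have h2 : c1 <= expR (- (2 * n%:R / (n%:R + 4))).
  have -> : - (2 * n%:R / (n%:R + 4)) = n%:R * (- (2 / (n%:R + 4))) :> R by field; rewrite gt_eqF// addr_gt0.
  rewrite expRM_natl /c1 ler_pXn2r ?nnegrE ?invr_ge0 ?sqrtr_ge0 ?expR_ge0// -sqrtrV; last first.
    by rewrite addr_ge0// mulr_ge0// divr_ge0// ltW.
  apply: sqrtr_le_expR.
    by rewrite invr_ge0 addr_ge0// mulr_ge0// divr_ge0// ltW.
  apply: le_trans (expR_ge1Dx _); rewrite le_eqVlt; apply/orP; left; apply/eqP; field.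
  by rewrite !gt_eqF// addr_gt0.
have h3 : expR (- (2 * n%:R / (n%:R + 4))) - expR (- 1) ^+ 2 <= 8 / n%:R :> R.
  have -> : expR (- 1) ^+ 2 = expR (- (2 * n%:R / (n%:R + 4))) * expR (- (8 / (n%:R + 4))) :> R.
    rewrite -expRD -expRM_natl; congr expR; field; rewrite gt_eqF// addr_gt0//.
  have g1 := expR_ge1Dx (- (8 / (n%:R + 4)) : R).
  have /andP[g2 g3] : 0 <= expR (- (2 * n%:R / (n%:R + 4)) : R) <= 1.
    by apply: expRN_unit; rewrite divr_ge0 ?mulr_ge0 ?addr_ge0 ?(ltW N0).
  have g4 : 8 / (n%:R + 4) <= 8 / n%:R :> R by rewrite ler_pM2l// lef_pV2 ?posrE ?addr_gt0// lerDl.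
  have g5 : 0 <= 8 / (n%:R + 4) :> R by rewrite divr_ge0// addr_ge0// ltW.
  have aux (x y z k : R) : 1 - x <= y -> 0 <= z -> z <= 1 -> x <= k -> 0 <= x -> z - z * y <= k by move=> *; nra.
  exact: aux g1 g2 g3 g4 g5.
have h4 := expR_gt0 (- 1 : R).
have aux (x y z k c : R) : y <= x -> c <= z -> z - y ^+ 2 <= k -> 0 < y -> c - 2 * y * x + y ^+ 2 <= k by move=> *; nra.
exact: aux h1 h2 h3 h4.
Qed.

(** [expR (- W)] is strictly monotone in [W]; [d] is the smaller of the squared differences between
    its value at 1 and at the two ends of the window. *)
Lemma expRN_window (h : R) : 0 < h ->
  exists2 d : R, 0 < d & forall W, (expR (- W) - expR (- 1)) ^+ 2 < d -> 1 - h < W < 1 + h.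
Proof.
move=> h0; pose a := expR (- 1) - expR (- (1 + h)); pose b := expR (- (1 - h)) - expR (- 1).
have a0 : 0 < a by rewrite subr_gt0 ltr_expR; lra.
have b0 : 0 < b by rewrite subr_gt0 ltr_expR; lra.
exists (Num.min (a ^+ 2) (b ^+ 2)); first by rewrite lt_min !exprn_gt0.
move=> W; rewrite lt_min => /andP[hA hB]; apply/andP; split.
  rewrite -ltrN2 -ltr_expR.
  suff : expR (- W) - expR (- 1) < b by rewrite /b; lra.
  by rewrite ltNge; apply/negP => hb; move: hB; nra.
rewrite -ltrN2 -ltr_expR.
suff : expR (- 1) - expR (- W) < a by rewrite /a; lra.
by rewrite ltNge; apply/negP => ha; move: hA; nra.
Qed.

Lemma ndot_near p q (x y : 'M[R]_(p, q)) (k rho h : R) : 0 < k -> -1 <= rho <= 0 -> 0 < h < 1 ->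
  1 - h < k * dotm x x < 1 + h -> 1 - h < k * dotm y y < 1 + h ->
  1 - h < k * ((2 - 2 * rho)^-1 * dotm (x - y) (x - y)) < 1 + h -> ndot x y <= rho + 4 * h.
Proof.
move=> k0 /andP[r1 r2] /andP[h0 h1] /andP[x1 x2] /andP[y1 y2] /andP[d1 _].
have hxy : k * dotm x y < rho + 3 * h.
  have e : dotm (x - y) (x - y) = dotm x x + dotm y y - 2 * dotm x y.
    by rewrite dotmDl !dotmDr !dotmNl !dotmNr (dotmC y x); ring.
  move: d1; rewrite mulrCA -ltr_pdivrMl ?invr_gt0; last by lra.
  rewrite invrK e => d1.
  by nra.
have c : dotm x y = ndot x y * (enorm x * enorm y).
  have [x0|x0] := eqVneq (enorm x) 0.
    by move/eqP: x0; rewrite enorm_eq0 => /eqP->; rewrite dotm0l /ndot normalize0 dotm0l mul0r.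
  have [y0|y0] := eqVneq (enorm y) 0.
    by move/eqP: y0; rewrite enorm_eq0 => /eqP->; rewrite dotm0r /ndot normalize0 dotm0r mul0r.
  by rewrite /ndot /normalize dotmZl dotmZr; field; rewrite x0 y0.
pose s := k * (enorm x * enorm y).
have s0 : 0 <= s by rewrite mulr_ge0 ?mulr_ge0 ?enorm_ge0// ltW.
have s2 : s ^+ 2 = (k * dotm x x) * (k * dotm y y) by rewrite /s -!enorm_sqr; ring.
have s3 : s < 1 + h.
  rewrite -(@ltr_pXn2r _ 2) ?nnegrE ?addr_ge0 ?(ltW h0)// s2 expr2.
  by apply: ltr_pM => //; lra.
have s4 : 1 - h < s.
  by rewrite -(@ltr_pXn2r _ 2) ?nnegrE ?subr_ge0 ?(ltW h1)// s2 expr2 ltr_pM// subr_ge0 ltW.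
have e : k * dotm x y = ndot x y * s by rewrite c /s; ring.
have := normr_ndot_le1 x y; rewrite ler_norml => /andP[n1 n2].
by move: hxy; rewrite e; nra.
Qed.

(** A pointwise Markov inequality: as soon as one gap reaches [d], the last term is at least 2, and
    the right-hand side exceeds 1 because [rho >= -1]. *)
Lemma ndot_le_norm_gap n (x y z : 'rV[R]_n) (rho h d : R) : (0 < n)%N -> -1 <= rho <= 0 -> 0 < h < 1 -> 0 < d ->
  (forall W, (expR (- W) - expR (- 1)) ^+ 2 < d -> 1 - h < W < 1 + h) ->
  dotm z z = (2 - 2 * rho)^-1 * dotm (x - y) (x - y) ->
  ndot x y <= rho + 4 * h + 2 / d * (norm_gap x + norm_gap y + norm_gap z).
Proof.
move=> n0 rho1 h01 d0 hd zE; have /andP[r1 _] := rho1; have /andP[h0 _] := h01.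
have dS (u : 'rV[R]_n) : d <= norm_gap u -> 1 <= d^-1 * norm_gap u.
  by move=> hz; rewrite ler_pdivlMl// mulr1.
have dS0 (u : 'rV[R]_n) : 0 <= d^-1 * norm_gap u by rewrite mulr_ge0 ?norm_gap_ge0// invr_ge0 ltW.
have := normr_ndot_le1 x y; rewrite ler_norml => /andP[_ n2].
have -> : 2 / d * (norm_gap x + norm_gap y + norm_gap z) =
    2 * (d^-1 * norm_gap x) + 2 * (d^-1 * norm_gap y) + 2 * (d^-1 * norm_gap z) by ring.
have := dS0 x; have := dS0 y; have := dS0 z => sz sy sx.
have [gx|/dS gx] := ltP (norm_gap x) d; last by lra.
have [gy|/dS gy] := ltP (norm_gap y) d; last by lra.
have [gz|/dS gz] := ltP (norm_gap z) d; last by lra.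
suff : ndot x y <= rho + 4 * h by lra.
apply: (@ndot_near _ _ _ _ n%:R^-1) => //; [by rewrite invr_gt0 ltr0n|exact: hd|exact: hd|].
by rewrite -zE; exact: hd.
Qed.

(** The two Gaussian vectors and their rescaled difference are all images of [w] under isometries,
    hence standard Gaussian; concentration of these three norms locates the angle. *)
Lemma ndot_mean_le (rho e : R) : -1 <= rho <= 0 -> 0 < e ->
  exists2 n : nat, (3 <= n)%N &
   \int[gaussP (n + n)]_w ndot (w *m col_mx 1%:M 0) (w *m col_mx rho%:M (Num.sqrt (1 - rho ^+ 2))%:M)
   <= rho + e.
Proof.
move=> rho1 e0; have /andP[r1 r2] := rho1.
pose h := Num.min (e / 8) 2^-1.
have h0 : 0 < h by rewrite lt_min divr_gt0//= invr_gt0.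
have h1 : h <= 2^-1 by rewrite /h ge_min lexx orbT.
have he : h <= e / 8 by rewrite /h ge_min lexx.
have fin : rho + 4 * h + e / 2 <= rho + e by lra.
have [d d0 hd] := expRN_window h0.
(* Three means of [8 / n], times [2 / d], must not exceed [e / 2], whence 96; the offset 3 meets the
   dimension bound in (H3). *)
pose n := (Num.bound (96 / (d * e))).+3.
have n0 : 0 < n%:R :> R by rewrite ltr0n.
have hn : 48 / (d * n%:R) <= e / 2.
  have : 96 / (d * e) <= n%:R.
    apply: le_trans (ltW (archi_boundP _)) _; first by rewrite divr_ge0 ?mulr_ge0 ?ltW.
    by rewrite ler_nat; do 3 apply: leqW.
  rewrite !ler_pdivrMr ?mulr_gt0//; nra.
exists n => //.
set A := col_mx 1%:M 0 : 'M[R]_(n + n, n).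
set s := Num.sqrt (1 - rho ^+ 2).
have s2 : s ^+ 2 = 1 - rho ^+ 2 by rewrite sqr_sqrtr//; nra.
set B := col_mx rho%:M s%:M : 'M[R]_(n + n, n).
have t0 : 0 < 2 - 2 * rho by lra.
pose t := (Num.sqrt (2 - 2 * rho))^-1.
have t2 : t * t = (2 - 2 * rho)^-1 by rewrite -expr2 exprVn sqr_sqrtr// ltW.
pose D := t *: (A - B).
have AA : A^T *m A = 1%:M by rewrite tr_col_mx mul_row_col trmx1 trmx0 mulmx1 mulmx0 addr0.
have BB : B^T *m B = 1%:M.
  rewrite tr_col_mx mul_row_col !tr_scalar_mx -!scalar_mxM -raddfD/= -!expr2 s2; congr _%:M; ring.
have DE : D = col_mx (t * (1 - rho))%:M (- (t * s))%:M.
  rewrite /D /A /B opp_col_mx add_col_mx scale_col_mx add0r scalerN -raddfB/= !scale_scalar_mx.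
  by rewrite raddfN.
have DD : D^T *m D = 1%:M.
  rewrite DE tr_col_mx mul_row_col !tr_scalar_mx -!scalar_mxM -raddfD/=; congr _%:M.
  have -> : t * (1 - rho) * (t * (1 - rho)) + - (t * s) * - (t * s) = t * t * ((1 - rho) ^+ 2 + s ^+ 2) by ring.
  by rewrite t2 s2; field; rewrite gt_eqF.
have mQ (C : 'M[R]_(n + n, n)) : measurable_fun setT (fun w => norm_gap (w *m C)).
  exact: (measurableT_comp (@measurable_norm_gap n) (measurable_mulmx C)).
have iQ (C : 'M[R]_(n + n, n)) : (gaussP (n + n)).-integrable setT (EFin \o (fun w => norm_gap (w *m C))).
  apply: (@bounded_integrable_probability _ _ _ _ _ 1) => // w.
  by rewrite ger0_norm ?norm_gap_ge0// norm_gap_le1.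
have eQ (C : 'M[R]_(n + n, n)) : C^T *m C = 1%:M ->
    \int[gaussP (n + n)]_w norm_gap (w *m C) <= 8 / n%:R.
  by move=> CC; rewrite (Rintegral_gauss_isometry CC (@measurable_norm_gap n)) norm_gap_mean.
pose S w := norm_gap (w *m A) + norm_gap (w *m B) + norm_gap (w *m D).
have iS1 := integrableD measurableT (iQ A) (iQ B).
have iS : (gaussP (n + n)).-integrable setT (EFin \o S) := integrableD measurableT iS1 (iQ D).
have iS' : (gaussP (n + n)).-integrable setT (EFin \o (fun w => 2 / d * S w)) := integrableZl measurableT (2 / d) iS.
have ic : (gaussP (n + n)).-integrable setT (EFin \o (fun=> rho + 4 * h)).
  by apply: (@bounded_integrable_probability _ _ _ _ _ `|rho + 4 * h|).
have h01 : 0 < h < 1 by rewrite h0 (le_lt_trans h1)// invf_lt1// ltr1n.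
have key w : ndot (w *m A) (w *m B) <= rho + 4 * h + 2 / d * S w.
  apply: (ndot_le_norm_gap _ rho1 h01 d0 hd) => //.
  by rewrite /D -scalemxAr dotmZl dotmZr mulmxBr mulrA t2.
apply: (@le_trans _ _ (\int[gaussP (n + n)]_w (rho + 4 * h + 2 / d * S w))).
  apply: le_Rintegral => //; [exact: integrable_ndot|exact: (integrableD measurableT ic iS')].
rewrite (RintegralD measurableT ic iS') (RintegralZl _ measurableT iS) Rintegral_probability_cst.
rewrite (RintegralD measurableT iS1 (iQ D)) (RintegralD measurableT (iQ A) (iQ B)).
have hS := lerD (lerD (eQ _ AA) (eQ _ BB)) (eQ _ DD).
have : 2 / d * (\int[gaussP (n + n)]_w norm_gap (w *m A) + \int[gaussP (n + n)]_w norm_gap (w *m B) +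
         \int[gaussP (n + n)]_w norm_gap (w *m D)) <= e / 2.
  apply: le_trans hn.
  have -> : 48 / (d * n%:R) = 2 / d * (8 / n%:R + 8 / n%:R + 8 / n%:R).
    by field; rewrite !gt_eqF.
  by rewrite ler_pM2l ?divr_gt0.
by move=> hX; exact: le_trans (lerD (lexx _) hX) fin.
Qed.

End laplace.

(** * Discretised Gaussian graphs *)

Section cells.
Context {R : realType}.

(** Coordinates are continuous, so the sigma-algebra that they generate consists of Borel sets; this
    brings step functions on cells within the scope of (H3). *)
Lemma measurable_borel_rV n (A : set 'rV[R]_n) : measurable A -> borel_rV A.
Proof.
move=> mA; apply: (mA (borel_rV (n := n))); split; first exact: smallest_sigma_algebra.
move=> B; rewrite -bigcup_seq => -[i _ [Y mY <-]].
have mcoor : measurable_fun [set: g_sigma_algebraType (@open 'rV[R]_n)]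
    (fun x : g_sigma_algebraType (@open 'rV[R]_n) => (x : 'rV[R]_n) ord0 i).
  apply: (measurability _ (RGenOInfty.measurableE R)) => _ [_ [x ->] <-].
  rewrite setTI; apply: sub_sigma_algebra.
  apply: (open_comp (f := fun x : 'rV[R]_n => x ord0 i)); last exact: interval_open.
  by move=> z _; exact: coord_continuous.
by have := mcoor measurableT Y mY.
Qed.

Lemma measurable_normalize_coor n (i : 'I_n) :
  measurable_fun setT (fun x : 'rV[R]_n => normalize x ord0 i).
Proof.
have -> : (fun x : 'rV[R]_n => normalize x ord0 i) = (fun x => dotm x x `^ (- 2^-1) * x ord0 i).
  by apply/funext => x; rewrite mxE powRN powR12_sqrt ?dotm_ge0.
apply: measurable_funM; last exact: measurable_coor.
exact: (measurableT_comp (measurable_powR _) (@measurable_dotm_self R n)).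
Qed.

Lemma normalize_coor_le n (x : 'rV[R]_n) i : -1 <= normalize x ord0 i <= 1.
Proof.
rewrite -ler_norml -(@ler_pXn2r _ 2) ?nnegrE// expr1n real_normK ?num_real//.
apply: (@le_trans _ _ (enorm (normalize x) ^+ 2)); last by rewrite exprn_ile1 ?enorm_ge0// enorm_normalize_le.
rewrite enorm_sqr /dotm big_ord1 (bigD1 i)//= -expr2 lerDl.
by apply: sumr_ge0 => j _; rewrite -expr2 sqr_ge0.
Qed.

(** The first point beyond [t] in a grid of step [1 / M] is at most [t + 1 / M]; if [u] exceeded
    that value, this grid point would separate [t] from [u]. *)
Lemma thresholds_close (M : nat) (t u : R) : (0 < M)%N -> -1 <= t -> u <= 1 ->
  (forall k : 'I_(2 * M).+1, k%:R / M%:R - 1 <= u -> k%:R / M%:R - 1 <= t) -> u <= t + M%:R^-1.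
Proof.
move=> M0 t1 u1 h; have Mr0 : 0 < M%:R :> R by rewrite ltr0n.
rewrite leNgt; apply/negP => ut.
have T0 : 0 <= M%:R * (t + 1) by rewrite mulr_ge0 ?ler0n//; lra.
have /andP[k1 k2] := truncn_itv T0; set k := Num.truncn _ in k1 k2.
have ku : k.+1%:R / M%:R - 1 <= u.
  rewrite lerBlDr ler_pdivrMr// -natr1.
  have : M%:R^-1 * M%:R = 1 :> R by rewrite mulVf// gt_eqF.
  by move: ut k1; move: (M%:R^-1) => z; nra.
have kM : (k.+1 < (2 * M).+1)%N.
  rewrite ltnS -(ler_nat R) natrM.
  by move: ku; rewrite lerBlDr ler_pdivrMr//; nra.
have := h (Ordinal kM) ku; rewrite /= lerBlDr ler_pdivrMr//; lra.
Qed.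

(** A cell records how each coordinate of the normalised vector compares with the grid. Within a
    cell these coordinates differ by at most [1 / M], and [n / M ^+ 2 <= n / M <= tau ^+ 2]. *)
Lemma finite_cells n (tau : R) : 0 < tau -> exists (V : finType) (cell : 'rV[R]_n -> V),
  (forall a, measurable [set x | cell x = a]) /\
  (forall x y, cell x = cell y -> enorm (normalize x - normalize y) <= tau).
Proof.
move=> tau0; pose M := (Num.bound (n%:R / tau ^+ 2)).+1.
have M0 : (0 < M)%N by [].
have Mr1 : 1 <= M%:R :> R by rewrite ler1n.
pose th (k : 'I_(2 * M).+1) : R := k%:R / M%:R - 1.
pose cell (x : 'rV[R]_n) : {ffun 'I_n * 'I_(2 * M).+1 -> bool} :=
  [ffun ik => th ik.2 <= normalize x ord0 ik.1].
exists {ffun 'I_n * 'I_(2 * M).+1 -> bool}, cell; split.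
  move=> a.
  have -> : [set x | cell x = a] =
      \bigcap_(ik in [set: 'I_n * 'I_(2 * M).+1]) [set x | (th ik.2 <= normalize x ord0 ik.1) = a ik].
    apply/seteqP; split => [x <- ik _ /=|x h]; first by rewrite ffunE.
    by apply/ffunP => ik; rewrite ffunE; exact: h.
  apply: fin_bigcap_measurable; first exact: finite_finset.
  move=> ik _.
  have mf : measurable_fun setT (fun x : 'rV[R]_n => th ik.2 <= normalize x ord0 ik.1).
    by apply: measurable_fun_ler => //; exact: measurable_normalize_coor.
  by have := mf measurableT [set a ik] I; rewrite setTI.
move=> x y xy.
have th_xy k i : th k <= normalize x ord0 i = (th k <= normalize y ord0 i).
  by move/ffunP: xy => /(_ (i, k)); rewrite !ffunE.
have close i : `|normalize x ord0 i - normalize y ord0 i| <= M%:R^-1.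
  have /andP[x1 x2] := normalize_coor_le x i; have /andP[y1 y2] := normalize_coor_le y i.
  have h1 : normalize x ord0 i <= normalize y ord0 i + M%:R^-1.
    by apply: thresholds_close => // k; rewrite -/(th k) th_xy.
  have h2 : normalize y ord0 i <= normalize x ord0 i + M%:R^-1.
    by apply: thresholds_close => // k; rewrite -/(th k) th_xy.
  by rewrite ler_norml; apply/andP; split; lra.
rewrite -(@ler_pXn2r _ 2) ?nnegrE ?enorm_ge0 ?(ltW tau0)// enorm_sqr /dotm big_ord1.
apply: (@le_trans _ _ (\sum_(i < n) M%:R^-1)).
  apply: ler_sum => i _; have := close i; rewrite !mxE; move: (_ - _) => z hz.
  rewrite -expr2 -real_normK ?num_real//.
  apply: (@le_trans _ _ (M%:R^-1 ^+ 2)); first by rewrite lerXn2r ?nnegrE.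
  rewrite expr2 ler_piMl ?invr_ge0// invf_le1//; lra.
rewrite sumr_const card_ord -[X in X <= _]mulr_natl.
have hM : n%:R / tau ^+ 2 <= M%:R.
  apply: le_trans (ltW (archi_boundP _)) _; first by rewrite divr_ge0 ?exprn_ge0 ?(ltW tau0).
  by rewrite ler_nat.
rewrite ler_pdivrMr; last by lra.
by rewrite mulrC -ler_pdivrMr ?exprn_gt0.
Qed.

(** * The joint law of the cells of a correlated pair *)

Section cell_law.
Context {V : finType} {n : nat}.
Variables (A B : 'M[R]_(n + n, n)) (cell : 'rV[R]_n -> V).
Hypothesis mcell : forall a, measurable [set x | cell x = a].

Definition cell_ind (a c : V) (w : 'rV[R]_(n + n)) : R :=
  (cell (w *m A) == a)%:R * (cell (w *m B) == c)%:R.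

Definition cell_law (a c : V) : R := \int[gaussP (n + n)]_w cell_ind a c w.

Lemma cell_ind_unit a c w : 0 <= cell_ind a c w <= 1.
Proof. by rewrite /cell_ind; do 2 case: eqP => _; rewrite ?mulr1 ?mulr0 ?lexx ?ler01. Qed.

Let measurable_cell_eq (C : 'M[R]_(n + n, n)) a :
  measurable_fun setT (fun w : 'rV[R]_(n + n) => (cell (w *m C) == a)%:R : R).
Proof.
have -> : (fun w : 'rV[R]_(n + n) => (cell (w *m C) == a)%:R : R) =
    (\1_[set x | cell x = a] : _ -> R) \o (fun w => w *m C).
  by apply/funext => w /=; rewrite indicE; case: eqP => h; [rewrite mem_set|rewrite memNset].
apply: (measurableT_comp _ (measurable_mulmx C)); exact: measurable_indic.
Qed.

Lemma integrable_cell_ind a c : (gaussP (n + n)).-integrable setT (EFin \o cell_ind a c).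
Proof.
apply: (@bounded_integrable_probability _ _ _ _ _ 1); first exact: measurable_funM.
by move=> w; have /andP[h1 h2] := cell_ind_unit a c w; rewrite ger0_norm.
Qed.

Lemma cell_ind_sum (Phi : V -> V -> R) w :
  Phi (cell (w *m A)) (cell (w *m B)) = \sum_a \sum_c cell_ind a c w * Phi a c.
Proof.
rewrite (bigD1 (cell (w *m A)))//= [X in _ + X]big1 ?addr0 => [|a /negbTE aA]; last first.
  by rewrite big1// => c _; rewrite /cell_ind eq_sym aA !mul0r.
rewrite (bigD1 (cell (w *m B)))//= [X in _ + X]big1 ?addr0 => [|c /negbTE cB]; last first.
  by rewrite /cell_ind [_ == c]eq_sym cB mulr0 mul0r.
by rewrite /cell_ind !eqxx !mul1r.
Qed.

Let integrable_term (Phi : V -> V -> R) a c :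
  (gaussP (n + n)).-integrable setT (EFin \o (fun w => cell_ind a c w * Phi a c)).
Proof. exact: (integrableZr measurableT _ (integrable_cell_ind a c)). Qed.

Lemma integrable_cell (Phi : V -> V -> R) :
  (gaussP (n + n)).-integrable setT (EFin \o (fun w => Phi (cell (w *m A)) (cell (w *m B)))).
Proof.
rewrite (_ : (fun w => _) = fun w => \sum_a \sum_c cell_ind a c w * Phi a c); last first.
  by apply/funext => w; exact: cell_ind_sum.
by apply: integrable_Rsum => a _; exact: integrable_Rsum.
Qed.

Lemma mean_cell (Phi : V -> V -> R) :
  \int[gaussP (n + n)]_w Phi (cell (w *m A)) (cell (w *m B)) = \sum_a \sum_c cell_law a c * Phi a c.
Proof.
transitivity (\int[gaussP (n + n)]_w (\sum_a \sum_c cell_ind a c w * Phi a c)).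
  by apply: eq_Rintegral => w _; exact: cell_ind_sum.
rewrite Rintegral_sum => [|a _]; last exact: integrable_Rsum.
apply: eq_bigr => a _; rewrite Rintegral_sum//; apply: eq_bigr => c _.
by rewrite (RintegralZr _ measurableT (integrable_cell_ind a c)).
Qed.

Lemma cell_law_ge0 a c : 0 <= cell_law a c.
Proof. by apply: Rintegral_ge0 => w _; have /andP[] := cell_ind_unit a c w. Qed.

Lemma cell_law_sum : \sum_a \sum_c cell_law a c = 1.
Proof.
rewrite -[RHS](Rintegral_probability_cst (gaussP (n + n)) 1) (mean_cell (fun _ _ => 1)).
by apply: eq_bigr => a _; apply: eq_bigr => c _; rewrite mulr1.
Qed.

End cell_law.

Lemma borel_measurable_cell (V : finType) n k (cell : 'rV[R]_n -> V) (b : V -> 'rV[R]_k) :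
  (forall a, measurable [set x | cell x = a]) -> borel_measurable_rV (b \o cell).
Proof.
move=> mcell B _; apply: measurable_borel_rV.
have -> : (b \o cell) @^-1` B = \bigcup_(a in [set a | B (b a)]) [set x | cell x = a].
  by apply/seteqP; split => [x Bx|x [a Ba /= xa]]; [exists (cell x)|rewrite /preimage/= xa].
by apply: fin_bigcup_measurable => //; exact: finite_finset.
Qed.

Lemma gap_graph (rho e : R) : hyp_H3 R -> -1 <= rho <= 0 -> 0 < e ->
  exists (k : nat) (w : 'I_k -> 'I_k -> R),
  [/\ wgraph w, QMaxCut w <= 4^-1 - 4^-1 * Fstar3 rho + e & 4^-1 - 3 / 4 * rho - e <= SDP_QMC w].
Proof.
move=> H3 rho1 e0; have /andP[r1 r2] := rho1.
(* The concentration error costs [h] and the cell size [2 * h]: half of [e] is spent here and half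
   in [blowup], and [10^-1] keeps [rho + 3 * h] below the [3^-1] that [blowup] requires. *)
pose h := Num.min (e / 6) 10^-1.
have h0 : 0 < h by rewrite lt_min divr_gt0//= invr_gt0.
have he : h <= e / 6 by rewrite /h ge_min lexx.
have h1 : h <= 10^-1 by rewrite /h ge_min lexx orbT.
have [n n3 hn] := ndot_mean_le rho1 h0.
have [V [cell [mcell hcell]]] := finite_cells n h0.
set A := col_mx 1%:M 0 in hn; set s := Num.sqrt (1 - rho ^+ 2) in hn; set B := col_mx rho%:M s%:M in hn.
pose p := cell_law A B cell.
(* The direction of a representative; an empty cell gets 0. *)
pose g (a : V) : 'rV[R]_n :=
  if pselect (exists x, cell x = a) is left ex then normalize (projT1 (cid ex)) else 0.
have g1 a : enorm (g a) <= 1.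
  rewrite /g; case: pselect => [ex|_]; first exact: enorm_normalize_le.
  by rewrite /enorm dotm0l sqrtr0.
have gc x : enorm (g (cell x) - normalize x) <= h.
  rewrite /g; case: pselect => [ex|[]]; last by exists x.
  by apply: hcell; case: (cid ex).
have g2 a : dotm (g a) (g a) <= 1 by rewrite -enorm_sqr exprn_ile1// enorm_ge0.
have gn x y : dotm (g (cell x)) (g (cell y)) <= ndot x y + 2 * h.
  have -> : dotm (g (cell x)) (g (cell y)) =
     ndot x y + (dotm (g (cell x) - normalize x) (g (cell y)) + dotm (normalize x) (g (cell y) - normalize y)).
    by rewrite /ndot !dotmDl !dotmDr !dotmNl !dotmNr; ring.
  rewrite lerD2l (_ : 2 * h = h + h); last by ring.
  apply: lerD.
    apply: le_trans (dotm_le _ _) _; apply: le_trans (_ : h * 1 <= _); last by rewrite mulr1.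
    by rewrite ler_pM ?enorm_ge0.
  apply: le_trans (dotm_le _ _) _; apply: le_trans (_ : 1 * h <= _); last by rewrite mul1r.
  by rewrite ler_pM ?enorm_ge0 ?enorm_normalize_le.
have gsum : \sum_a \sum_c p a c * dotm (g a) (g c) <= rho + 3 * h.
  rewrite -(mean_cell A B mcell (fun a c => dotm (g a) (g c))).
  have ic : (gaussP (n + n)).-integrable setT (EFin \o (fun=> 2 * h)).
    by apply: (@bounded_integrable_probability _ _ _ _ _ `|2 * h|).
  have ind : (gaussP (n + n)).-integrable setT (EFin \o (fun w => ndot (w *m A) (w *m B))) by exact: integrable_ndot.
  apply: (@le_trans _ _ (\int[gaussP (n + n)]_w (ndot (w *m A) (w *m B) + 2 * h))).
    apply: le_Rintegral => //; first exact: (integrable_cell A B mcell (fun a c => dotm (g a) (g c))).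
    exact: (integrableD measurableT ind ic).
  rewrite (RintegralD measurableT ind ic) Rintegral_probability_cst.
  by apply: le_trans (lerD hn (lexx _)) _; lra.
have Fp (b : V -> 'rV[R]_3) : (forall a, in_ball (b a)) ->
    Fstar3 rho <= \sum_a \sum_c p a c * dotm (b a) (b c).
  move=> b1; have rho11 : -1 <= rho <= 1 by rewrite r1 (le_trans r2).
  have := H3 n n3 rho rho1 (b \o cell) (borel_measurable_cell b mcell) (fun x => b1 (cell x)).
  rewrite (Stab_fopt3 n3 rho11) => /le_trans; apply.
  rewrite -(mean_cell A B mcell (fun a c => dotm (b a) (b c))) /Stab.
  have E : (fun w : 'rV[R]_(n + n) => dotm ((b \o cell) (lsubmx w))
      ((b \o cell) (rho *: lsubmx w + Num.sqrt (1 - rho ^+ 2) *: rsubmx w))) =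
      (fun w => dotm (b (cell (w *m A))) (b (cell (w *m B)))).
    apply/funext => w /=; congr (dotm (b (cell _)) (b (cell _))).
      by rewrite -[w in RHS]hsubmxK mul_row_col mulmx1 mulmx0 addr0.
    by rewrite -[w in RHS]hsubmxK mul_row_col !mul_mx_scalar.
  rewrite E (@gaussE_integral _ _ _ 1)//.
    apply/measurable_EFinP.
    by have /measurable_int := integrable_cell A B mcell (fun a c => dotm (b a) (b c)).
  move=> w; apply: le_trans (normr_dotm_le _ _) _.
  by rewrite mulr_ile1 ?enorm_ge0//; exact: b1.
have F1 : -1 <= Fstar3 rho.
  have := @Fstar3_norm_le1 R rho; rewrite r1 (le_trans r2)// => /(_ isT).
  by rewrite ler_norml => /andP[].
have r3 : rho + 3 * h <= 3^-1 by lra.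
have e2 : 0 < e / 2 by rewrite divr_gt0.
have [k [w [wg q sd]]] := blowup (cell_law_ge0 A B cell) (cell_law_sum A B mcell) F1 Fp g2 r3 gsum e2.
by exists k, w; split => //; move: q sd he; lra.
Qed.

End cells.

(** * The approximation ratio *)

Section ratio.
Context {R : realType}.

Let num (rho : R) := 4^-1 - 4^-1 * Fstar3 rho.
Let den (rho : R) := 4^-1 - 3 / 4 * rho.

Let num_ge0 rho : -1 <= rho <= 1 -> 0 <= num rho.
Proof. by move=> /Fstar3_norm_le1; rewrite ler_norml /num => /andP[_]; lra. Qed.

Let den_gt0 rho : rho < 3^-1 -> 0 < den rho.
Proof. by rewrite /den; lra. Qed.

Let ratio_ge0 rho : -1 <= rho -> rho < 3^-1 -> 0 <= num rho / den rho.
Proof.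
move=> r1 r2; apply: divr_ge0; last by rewrite ltW// den_gt0.
by apply: num_ge0; rewrite r1/=; lra.
Qed.

Lemma alphaGP_ge0 : 0 <= alphaGP R.
Proof.
apply: lb_le_inf; first by exists (num (-1) / den (-1)), (-1) => //=; split; [lra|lra].
by move=> _ [rho [r1 r2] <-]; exact: ratio_ge0.
Qed.

Lemma alphaGP_le rho : -1 <= rho -> rho < 3^-1 -> alphaGP R * den rho <= num rho.
Proof.
move=> r1 r2; rewrite -ler_pdivlMr ?den_gt0//; apply: ge_inf; last by exists rho.
by exists 0 => _ [r [h1 h2] <-]; exact: ratio_ge0.
Qed.

Lemma dotm_delta n (u v : 'I_n) :
  dotm (delta_mx ord0 u : 'rV[R]_n) (delta_mx ord0 v) = (u == v)%:R.
Proof.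
rewrite /dotm big_ord1 (bigD1 u)//= big1 ?addr0 => [|k ku]; last by rewrite !mxE (negbTE ku) mul0r.
by rewrite !mxE !eqxx mul1r.
Qed.

(** Orthonormal vectors are feasible; the bound keeps every denominator in the infimum positive. *)
Lemma SDP_QMC_ge4 n (w : 'I_n -> 'I_n -> R) : wgraph w -> 4^-1 <= SDP_QMC w.
Proof.
move=> wg; pose f (u : 'I_n) : 'rV[R]_n := delta_mx ord0 u.
apply: le_trans (SDP_QMC_ge wg (f := f) _); last by move=> u; rewrite dotm_delta eqxx.
have [_ _ _ w1] := wg.
rewrite -[leLHS]mul1r -w1 mulr_suml; apply: ler_sum => u _; rewrite mulr_suml; apply: ler_sum => v uv.
suff -> : dotm (f u) (f v) = 0 by rewrite mulr0 subr0.
by rewrite dotm_delta -val_eqE/= ltn_eqF.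
Qed.

Lemma QMaxCut_ge_SDP n (w : 'I_n -> 'I_n -> R) : wgraph w -> alphaGP R * SDP_QMC w <= QMaxCut w.
Proof.
move=> wg.
have h (f : 'I_n -> 'rV[R]_n) : (forall u, dotm (f u) (f u) = 1) ->
    alphaGP R * (\sum_(u < n) \sum_(v < n | (u < v)%N) w u v * (4^-1 - 3 / 4 * dotm (f u) (f v))) <= QMaxCut w.
  move=> f1; apply: le_trans (rounding wg f1); rewrite mulr_sumr; apply: ler_sum => u _.
  rewrite mulr_sumr; apply: ler_sum => v _; rewrite mulrCA; apply: ler_wpM2l; first by case: wg.
  have fuv : -1 <= dotm (f u) (f v) <= 1.
    by rewrite -ler_norml (le_trans (normr_dotm_le _ _))// /enorm !f1 sqrtr1 mulr1.
  have [r3|r3] := ltP (dotm (f u) (f v)) 3^-1.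
    by apply: alphaGP_le => //; case/andP: fuv.
  (* [den] is nonpositive here, so the SDP term is at most 0 while the rounded term is
     nonnegative. *)
  apply: le_trans (num_ge0 fuv); rewrite mulr_ge0_le0 ?alphaGP_ge0//; lra.
pose f0 (u : 'I_n) : 'rV[R]_n := delta_mx ord0 u.
have f01 u : dotm (f0 u) (f0 u) = 1 by rewrite dotm_delta eqxx.
(* Passing to the supremum divides by [alphaGP]; if it is 0, a single feasible point gives the
   claim. *)
have := alphaGP_ge0; rewrite le_eqVlt => /orP[/eqP a0|a0].
  by have := h f0 f01; rewrite -a0 !mul0r.
rewrite mulrC -ler_pdivlMr//; apply: ge_sup; first by eexists; exists f0; [exact: f01|].
by move=> _ [f f1 <-]; rewrite ler_pdivlMr// mulrC; exact: h.
Qed.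

Lemma ratio_half rho : 0 <= rho -> rho < 3^-1 -> 2^-1 <= num rho / den rho.
Proof.
move=> r0 r3; rewrite ler_pdivlMr ?den_gt0//.
by have := Fstar3_le r0 r3; rewrite /num /den; lra.
Qed.

(** The denominator at -1 equals 1, and [F >= -1] bounds the numerator by 1/2. *)
Lemma ratio_opp1 : num (-1) / den (-1) <= 2^-1.
Proof.
have : `|Fstar3 (-1 : R)| <= 1 by apply: Fstar3_norm_le1; rewrite lexx/=; lra.
rewrite ler_norml => /andP[h _]; rewrite ler_pdivrMr ?den_gt0//; last by lra.
by rewrite /num /den; lra.
Qed.

End ratio.

Theorem theorem2p7 (R : realType) :
  hyp_H3 R ->
  inf [set r : R | exists (n : nat) (w : 'I_n -> 'I_n -> R),
         wgraph w /\ r = QMaxCut w / SDP_QMC w] = alphaGP R.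
Proof.
move=> H3; set S := [set r : R | _].
have Slb : lbound S (alphaGP R).
  move=> _ [n [w [wg ->]]]; rewrite ler_pdivlMr; first exact: QMaxCut_ge_SDP.
  by apply: lt_le_trans (SDP_QMC_ge4 wg); rewrite invr_gt0.
have S0 : S !=set0.
  have r0 : -1 <= (0 : R) <= 0 by rewrite lexx andbT; lra.
  have [k [w [wg _ _]]] := gap_graph H3 r0 ltr01.
  by exists (QMaxCut w / SDP_QMC w), k, w.
have aS : alphaGP R <= inf S by exact: lb_le_inf.
have I0 : 0 <= inf S by exact: le_trans alphaGP_ge0 aS.
have neg rho : -1 <= rho <= 0 -> inf S <= (4^-1 - 4^-1 * Fstar3 rho) / (4^-1 - 3 / 4 * rho).
  move=> rho1; have /andP[r1 r2] := rho1.
  rewrite ler_pdivlMr; last by lra.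
  apply/ler_addgt0Pr => e e0.
  (* The errors of [gap_graph] in [QMaxCut] and in the SDP value add up to [d + inf S * d], hence
     the factor [1 + inf S]. *)
  have d0 : 0 < e / (1 + inf S) by rewrite divr_gt0//; lra.
  have [k [w [wg hq hs]]] := gap_graph H3 rho1 d0.
  have s0 : 0 < SDP_QMC w by apply: lt_le_trans (SDP_QMC_ge4 wg); rewrite invr_gt0.
  have : inf S * SDP_QMC w <= QMaxCut w.
    by rewrite -ler_pdivlMr//; apply: ge_inf; [exists (alphaGP R)|exists k, w].
  have : e / (1 + inf S) * (1 + inf S) = e by rewrite divfK// gt_eqF//; lra.
  move: (e / (1 + inf S)) hq hs => d hq hs; nra.
apply/eqP; rewrite eq_le aS andbT; apply: lb_le_inf.
  by exists ((4^-1 - 4^-1 * Fstar3 (-1)) / (4^-1 - 3 / 4 * -1)), (-1) => //=; split; lra.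
move=> _ [rho [r1 r2] <-].
have [r0|r0] := leP rho 0; first by apply: neg; rewrite r1 r0.
apply: le_trans (ratio_half (ltW r0) r2).
apply: le_trans ratio_opp1; apply: neg; lra.
Qed.
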